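(* Let $n\ge0$ be an integer. There is a single nonzero $x\in\mathbb Z_{\ge0}^{n+1}$ such that $$Q_{F,r(n)}(x)<0\quad\text{for every normalized admissible }F$$ if and only if $n=0$ or $n$ is odd. In those cases $x$ can be chosen with all coordinates strictly positive and symmetric, i.e. $x_k=x_{n-k}$ for $0\le k\le n$. If $n$ is positive and even, then for each individual normalized admissible $F$ there is an integral vector $x\in\mathbb Z^{n+1}$ with strictly positive coordinates, symmetric ($x_k=x_{n-k}$), such that $Q_{F,r(n)}(x)<0$; but there is no nonzero integral vector $x\in\mathbb Z^{n+1}$ such that $Q_{F,r(n)}(x)<0$ for all normalized admissible $F$ simultaneously.
   Context: Critical scale. Let $(P_n)_{n\ge0}$, $\deg P_n=n$, be the orthogonal polynomials on $(-1,1)$ for the weight $\frac{\arcsin x}x\,\mathrm dx$, normalized by $P_n(1)=1$, and let $v_n=(v_{n,0},\dots,v_{n,n})^{\mathsf T}$ be defined by $e^{in\theta}P_n(\cos\theta)=\sum_{k=0}^nv_{n,k}e^{2ik\theta}$ for $\theta\in\mathbb R$. With $\psi=\Gamma'/\Gamma$, put $$A_n=\left(\log2+\psi\left(\tfrac{1+|i-j|}2\right)\right)_{0\le i,j\le n},\qquad t_n=v_n^{\mathsf T}A_nv_n,\qquad r(n)=2\pi e^{-t_n}.$$ Test functions. Consider even functions $F:\mathbb R\to\mathbb R$ such that: $F(x)e^{\varepsilon|x|}$ is integrable and of bounded variation on $\mathbb R$ for some $\varepsilon>1/2$; $(F(x)-F(0))/x$ is of bounded variation on $\mathbb R\setminus\{0\}$;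 and $F$ equals the arithmetic mean of its one-sided limits at each point. Such an $F$ is called admissible if it is nonzero, nonnegative, and satisfies $$\widehat G(u)=\int_{\mathbb R}G(x)e^{-2\pi ixu}\,\mathrm dx\ge0\quad(u\in\mathbb R),\qquad G(x)=F(x)\cosh(x/2).$$ It is normalized if $F(0)=1$. Quadratic forms. For a normalized admissible $F$ put $H_F(t)=e^{-t/2}F(t)$ for $t\ge0$, and $$\psi_{H_F}(s)=\int_0^\infty\left(H_F(0)\frac{e^{-t}}t-\frac{H_F(t)e^{-st}}{1-e^{-t}}\right)\mathrm dt\qquad(s\ge0).$$ For $x=(x_0,\dots,x_n)\in\mathbb R^{n+1}$ put $\phi_n(x)=\sum_{j=0}^nx_j$ and $q_n^{H_F}(x)=\sum_{i,j=0}^nx_ix_j\,\psi_{H_F}(|i-j|)$. For real $r>0$ define $$Q_{F,r}(x)=\log(2\pi/r)\,\phi_n(x)^2-q_n^{H_F}(x).$$ *)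

(* Defs.v *)
From mathcomp Require Export all_boot all_order all_algebra.
From mathcomp Require Export all_classical all_reals all_analysis.
From mathcomp Require Export complex.

Set Implicit Arguments.
Unset Strict Implicit.
Unset Printing Implicit Defensive.

Import Order.TTheory GRing.Theory Num.Theory numFieldNormedType.Exports.

Local Open Scope classical_set_scope.
Local Open Scope ring_scope.
Local Open Scope complex_scope.

(* The library has no Gamma function; this one is meaningful for x > 0. *)
Definition Gamma (R : realType) (x : R) : R :=
  \int[lebesgue_measure]_(t in `]0, +oo[) (t `^ (x - 1) * expR (- t)).

Definition digamma (R : realType) (x : R) : R := derive1 (@Gamma R) x / Gamma x.

Definition cis (R : realType) (a : R) : R[i] := cos a +i* sin a.

Definition cosh (R : realType) (x : R) : R := (expR x + expR (- x)) / 2.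

(* The order on R[i] makes 0 <= fourier G u say that the transform is real and
   nonnegative. *)
Definition fourier (R : realType) (G : R -> R) (u : R) : R[i] :=
  let f x := (G x)%:C * cis (- (2 * pi * x * u)) in
  (\int[lebesgue_measure]_(x in [set: R]) complex.Re (f x)) +i*
  (\int[lebesgue_measure]_(x in [set: R]) complex.Im (f x)).

Section CriticalScale.
Context {R : realType}.

(* At x = 0, where 0^-1 = 0, the value is 0 instead of the limit 1: this does
   not change integrals. *)
Definition arcsin_weight (x : R) : R := asin x / x.

Definition orthogonal_system (P : nat -> {poly R}) : Prop :=
  [/\ forall n, size (P n) = n.+1,
      forall m n, m != n ->
        \int[lebesgue_measure]_(x in `]-1, 1[)
          ((P m).[x] * (P n).[x] * arcsin_weight x) = 0
    & forall n, (P n).[1] = 1].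

Definition trig_coefficients (P : nat -> {poly R}) (n : nat)
    (v : 'cV[R]_n.+1) : Prop :=
  forall theta : R,
    cis (n%:R * theta) * ((P n).[cos theta])%:C =
    \sum_(k < n.+1) (v k 0)%:C * cis (2 * k%:R * theta).

Definition digamma_matrix (n : nat) : 'M[R]_n.+1 :=
  \matrix_(i, j) (ln 2 + digamma ((1 + `|i%:R - j%:R|) / 2)).

Definition critical_exponent (n : nat) (v : 'cV[R]_n.+1) : R :=
  (v^T *m digamma_matrix n *m v) 0 0.

Definition critical_scale (n : nat) (v : 'cV[R]_n.+1) : R :=
  2 * pi * expR (- critical_exponent v).

End CriticalScale.

Section TestFunctions.
Context {R : realType}.

(* The library's bounded_variation only concerns a compact interval; here the
   partitions are all finite increasing sequences of points of A. *)
Definition bounded_variation_on (A : set R) (f : R -> R) : Prop :=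
  exists M : R, forall (a : R) (s : seq R),
    path <%R a s -> (forall x, x \in a :: s -> A x) ->
    variation a (last a s) f s <= M.

Record test_function (F : R -> R) : Prop := TestFunction {
  test_even : forall x, F (- x) = F x;
  test_decay : exists2 eps : R, 1 / 2 < eps &
    let f x := F x * expR (eps * `|x|) in
    lebesgue_measure.-integrable [set: R] (EFin \o f) /\
    bounded_variation_on [set: R] f;
  test_slope :
    bounded_variation_on [set x | x != 0] (fun x => (F x - F 0) / x);
  test_mean : forall x, exists l r : R,
    [/\ F y @[y --> x^'-] --> l, F y @[y --> x^'+] --> r
      & F x = (l + r) / 2]
}.

Record admissible (F : R -> R) : Prop := Admissible {
  admissible_test : test_function F;
  admissible_neq0 : exists x, F x != 0;
  admissible_ge0 : forall x, 0 <= F x;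
  admissible_fourier : forall u, 0 <= fourier (fun x => F x * cosh (x / 2)) u
}.

Definition normalized_admissible (F : R -> R) : Prop :=
  admissible F /\ F 0 = 1.

End TestFunctions.

Section QuadraticForms.
Context {R : realType}.

Definition damped (F : R -> R) (t : R) : R := expR (- t / 2) * F t.

Definition psi_of (H : R -> R) (s : R) : R :=
  \int[lebesgue_measure]_(t in `]0, +oo[)
    (H 0 * (expR (- t) / t) - H t * expR (- (s * t)) / (1 - expR (- t))).

Definition phi_form (n : nat) (x : 'cV[R]_n.+1) : R := \sum_(j < n.+1) x j 0.

Definition q_form (H : R -> R) (n : nat) (x : 'cV[R]_n.+1) : R :=
  \sum_(i < n.+1) \sum_(j < n.+1)
    x i 0 * x j 0 * psi_of H `|i%:R - j%:R|.

Definition Q_form (F : R -> R) (r : R) (n : nat) (x : 'cV[R]_n.+1) : R :=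
  ln (2 * pi / r) * phi_form x ^+ 2 - q_form (damped F) x.

End QuadraticForms.

Definition Q_int (R : realType) (F : R -> R) (r : R) (n : nat)
    (x : 'cV[int]_n.+1) : R := Q_form F r (map_mx intr x).

Definition positive_vector (n : nat) (x : 'cV[int]_n.+1) : Prop :=
  forall k, 0 < x k 0.

Definition nonneg_vector (n : nat) (x : 'cV[int]_n.+1) : Prop :=
  forall k, 0 <= x k 0.

Definition symmetric_vector (n : nat) (x : 'cV[int]_n.+1) : Prop :=
  forall k, x k 0 = x (rev_ord k) 0.

(* Main.v *)
(* The function sech(x/2) is the pointwise supremum of the normalized admissible
   functions: if F is admissible, G(x) = F(x) cosh(x/2) is positive definite, so
   it is maximal at 0, where it equals 1.  Accordingly
     Q_F(x) = t phi(x)^2 - x^T A x - (a positive semidefinite remainder),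
   where A is the digamma matrix, whose entries are psi_H(|i-j|) for the choice
   F(x) = sech(x/2), and t = v^T A v.  The second differences of the entries of A
   are, up to a factor, the moments of the Chebyshev polynomials against
   arcsin(x)/x; orthogonality of P_n makes A v constant, A v = t 1, with v
   positive, symmetric and of sum 1.  As A is negative definite on the vectors
   of sum 0, t phi(x)^2 - x^T A x >= 0 with equality only on the line of v, and the remainder is positive at v, so that
   Q_F(v) < 0.  Conversely, if Q_F(x) < 0 for all F, then letting a tend to 0 in
   F(x) = exp(-a|x|) sech(x/2) shows that x is a multiple of v.
   It remains to decide when v is rational.  The entries of A are of the form
   A_00 + q, or A_00 + 2 ln 2 + q with q rational for odd |i - j|.  For odd n
   the symmetry of v makes its even and odd entries both sum to 1/2, so ln 2
   drops out of A v = t 1 and v is the unique solution of a rational linear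
   system.  For even n > 0, irrationality of ln 2 and rationality of v would
   force P_n(0) = 0, which is impossible. *)

(* The digamma entries are reached through integrals: [kern s] and log 2 + psi((1 + s)/2) have the
   same increment 2/(s + 1) under s -> s + 2 and the same logarithmic growth, so they agree. Second
   differences of [kern] match Chebyshev moments because sums of consecutive terms are elementary on
   both sides: T_{2m} + T_{2m+2} = 2x T_{2m+1}, and the factor x cancels the denominator of the
   weight. Only the zeroth moment, pi log 2, needs a double integral. Definiteness comes from an
   explicit sum of squares for the matrix x^|i-j|, integrated over x = e^{-t}. Maximality of G at 0
   is not taken from Fourier inversion, since integrability of the transform is not given; Poisson
   averages replace it, and they converge to G because G is the mean of its one-sided limits.
   Rationality of v for odd n is linear algebra: a unique real solution of a rational system is
   rational. For even n and one fixed F, strictness of Q_F(v) < 0 leaves room to round a large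
   multiple of v. Irrationality of ln 2 reduces to e^p not being an integer for positive integers
   p. *)
Require Import Defs.
From mathcomp Require Import ring lra zify measurable_realfun.
Set Implicit Arguments.
Unset Strict Implicit.
Unset Printing Implicit Defensive.
Import Order.TTheory GRing.Theory Num.Theory numFieldNormedType.Exports.
Local Open Scope classical_set_scope.
Local Open Scope ring_scope.

(** * Derivatives and improper integrals *)

(* The same as is_derive, but not a type class: the derivatives computed by the
   instances of is_derive would mix scaling and multiplication. *)
Definition has_der {R : realType} (f : R -> R) (x a : R) : Prop :=
  is_derive x 1 f a.

Section FTC.
Context {R : realType}.
Notation mu := (@lebesgue_measure R).
Implicit Types (f F : R -> R) (D : set R).

Lemma cont_integrable_itv f (a b : R) :
  (forall x, a <= x <= b -> {for x, continuous f}) ->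
  mu.-integrable `[a, b] (EFin \o f).
Proof.
move=> cf; apply: continuous_compact_integrable; first exact: segment_compact.
apply: continuous_in_subspaceT => x; rewrite inE/= in_itv/=; exact: cf.
Qed.

Lemma FTC_segment f F (a b : R) : a <= b ->
  (forall x, a <= x <= b -> has_der F x (f x)) ->
  (forall x, a <= x <= b -> {for x, continuous f}) ->
  (\int[mu]_(x in `[a, b]) (f x)%:E = (F b - F a)%:E)%E.
Proof.
rewrite le_eqVlt => /predU1P[<- _ _|ab dF cf].
  by rewrite set_itv1 integral_set1 subrr.
have cF x : a <= x <= b -> {for x, continuous F}.
  move=> xab; apply/differentiable_continuous/derivable1_diffP.
  by have [] := dF x xab.
rewrite (@continuous_FTC2 _ f F)//.
- by apply: continuous_in_subspaceT => x; rewrite inE/= in_itv/=; exact: cf.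
- split => [x|//|//].
  + by rewrite in_itv/= => /andP[ax xb]; have [] := dF x; rewrite ?ltW//.
  + by apply: cvg_at_right_filter; apply: cF; rewrite lexx ltW.
  + by apply: cvg_at_left_filter; apply: cF; rewrite lexx ltW.
- move=> x; rewrite in_itv/= => /andP[ax xb]; rewrite derive1E.
  by have [|_ ->] := dF x; rewrite ?ltW.
Qed.

Section bigcup.
Variables (f F : R -> R) (u v : nat -> R) (D : set R) (l m : R).
Hypothesis uv : forall n, u n <= v n.
Hypothesis u_dec : forall n k, (n <= k)%N -> u k <= u n.
Hypothesis v_inc : forall n k, (n <= k)%N -> v n <= v k.
Hypothesis DE : D = \bigcup_n `[u n, v n]%classic.
Hypothesis dF : forall x, D x -> has_der F x (f x).
Hypothesis cf : forall x, D x -> {for x, continuous f}.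
Hypothesis Fu : F (u n) @[n --> \oo] --> l.
Hypothesis Fv : F (v n) @[n --> \oo] --> m.

Let subD n x : u n <= x <= v n -> D x.
Proof. by move=> xn; rewrite DE; exists n => //=; rewrite in_itv. Qed.

Let mD : measurable D.
Proof. by rewrite DE; exact: bigcupT_measurable. Qed.

Let homoI : {homo (fun n => `[u n, v n]%classic : set R) : n k / (n <= k)%N >-> (n <= k)%O}.
Proof.
move=> n k nk; rewrite subsetEset => x /=; rewrite !in_itv/= => /andP[ux xv].
by rewrite (le_trans (u_dec nk) ux) (le_trans xv (v_inc nk)).
Qed.

Let intf n : mu.-integrable `[u n, v n] (EFin \o f).
Proof. by apply: cont_integrable_itv => x /subD; exact: cf. Qed.

Lemma bigcup_measurable_fun : measurable_fun D f.
Proof.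
rewrite DE; apply/measurable_fun_bigcup => // n.
by have /measurable_int/measurable_EFinP := intf n.
Qed.

Let FTCn n : (\int[mu]_(x in `[u n, v n]) (f x)%:E = (F (v n) - F (u n))%:E)%E.
Proof.
by apply: FTC_segment => // x /subD Dx; [exact: dF|exact: cf].
Qed.

Let cvgF : (F (v n) - F (u n))%:E @[n --> \oo] --> (m - l)%:E.
Proof. by apply: cvg_EFin; [exact: nearW|exact: cvgB]. Qed.

(** Monotone convergence along the segments [[u n, v n]]: for a nonnegative integrand the
    antiderivative yields integrability and value at once. *)
Lemma ge0_FTC_bigcup : (forall x, D x -> 0 <= f x) ->
  mu.-integrable D (EFin \o f) /\ \int[mu]_(x in D) f x = m - l.
Proof.
move=> f0.
have fE : (\int[mu]_(x in D) (f x)%:E = (m - l)%:E)%E.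
  rewrite [in LHS]DE.
  have /= := @ge0_nondecreasing_set_cvg_integral _ (measurableTypeR R) R _ (EFin \o f) mu homoI.
  move=> /(_ (fun=> measurable_itv _)).
  move=> /(_ (fun n => measurable_int _ (intf n))).
  move=> cvgI; apply: (cvg_unique _ (cvgI _)) => //.
    by move=> n x; rewrite in_itv/= lee_fin => /subD; exact: f0.
  by rewrite /= (funext FTCn).
split; last by rewrite /Rintegral fE.
apply/integrableP; split; first by apply/measurable_EFinP; exact: bigcup_measurable_fun.
suff -> : (\int[mu]_(x in D) `|(EFin \o f) x| = (m - l)%:E)%E by rewrite ltry.
rewrite -fE; apply: eq_integral => x; rewrite inE => Dx.
by rewrite /= ger0_norm// f0.
Qed.

(** Integrands that change sign need integrability beforehand; the truncations to [[u n, v n]] are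
    then dominated by |f|. *)
Lemma FTC_bigcup : mu.-integrable D (EFin \o f) ->
  \int[mu]_(x in D) f x = m - l.
Proof.
move=> iD.
pose g n : R -> R := f \_ `[u n, v n]%classic.
have mg n : measurable_fun D (EFin \o g n).
  apply: measurable_funTS; rewrite -restrict_EFin.
  by apply/(measurable_restrictT _ _).1 => //; exact: (measurable_int mu).
have cg : {ae mu, forall x, D x -> (g n x)%:E @[n --> \oo] --> (f x)%:E}.
  apply: aeW => x; rewrite DE => -[N _ /= xN].
  apply: cvg_near_cst; exists N => // k /= Nk.
  rewrite /g patchE mem_set//=.
  by move: Nk => /homoI; rewrite subsetEset; exact.
have := @dominated_convergence _ (measurableTypeR R) R mu _ mD (fun n => EFin \o g n) (EFin \o f)
  (abse \o (EFin \o f)) mg (measurable_int mu iD) cg (integrable_abse iD).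
case.
  apply: aeW => x n Dx; rewrite /= lee_fin /g patchE.
  by case: ifPn => // _; rewrite normr0.
move=> _ _ /= cvgI.
have gE n : (\int[mu]_(x in D) (g n x)%:E = (F (v n) - F (u n))%:E)%E.
  rewrite -FTCn [RHS]integral_mkcond [LHS]integral_mkcond; apply: eq_integral => x _.
  rewrite /g !patchE; case: ifPn => [_|xD]; case: ifPn => //.
  by move=> /set_mem/= xn; move/negP: xD; case; rewrite inE; apply: (@subD n).
have : (\int[mu]_(x in D) (g n x)%:E)%E @[n --> \oo] --> (m - l)%:E.
  by rewrite (funext gE).
by move=> /(cvg_unique _ cvgI); rewrite /Rintegral /= => ->.
Qed.

End bigcup.

Let hn (n : nat) : R := n.+1%:R^-1.

Let hn0 n : 0 < hn n. Proof. by rewrite invr_gt0. Qed.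

Let cvg_hn : hn n @[n --> \oo] --> (0 : R).
Proof. exact: cvg_harmonic. Qed.

Let hn_dec n k : (n <= k)%N -> hn k <= hn n.
Proof. by move=> nk; rewrite lef_pV2 ?posrE// ler_nat. Qed.

Let hn1 n : hn n <= 1.
Proof. by rewrite invf_le1// ler1n. Qed.

Section pinfty.
Variables (f F : R -> R) (a l m : R).
Hypothesis dF : forall x, a < x -> has_der F x (f x).
Hypothesis cf : forall x, a < x -> {for x, continuous f}.
Hypothesis Fa : F x @[x --> a^'+] --> l.
Hypothesis Foo : F x @[x --> +oo] --> m.

Let u n := a + hn n.
Let v n : R := a + n.+1%:R.

Let uv n : u n <= v n.
Proof. by rewrite lerD2l (le_trans (hn1 n))// ler1n. Qed.
Let u_dec n k : (n <= k)%N -> u k <= u n.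
Proof. by move=> nk; rewrite lerD2l hn_dec. Qed.
Let v_inc n k : (n <= k)%N -> v n <= v k.
Proof. by move=> nk; rewrite lerD2l ler_nat. Qed.
Let DE : `]a, +oo[%classic = \bigcup_n `[u n, v n]%classic.
Proof.
apply/seteqP; split => x /=; last first.
  move=> [n _ /=]; rewrite !in_itv/= andbT => /andP[ux _].
  by apply: lt_le_trans ux; rewrite ltrDl.
rewrite in_itv/= andbT => ax.
have : \forall n \near \oo, u n <= x /\ x <= v n.
  have h1 : \forall n \near \oo, hn n <= x - a.
    by apply: (cvgr_le 0) => //; rewrite subr_gt0.
  near=> n; split.
    by rewrite -lerBrDl; near: n.
  rewrite -lerBlDl (@le_trans _ _ n%:R)// ?ler_nat//.
  by near: n; exact: nbhs_infty_ger.
by move=> [N _ /(_ N (leqnn _))[h1 h2]]; exists N => //=; rewrite in_itv/= h1.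
Unshelve. all: by end_near. Qed.
Let Fu : F (u n) @[n --> \oo] --> l.
Proof.
move/cvg_at_rightP : Fa; apply; split => [n|]; first by rewrite ltrDl.
by rewrite -[X in _ --> X]addr0; apply: cvgD => //; exact: cvg_cst.
Qed.
Let Fv : F (v n) @[n --> \oo] --> m.
Proof.
move/cvg_pinftyP : Foo; apply; apply/cvgryPge => A.
near=> n; rewrite -lerBlDl (@le_trans _ _ n%:R)// ?ler_nat//.
by near: n; exact: nbhs_infty_ger.
Unshelve. all: by end_near. Qed.
Let dF' x : `]a, +oo[%classic x -> has_der F x (f x).
Proof. by rewrite /= in_itv/= andbT; exact: dF. Qed.
Let cf' x : `]a, +oo[%classic x -> {for x, continuous f}.
Proof. by rewrite /= in_itv/= andbT; exact: cf. Qed.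

Lemma ge0_FTCy : (forall x, a < x -> 0 <= f x) ->
  mu.-integrable `]a, +oo[ (EFin \o f) /\ \int[mu]_(x in `]a, +oo[) f x = m - l.
Proof.
move=> f0; apply: (ge0_FTC_bigcup uv u_dec v_inc DE dF' cf' Fu Fv) => x /=.
by rewrite in_itv/= andbT; exact: f0.
Qed.

Lemma FTCy : mu.-integrable `]a, +oo[ (EFin \o f) ->
  \int[mu]_(x in `]a, +oo[) f x = m - l.
Proof. exact: (FTC_bigcup uv u_dec v_inc DE dF' cf' Fu Fv). Qed.

End pinfty.

Section bounded.
Variables (f F : R -> R) (a b l m : R).
Hypothesis ab : a < b.
Hypothesis dF : forall x, a < x < b -> has_der F x (f x).
Hypothesis cf : forall x, a < x < b -> {for x, continuous f}.
Hypothesis Fa : F x @[x --> a^'+] --> l.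
Hypothesis Fb : F x @[x --> b^'-] --> m.

(** The factor (b - a)/2 keeps [u n <= v n] from n = 0 on, where both equal the midpoint. *)
Let h n := (b - a) / 2 * hn n.
Let u n := a + h n.
Let v n : R := b - h n.

Let h0 n : 0 < h n.
Proof. by rewrite mulr_gt0// divr_gt0// subr_gt0. Qed.
Let h_dec n k : (n <= k)%N -> h k <= h n.
Proof. by move=> nk; rewrite ler_wpM2l ?hn_dec// divr_ge0// subr_ge0 ltW. Qed.
Let hle n : h n <= (b - a) / 2.
Proof. by rewrite ler_piMr// divr_ge0// subr_ge0 ltW. Qed.
Let cvgh : h n @[n --> \oo] --> (0 : R).
Proof. by rewrite -[X in _ --> X](mulr0 ((b - a) / 2)); apply: cvgM => //; exact: cvg_cst. Qed.
Let uv n : u n <= v n.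
Proof. by have := hle n; rewrite /u /v; lra. Qed.
Let u_dec n k : (n <= k)%N -> u k <= u n.
Proof. by move=> nk; rewrite lerD2l h_dec. Qed.
Let v_inc n k : (n <= k)%N -> v n <= v k.
Proof. by move=> nk; rewrite lerD2l lerN2 h_dec. Qed.
Let DE : `]a, b[%classic = \bigcup_n `[u n, v n]%classic.
Proof.
apply/seteqP; split => x /=; last first.
  move=> [n _ /=]; rewrite !in_itv/= => /andP[ux xv].
  by have := h0 n; move: ux xv; rewrite /u /v; lra.
rewrite in_itv/= => /andP[ax xb].
have : \forall n \near \oo, u n <= x /\ x <= v n.
  have h1 : \forall n \near \oo, h n <= x - a.
    by apply: (cvgr_le 0) => //; rewrite subr_gt0.
  have h2 : \forall n \near \oo, h n <= b - x.
    by apply: (cvgr_le 0) => //; rewrite subr_gt0.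
  near=> n; split; first by rewrite -lerBrDl; near: n.
  by rewrite lerBrDr -lerBrDl; near: n.
by move=> [N _ /(_ N (leqnn _))[h1 h2]]; exists N => //=; rewrite in_itv/= h1.
Unshelve. all: by end_near. Qed.
Let Fu : F (u n) @[n --> \oo] --> l.
Proof.
move/cvg_at_rightP : Fa; apply; split => [n|]; first by rewrite ltrDl.
by rewrite -[X in _ --> X]addr0; apply: cvgD => //; exact: cvg_cst.
Qed.
Let Fv : F (v n) @[n --> \oo] --> m.
Proof.
move/cvg_at_leftP : Fb; apply; split => [n|]; first by rewrite ltrBlDr ltrDl.
by rewrite -[X in _ --> X]subr0; apply: cvgB => //; exact: cvg_cst.
Qed.
Let dF' x : `]a, b[%classic x -> has_der F x (f x).
Proof. by rewrite /= in_itv/=; exact: dF. Qed.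
Let cf' x : `]a, b[%classic x -> {for x, continuous f}.
Proof. by rewrite /= in_itv/=; exact: cf. Qed.

Lemma ge0_FTCoo : (forall x, a < x < b -> 0 <= f x) ->
  mu.-integrable `]a, b[ (EFin \o f) /\ \int[mu]_(x in `]a, b[) f x = m - l.
Proof.
move=> f0; apply: (ge0_FTC_bigcup uv u_dec v_inc DE dF' cf' Fu Fv) => x /=.
by rewrite in_itv/=; exact: f0.
Qed.

Lemma FTCoo : mu.-integrable `]a, b[ (EFin \o f) ->
  \int[mu]_(x in `]a, b[) f x = m - l.
Proof. exact: (FTC_bigcup uv u_dec v_inc DE dF' cf' Fu Fv). Qed.

End bounded.

Lemma le_integrableR D f (g : R -> R) : measurable D -> measurable_fun D f ->
  (forall x, D x -> `|f x| <= g x) -> mu.-integrable D (EFin \o g) ->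
  mu.-integrable D (EFin \o f).
Proof.
move=> mD mf fg; apply: le_integrable => //; first exact/measurable_EFinP.
by move=> x Dx; rewrite /= lee_fin (le_trans (fg x Dx))// ler_norm.
Qed.

Lemma integrableDR D f g : measurable D -> mu.-integrable D (EFin \o f) ->
  mu.-integrable D (EFin \o g) -> mu.-integrable D (EFin \o (fun x => f x + g x)).
Proof.
move=> mD fi gi; rewrite /comp; under eq_fun do rewrite EFinD.
exact: integrableD.
Qed.

Lemma integrableBR D f g : measurable D -> mu.-integrable D (EFin \o f) ->
  mu.-integrable D (EFin \o g) -> mu.-integrable D (EFin \o (fun x => f x - g x)).
Proof.
move=> mD fi gi; rewrite /comp; under eq_fun do rewrite EFinB.
exact: integrableB.
Qed.

Lemma integrableZR D f c : measurable D -> mu.-integrable D (EFin \o f) ->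
  mu.-integrable D (EFin \o (fun x => c * f x)).
Proof.
move=> mD fi; rewrite /comp; under eq_fun do rewrite EFinM.
exact: integrableZl.
Qed.

Lemma integrableSR D E f : measurable D -> measurable E -> E `<=` D ->
  mu.-integrable D (EFin \o f) -> mu.-integrable E (EFin \o f).
Proof.
move=> mD mE ED; exact: (@integrableS _ (measurableTypeR R) R mu D E _ mD mE ED).
Qed.

Lemma integrable_sumR D n (f : 'I_n -> R -> R) : measurable D ->
  (forall i, mu.-integrable D (EFin \o f i)) ->
  mu.-integrable D (EFin \o (fun x => \sum_(i < n) f i x)).
Proof.
move=> mD fi; rewrite (_ : _ \o _ = fun x => (\sum_(i < n) (f i x)%:E)%E); last first.
  by apply/funext => x /=; rewrite sumEFin.
by apply: integrable_sum => // i _; exact: fi.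
Qed.

Lemma Rintegral_sum D n (f : 'I_n -> R -> R) : measurable D ->
  (forall i, mu.-integrable D (EFin \o f i)) ->
  \int[mu]_(x in D) (\sum_(i < n) f i x) = \sum_(i < n) \int[mu]_(x in D) f i x.
Proof.
move=> mD; elim: n f => [|n IH] f fi.
  rewrite big_ord0; under eq_Rintegral do rewrite big_ord0.
  by rewrite /Rintegral integral0.
rewrite big_ord_recr/= -IH// -RintegralD//; last exact: integrable_sumR.
by apply: eq_Rintegral => x _; rewrite big_ord_recr.
Qed.

End FTC.

Section pointwise_derivation.
Context {R : realType}.
Implicit Types (f g : R -> R) (x a b c : R).

Lemma der_cst c x : has_der (fun=> c : R) x 0.
Proof. exact: is_derive_cst. Qed.

Lemma der_id x : has_der (fun t : R => t) x 1.
Proof. exact: is_derive_id. Qed.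

Lemma der_add f g x a b : has_der f x a -> has_der g x b ->
  has_der (fun t => f t + g t) x (a + b).
Proof. by move=> fa gb; exact: is_deriveD. Qed.

Lemma der_opp f x a : has_der f x a -> has_der (fun t => - f t) x (- a).
Proof. by move=> fa; exact: is_deriveN. Qed.

Lemma der_mul f g x a b : has_der f x a -> has_der g x b ->
  has_der (fun t => f t * g t) x (a * g x + f x * b).
Proof.
move=> fa gb; have := is_deriveM fa gb.
by rewrite addrC /GRing.scale /= [g x * a]mulrC.
Qed.

Lemma der_inv f x a : f x != 0 -> has_der f x a ->
  has_der (fun t => (f t)^-1) x (- a / f x ^+ 2).
Proof.
move=> f0 fa; have := @is_deriveV _ f x a 1 f0 fa.
by rewrite /GRing.scale /= mulNr [_ * a]mulrC -mulNr.
Qed.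

Lemma der_sum n (f : 'I_n -> R -> R) x (a : 'I_n -> R) :
  (forall i, has_der (f i) x (a i)) ->
  has_der (fun t => \sum_(i < n) f i t) x (\sum_(i < n) a i).
Proof.
move=> fa; rewrite (_ : (fun t => _) = \sum_(i < n) f i).
  exact: is_derive_sum.
by apply/funext => t; rewrite fct_sumE.
Qed.

Lemma der_exprn n f x a : has_der f x a ->
  has_der (fun t => f t ^+ n) x (n%:R * f x ^+ n.-1 * a).
Proof.
by move=> fa; have := is_deriveX n fa; rewrite exprfctE.
Qed.

Lemma der_comp f g x a b : has_der f (g x) a -> has_der g x b ->
  has_der (fun t => f (g t)) x (a * b).
Proof. exact: is_derive1_comp. Qed.

Lemma der_expR f x a : has_der f x a ->
  has_der (fun t => expR (f t)) x (expR (f x) * a).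
Proof. by move=> fa; apply: der_comp fa; exact: is_derive_expR. Qed.

Lemma der_sin f x a : has_der f x a ->
  has_der (fun t => sin (f t)) x (cos (f x) * a).
Proof. by move=> fa; apply: der_comp fa; exact: is_derive_sin. Qed.

Lemma der_cos f x a : has_der f x a ->
  has_der (fun t => cos (f t)) x (- sin (f x) * a).
Proof. by move=> fa; apply: der_comp fa; exact: is_derive_cos. Qed.

Lemma der_ln f x a : 0 < f x -> has_der f x a ->
  has_der (fun t => ln (f t)) x ((f x)^-1 * a).
Proof. by move=> f0 fa; apply: der_comp fa; exact: is_derive1_ln. Qed.

Lemma der_atan f x a : has_der f x a ->
  has_der (fun t => atan (f t)) x ((1 + f x ^+ 2)^-1 * a).
Proof. by move=> fa; apply: der_comp fa; exact: is_derive1_atan. Qed.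

Lemma der_asin f x a : -1 < f x < 1 -> has_der f x a ->
  has_der (fun t => asin (f t)) x ((Num.sqrt (1 - f x ^+ 2))^-1 * a).
Proof. by move=> f1 fa; apply: der_comp fa; exact: is_derive1_asin. Qed.

Lemma der_acos f x a : -1 < f x < 1 -> has_der f x a ->
  has_der (fun t => acos (f t)) x (- (Num.sqrt (1 - f x ^+ 2))^-1 * a).
Proof. by move=> f1 fa; apply: der_comp fa; exact: is_derive1_acos. Qed.

Lemma der_sqrt f x a : 0 < f x -> has_der f x a ->
  has_der (fun t => Num.sqrt (f t)) x ((2 * Num.sqrt (f x))^-1 * a).
Proof. by move=> f0 fa; apply: der_comp fa; exact: is_derive1_sqrt. Qed.

Lemma der_powR p f x a : 0 < f x -> has_der f x a ->
  has_der (fun t => f t `^ p) x (p * f x `^ (p - 1) * a).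
Proof. by move=> f0 fa; apply: (der_comp (f := fun y => y `^ p)) fa; exact: is_derive1_powR. Qed.

(** [der] builds a derivative dictated by the shape of the function; this lemma leaves its
    comparison with the expected value as a separate algebraic goal. *)
Lemma der_eq f x a b : has_der f x a -> a = b -> has_der f x b.
Proof. by move=> fa <-. Qed.

Lemma der_derive1 f x : derivable f x 1 -> has_der f x (derive1 f x).
Proof. by move=> df; rewrite /has_der derive1E; exact: derivableP. Qed.

Lemma der_unique f x a b : has_der f x a -> has_der f x b -> a = b.
Proof. by move=> [_ <-] [_ <-]. Qed.

Lemma der_continuous f x a : has_der f x a -> {for x, continuous f}.
Proof.
by move=> [df _]; apply: differentiable_continuous; exact/derivable1_diffP.
Qed.

End pointwise_derivation.

Ltac der_step := first
  [ apply: der_cst | apply: der_id | apply: der_add | apply: der_opp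
  | apply: der_mul | apply: der_exprn | apply: der_expR | apply: der_sin
  | apply: der_cos | apply: der_ln | apply: der_atan | apply: der_asin
  | apply: der_acos | apply: der_sqrt | apply: der_powR | apply: der_inv ].
Ltac der := repeat der_step.

Section exponential_integrals.
Context {R : realType}.
Notation mu := (@lebesgue_measure R).

Lemma cvgy_expRZ (c : R) : 0 < c -> expR (- (c * x)) @[x --> +oo] --> (0 : R).
Proof.
move=> c0; have cy : c * x @[x --> +oo] --> +oo by exact: gt0_cvgMry.
exact: (cvg_comp _ _ cy (@cvgr_expR R)).
Qed.

Lemma exp_integral (c : R) : 0 < c ->
  mu.-integrable `]0, +oo[ (EFin \o (fun t => expR (- (c * t)))) /\
  \int[mu]_(t in `]0, +oo[) expR (- (c * t)) = c^-1.
Proof.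
move=> c0; have c0' : c != 0 by rewrite gt_eqF.
pose F t : R := - (expR (- (c * t)) / c).
have dF (x : R) : has_der F x (expR (- (c * x))).
  apply: der_eq; first by rewrite /F; der.
  by rewrite /=; field.
have := @ge0_FTCy R (fun t => expR (- (c * t))) F 0 (- c^-1) 0.
rewrite sub0r opprK; apply.
- by move=> x _; exact: dF.
- by move=> x _; apply: der_continuous; der.
- rewrite (_ : - c^-1 = F 0); last by rewrite /F mulr0 oppr0 expR0 mul1r.
  exact/cvg_at_right_filter/der_continuous/dF.
- rewrite -[X in _ --> X]oppr0 -[X in _ --> - X](mul0r c^-1).
  by apply: cvgN; apply: cvgM; [exact: cvgy_expRZ|exact: cvg_cst].
- by move=> x _; exact: expR_ge0.
Qed.

Lemma exp_cos_integral (a b : R) : 0 < a ->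
  mu.-integrable `]0, +oo[ (EFin \o (fun t => expR (- (a * t)) * cos (b * t))) /\
  \int[mu]_(t in `]0, +oo[) (expR (- (a * t)) * cos (b * t)) = a / (a ^+ 2 + b ^+ 2).
Proof.
move=> a0; have d0 : a ^+ 2 + b ^+ 2 != 0.
  by rewrite gt_eqF// ltr_pwDl// ?sqr_ge0// exprn_gt0.
have ab : mu.-integrable `]0, +oo[ (EFin \o (fun t => expR (- (a * t)) * cos (b * t))).
  apply: le_integrableR (exp_integral a0).1 => //.
    apply: measurable_funTS; apply: continuous_measurable_fun => x.
    by apply: der_continuous; der.
  move=> x _; rewrite normrM ger0_norm ?expR_ge0//.
  by rewrite ler_piMr ?expR_ge0// ler_norml cos_geN1 cos_le1.
split => //.
pose F t : R := expR (- (a * t)) * ((b * sin (b * t) - a * cos (b * t)) / (a ^+ 2 + b ^+ 2)).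
have dF (x : R) : has_der F x (expR (- (a * x)) * cos (b * x)).
  apply: der_eq; first by rewrite /F; der.
  by rewrite /=; field.
rewrite (@FTCy R _ F 0 (- (a / (a ^+ 2 + b ^+ 2))) 0) ?sub0r ?opprK//.
- by move=> x _; apply: der_continuous; der.
- rewrite (_ : - _ = F 0); last first.
    by rewrite /F !mulr0 oppr0 expR0 sin0 cos0; field.
  exact/cvg_at_right_filter/der_continuous/dF.
(* The trigonometric factor of [F] stays below M, so the exponential forces the limit 0. *)
- pose M := (`|b| + a) / (a ^+ 2 + b ^+ 2).
  have M0 : 0 <= M.
    by rewrite divr_ge0 ?addr_ge0 ?sqr_ge0// ltW.
  apply/cvgr0Pnorm_le => e e0.
  have /cvgr0Pnorm_le/(_ (e / (M + 1))) := cvgy_expRZ a0.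
  have eM : 0 < e / (M + 1) by rewrite divr_gt0// ltr_wpDl.
  move=> /(_ eM); apply: filterS => x xe.
  rewrite /F normrM (@le_trans _ _ (e / (M + 1) * (M + 1)))//; last first.
    by rewrite divfK// gt_eqF// ltr_wpDl.
  apply: ler_pM => //; rewrite (@le_trans _ _ M) ?lerDl//.
  rewrite normrM normfV [`|_ ^+ 2 + _|]ger0_norm ?addr_ge0 ?sqr_ge0//.
  rewrite ler_wpM2r ?invr_ge0 ?addr_ge0 ?sqr_ge0//.
  rewrite (le_trans (ler_normB _ _))// lerD// normrM ?[`|a|]gtr0_norm//.
    by rewrite ler_piMr// ler_norml sin_geN1 sin_le1.
  by rewrite ler_piMr ?(ltW a0)// ler_norml cos_geN1 cos_le1.
Qed.

(** The integrand is [damped sech], which is also what remains of the kernel between s = 0 and s =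
    1. *)
Lemma ln2_integral :
  mu.-integrable `]0, +oo[ (EFin \o (fun t : R => 2 * expR (- t) / (1 + expR (- t)))) /\
  \int[mu]_(t in `]0, +oo[) (2 * expR (- t) / (1 + expR (- t))) = 2 * ln 2 :> R.
Proof.
have p0 (x : R) : 0 < 1 + expR (- x) by rewrite addr_gt0// expR_gt0.
pose F t : R := - (2 * ln (1 + expR (- t))).
have dF (x : R) : has_der F x (2 * expR (- x) / (1 + expR (- x))).
  apply: der_eq; first by rewrite /F; der.
  by rewrite /=; field; rewrite gt_eqF.
have := @ge0_FTCy R (fun t => 2 * expR (- t) / (1 + expR (- t))) F 0 (- (2 * ln 2)) 0.
rewrite sub0r opprK; apply.
- by move=> x _; exact: dF.
- by move=> x _; apply: der_continuous; der; rewrite gt_eqF.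
- rewrite (_ : - _ = F 0); last by rewrite /F oppr0 expR0.
  exact/cvg_at_right_filter/der_continuous/dF.
- rewrite -[X in _ --> X]oppr0 -[X in _ --> - X](mulr0 2) -ln1.
  apply: cvgN; apply: cvgM; first exact: cvg_cst.
  apply: continuous_cvg; first by apply: continuous_ln.
  rewrite -[X in _ --> X]addr0; apply: cvgD; first exact: cvg_cst.
  exact: cvgr_expR.
- by move=> x _; rewrite divr_ge0// ?mulr_ge0 ?expR_ge0// ltW.
Qed.

End exponential_integrals.

(** * Interchange of integrals on products of measurable sets *)

Section tonelli.
Context {R : realType}.
Notation mu := (@lebesgue_measure R).

Variables (A B : set R) (f : measurableTypeR R * measurableTypeR R -> R).
Hypotheses (mA : measurable A) (mB : measurable B) (mf : measurable_fun setT f).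
Hypothesis f0 : forall x y, A x -> B y -> 0 <= f (x, y).

(** The indicators move the problem to the whole plane while f has to be nonnegative on A x B
    only. *)
Let g (p : measurableTypeR R * measurableTypeR R) : \bar R :=
  (f p * (\1_A p.1 * \1_B p.2))%:E.

Let mg : measurable_fun setT g.
Proof.
apply/measurable_EFinP; apply: measurable_funM => //; apply: measurable_funM.
  by apply: measurableT_comp; [exact: measurable_indic|exact: measurable_fst].
by apply: measurableT_comp; [exact: measurable_indic|exact: measurable_snd].
Qed.

Let g0 p : (0 <= g p)%E.
Proof.
rewrite /g lee_fin !indicE; case: p => x y /=.
have [xA|] := boolP (x \in A); last by rewrite mul0r mulr0.
have [yB|] := boolP (y \in B); last by rewrite !mulr0.
by rewrite !mulr1 f0//; exact: set_mem.
Qed.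

Lemma Rtonelli_measurable : measurable_fun B (fun y => \int[mu]_(x in A) (f (x, y))%:E)%E.
Proof.
have := measurable_funS _ (@subsetT _ B) (@measurable_fun_fubini_tonelli_G _ _ _ _ R mu g mg g0).
move=> /(_ measurableT); apply: eq_measurable_fun => y yB.
rewrite /fubini_G [RHS]integral_mkcond; apply: eq_integral => x _.
by rewrite /g patchE !indicE /= yB; case: ifPn => _; rewrite ?mulr1 ?mulr0.
Qed.

Lemma Rtonelli :
  (\int[mu]_(x in A) \int[mu]_(y in B) (f (x, y))%:E =
   \int[mu]_(y in B) \int[mu]_(x in A) (f (x, y))%:E)%E.
Proof.
have := @fubini_tonelli _ _ (measurableTypeR R) (measurableTypeR R) R mu mu g mg g0.
rewrite [in LHS](_ : (fun x => _) = ((fun x => \int[mu]_(y in B) (f (x, y))%:E)%E \_ A)); last first.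
  apply/funext => x; rewrite patchE; case: ifPn => xA.
    rewrite [RHS]integral_mkcond; apply: eq_integral => y _.
    rewrite /g patchE !indicE /= xA; case: ifPn => _; first by rewrite !mulr1.
    by rewrite !mulr0.
  rewrite -[RHS](integral0 mu setT); apply: eq_integral => y _.
  by rewrite /g indicE /= (negbTE xA) mul0r mulr0.
rewrite [in RHS](_ : (fun y => _) = ((fun y => \int[mu]_(x in A) (f (x, y))%:E)%E \_ B)); last first.
  apply/funext => y; rewrite patchE; case: ifPn => yB.
    rewrite [RHS]integral_mkcond; apply: eq_integral => x _.
    rewrite /g patchE !indicE /= yB; case: ifPn => _; first by rewrite !mulr1.
    by rewrite mul0r mulr0.
  rewrite -[RHS](integral0 mu setT); apply: eq_integral => x _.
  by rewrite /g !indicE /= (negbTE yB) !mulr0.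
by rewrite -!integral_mkcond.
Qed.

End tonelli.

(** * The kernel of [sech]: asymptotics and recurrences *)

Section kernel.
Context {R : realType}.
Notation mu := (@lebesgue_measure R).

(** The quotient is the integral of e^{-ut} over u in [1, z]; after interchanging, the inner
    integral over t is 1/u. *)
Lemma frullani (z : R) : 1 <= z ->
  mu.-integrable `]0, +oo[ (EFin \o (fun t => (expR (- t) - expR (- (z * t))) / t)) /\
  \int[mu]_(t in `]0, +oo[) ((expR (- t) - expR (- (z * t))) / t) = ln z.
Proof.
move=> z1.
pose f (p : measurableTypeR R * measurableTypeR R) : R := expR (- (p.2 * p.1)).
have mf : measurable_fun setT f.
  apply: measurableT_comp; first exact: measurable_expR.
  apply: measurableT_comp; first exact: oppr_measurable.
  by apply: measurable_funM; [exact: measurable_snd|exact: measurable_fst].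
have := @Rtonelli R `]0, +oo[ `[1, z] f (measurable_itv _) (measurable_itv _) mf
  (fun x y _ _ => expR_ge0 _).
have -> : (\int[mu]_(t in `]0%R, +oo[) \int[mu]_(u in `[1%R, z]) (f (t, u))%:E =
    \int[mu]_(t in `]0%R, +oo[) ((expR (- t) - expR (- (z * t))) / t)%:E)%E.
  apply: eq_integral => t; rewrite inE/= in_itv/= andbT => t0.
  rewrite (@FTC_segment R _ (fun u => - (expR (- (u * t)) / t)))//.
  - by rewrite mul1r; congr EFin; field; rewrite gt_eqF.
  - move=> x _; apply: der_eq; first by rewrite /f; der.
    by rewrite /f/=; field; rewrite gt_eqF.
  - by move=> x _; apply: der_continuous; rewrite /f/=; der.
have -> : (\int[mu]_(u in `[1%R, z]) \int[mu]_(t in `]0%R, +oo[) (f (t, u))%:E =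
    \int[mu]_(u in `[1%R, z]) (u^-1)%:E)%E.
  apply: eq_integral => u; rewrite inE/= in_itv/= => /andP[u1 _].
  have u0 : 0 < u by rewrite (lt_le_trans _ u1).
  have [iu uE] := exp_integral u0.
  rewrite -uE /Rintegral fineK//.
  exact: integrable_fin_num iu.
rewrite (@FTC_segment R _ (@ln R))//; last 2 first.
- by move=> x /andP[x1 _]; apply: is_derive1_ln; rewrite (lt_le_trans _ x1).
- move=> x /andP[x1 _]; apply: der_continuous; der.
  by rewrite gt_eqF// (lt_le_trans _ x1).
rewrite ln1 subr0 => E; split; last by rewrite /Rintegral E.
apply/integrableP; split.
  apply/measurable_EFinP; apply: open_continuous_measurable_fun.
    exact: interval_open.
  move=> x; rewrite inE/= in_itv/= andbT => x0; apply: der_continuous; der.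
  by rewrite gt_eqF.
rewrite [ltLHS](_ : _ = (ln z)%:E) ?ltry// -E; apply: eq_integral => t.
rewrite inE/= in_itv/= andbT => t0; rewrite /= ger0_norm//.
apply: divr_ge0; last exact: ltW.
by rewrite subr_ge0 ler_expR lerN2 ler_peMl// ltW.
Qed.

Lemma expRN_lt1 (t : R) : 0 < t -> expR (- t) < 1.
Proof. by move=> t0; rewrite -expR0 ltr_expR oppr_lt0. Qed.

(** Both halves are 1 + x <= e^x, at -t and at t. *)
Lemma inv_onem_expR_bound (t : R) : 0 < t -> 0 <= (1 - expR (- t))^-1 - t^-1 <= 1.
Proof.
move=> t0; have d0 : 0 < 1 - expR (- t) by rewrite subr_gt0 expRN_lt1.
rewrite subr_ge0 lef_pV2 ?posrE//.
have -> /= : 1 - expR (- t) <= t by have := expR_ge1Dx (- t); lra.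
rewrite lerBlDr -[leLHS]mul1r ler_pdivrMr// -subr_ge0.
have -> : (1 + t^-1) * (1 - expR (- t)) - 1 = t^-1 * (1 - expR (- t) * (1 + t)).
  by field; rewrite gt_eqF.
rewrite mulr_ge0 ?invr_ge0 ?(ltW t0)// subr_ge0.
by rewrite expRN mulrC ler_pdivrMr ?expR_gt0// mul1r expR_ge1Dx.
Qed.

Definition sech (x : R) : R := (cosh (x / 2))^-1.

Lemma cosh_gt0 (x : R) : 0 < cosh x.
Proof. by rewrite /cosh divr_gt0// addr_gt0// expR_gt0. Qed.

Lemma damped_sech (t : R) : damped sech t = 2 * expR (- t) / (1 + expR (- t)).
Proof.
rewrite /damped /sech /cosh.
have e0 := expR_gt0 (- (t / 2)); rewrite mulNr.
have -> : expR (t / 2) = (expR (- (t / 2)))^-1 by rewrite expRN invrK.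
have -> : expR (- t) = expR (- (t / 2)) ^+ 2.
  by rewrite expr2 -expRD; congr expR; field.
by field; rewrite !gt_eqF// ?addr_gt0 ?exprn_gt0.
Qed.


Definition kernel_integrand (s t : R) : R :=
  expR (- t) / t - damped sech t * expR (- (s * t)) / (1 - expR (- t)).

(** The subtracted quotient equals 2 e^{-(s+1)t}/(1 - e^{-2t}), with singular part e^{-(s+1)t}/t at
    0. Splitting this off leaves a Frullani integrand and a bounded multiple of e^{-(s+1)t}. *)
Lemma kernel_integrandE (s t : R) : 0 < t ->
  kernel_integrand s t = (expR (- t) - expR (- ((s + 1) * t))) / t
    - expR (- ((s + 1) * t)) * (2 * ((1 - expR (- (2 * t)))^-1 - (2 * t)^-1)).
Proof.
move=> t0; rewrite /kernel_integrand damped_sech.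
have e1 := expRN_lt1 t0; have e0 := expR_gt0 (- t).
have -> : expR (- (2 * t)) = expR (- t) ^+ 2 by rewrite expr2 -expRD; congr expR; ring.
have -> : expR (- ((s + 1) * t)) = expR (- (s * t)) * expR (- t).
  by rewrite -expRD; congr expR; ring.
have e2 : 1 - expR (- t) ^+ 2 = (1 - expR (- t)) * (1 + expR (- t)) by ring.
by rewrite e2; field; rewrite !gt_eqF// ?subr_gt0// addr_gt0.
Qed.

Lemma kernel_remainder (s : R) : 0 <= s ->
  let f t := expR (- ((s + 1) * t)) * (2 * ((1 - expR (- (2 * t)))^-1 - (2 * t)^-1)) in
  mu.-integrable `]0, +oo[ (EFin \o f) /\
  0 <= \int[mu]_(t in `]0, +oo[) f t <= 2 / (s + 1).
Proof.
move=> s0 f; have s1 : 0 < s + 1 by rewrite ltr_wpDl.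
have [ie eE] := exp_integral s1.
have f0 t : 0 < t -> 0 <= f t <= 2 * expR (- ((s + 1) * t)).
  move=> t0; have /inv_onem_expR_bound/andP[h0 h1] : 0 < 2 * t by rewrite mulr_gt0.
  rewrite /f mulr_ge0 ?expR_ge0 ?mulr_ge0//= mulrC ler_wpM2r ?expR_ge0//.
  by rewrite ler_piMr.
have ig := integrableZR (2 : R) (measurable_itv `]0, +oo[) ie.
have iF : mu.-integrable `]0, +oo[ (EFin \o f).
  apply: le_integrableR ig => //; last first.
    by move=> t /=; rewrite in_itv/= andbT => /f0/andP[a b]; rewrite ger0_norm.
  apply: open_continuous_measurable_fun; first exact: interval_open.
  move=> x; rewrite inE/= in_itv/= andbT => x0; apply: der_continuous.
  rewrite /f; der; rewrite gt_eqF// ?subr_gt0 ?mulr_gt0//.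
  by apply: expRN_lt1; rewrite mulr_gt0.
split => //; apply/andP; split.
  by apply: Rintegral_ge0 => t /=; rewrite in_itv/= andbT => /f0/andP[].
rewrite -eE -RintegralZl//; apply: le_Rintegral => // t /=.
by rewrite in_itv/= andbT => /f0/andP[].
Qed.

(* Locked: unfolding it makes conversion tests between values of kern costly. *)
Fact kern_key : unit. Proof. exact: tt. Qed.
Definition kern (s : R) : R := locked_with kern_key (psi_of (damped sech) s).

Lemma kern_psi (s : R) : kern s = psi_of (damped sech) s.
Proof. by rewrite /kern unlock. Qed.

Lemma sech0 : sech 0 = 1 :> R.
Proof. by rewrite /sech /cosh mul0r oppr0 expR0 -[1 + 1]/2%:R divff// invr1. Qed.

Lemma kernE (s : R) : kern s = \int[mu]_(t in `]0, +oo[) kernel_integrand s t.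
Proof.
rewrite kern_psi; apply: eq_Rintegral => t _.
by rewrite /damped sech0 oppr0 mul0r expR0 mulr1 mul1r.
Qed.

Lemma kernel_integrable (s : R) : 0 <= s ->
  mu.-integrable `]0, +oo[ (EFin \o kernel_integrand s).
Proof.
move=> s0; have s1 : 1 <= s + 1 by rewrite lerDr.
have [f1 _] := frullani s1; have [f2 _] := kernel_remainder s0.
have := integrableBR (measurable_itv _) f1 f2.
apply: eq_integrable => // t; rewrite inE/= in_itv/= andbT => t0.
by rewrite kernel_integrandE.
Qed.

(** The Frullani part integrates to ln(s + 1), the regular part to at most 2/(s + 1). This growth
    and the recurrence [kernD2] together determine [kern]. *)
Lemma kern_asymptotic (s : R) : 0 <= s -> `|kern s - ln (s + 1)| <= 2 / (s + 1).
Proof.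
move=> s0; have s1 : 1 <= s + 1 by rewrite lerDr.
have [f1 E1] := frullani s1; have [f2 /andP[h0 h1]] := kernel_remainder s0.
rewrite kernE.
have -> : \int[mu]_(t in `]0, +oo[) kernel_integrand s t =
    \int[mu]_(t in `]0, +oo[) ((expR (- t) - expR (- ((s + 1) * t))) / t
    - expR (- ((s + 1) * t)) * (2 * ((1 - expR (- (2 * t)))^-1 - (2 * t)^-1))).
  apply: eq_Rintegral => t; rewrite inE/= in_itv/= andbT => t0.
  by rewrite kernel_integrandE.
by rewrite RintegralB// E1 addrC addrA addNr add0r normrN ger0_norm.
Qed.

(** Subtracting consecutive integrands produces the factor 1 - e^{-t}, which cancels the singular
    denominator. *)
Lemma kernD1_integral (s : R) : 0 <= s ->
  mu.-integrable `]0, +oo[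
    (EFin \o (fun t => 2 * expR (- ((s + 1) * t)) / (1 + expR (- t)))) /\
  kern (s + 1) - kern s =
    \int[mu]_(t in `]0, +oo[) (2 * expR (- ((s + 1) * t)) / (1 + expR (- t))).
Proof.
move=> s0; have s1 : 0 <= s + 1 by rewrite addr_ge0.
have E t : 0 < t -> kernel_integrand (s + 1) t - kernel_integrand s t =
    2 * expR (- ((s + 1) * t)) / (1 + expR (- t)).
  move=> t0; have e1 := expRN_lt1 t0; have e0 := expR_gt0 (- t).
  rewrite /kernel_integrand damped_sech.
  have -> : expR (- ((s + 1) * t)) = expR (- (s * t)) * expR (- t).
    by rewrite -expRD; congr expR; ring.
  by field; rewrite !gt_eqF// ?subr_gt0// addr_gt0.
split.
  have := integrableBR (measurable_itv _) (kernel_integrable s1) (kernel_integrable s0).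
  apply: eq_integrable => // t; rewrite inE/= in_itv/= andbT => t0.
  by rewrite E.
rewrite !kernE -RintegralB//; try exact: kernel_integrable.
by apply: eq_Rintegral => t; rewrite inE/= in_itv/= andbT => t0; rewrite E.
Qed.

(** A step of 2 produces 1 - e^{-2t}, which cancels the whole denominator and leaves a pure
    exponential. *)
Lemma kernD2 (s : R) : 0 <= s -> kern (s + 2) = kern s + 2 / (s + 1).
Proof.
move=> s0; have s2 : 0 <= s + 2 by rewrite addr_ge0.
have s1 : 0 < s + 1 by rewrite ltr_wpDl.
apply/eqP; rewrite [eqbRHS]addrC -subr_eq; apply/eqP.
have [ie eE] := exp_integral s1.
rewrite -eE -RintegralZl// !kernE -RintegralB//; try exact: kernel_integrable.
apply: eq_Rintegral => t; rewrite inE/= in_itv/= andbT => t0.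
have e1 := expRN_lt1 t0; have e0 := expR_gt0 (- t).
rewrite /kernel_integrand damped_sech.
have -> : expR (- ((s + 1) * t)) = expR (- (s * t)) * expR (- t).
  by rewrite -expRD; congr expR; ring.
have -> : expR (- ((s + 2) * t)) = expR (- (s * t)) * expR (- t) ^+ 2.
  by rewrite expr2 -!expRD; congr expR; ring.
by field; rewrite !gt_eqF// ?subr_gt0// addr_gt0.
Qed.

Lemma kern1B0 : kern 1 - kern 0 = 2 * ln 2.
Proof.
rewrite -ln2_integral.2 -[X in kern X - _]add0r (kernD1_integral (lexx 0)).2.
by apply: eq_Rintegral => t _; rewrite add0r mul1r.
Qed.

End kernel.

(** * The Gamma function and the kernel *)

Section positivity.
Context {R : realType}.
Notation mu := (@lebesgue_measure R).

(** The continuous minorant g has a positive minimum on [a, b]; f itself may be discontinuous, as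
    admissible functions are. *)
Lemma Rintegral_gt0_minorant (D : set R) (f g : R -> R) (a b : R) : measurable D ->
  mu.-integrable D (EFin \o f) -> (forall x, D x -> 0 <= f x) -> a < b ->
  `[a, b] `<=` D -> (forall x, a <= x <= b -> {for x, continuous g}) ->
  (forall x, a <= x <= b -> 0 < g x <= f x) -> 0 < \int[mu]_(x in D) f x.
Proof.
move=> mD fi f0 ab abD cg gf.
have cg' : {within `[a, b], continuous g}.
  by apply: continuous_in_subspaceT => x; rewrite inE/= in_itv/=; exact: cg.
have [c cab gc] := EVT_min (ltW ab) cg'.
have gc0 : 0 < g c by have /andP[] : 0 < g c <= f c by apply: gf; move: cab; rewrite in_itv.
have iab : mu.-integrable `[a, b] (EFin \o f) by exact: (integrableSR mD _ abD fi).
apply: (@lt_le_trans _ _ (\int[mu]_(x in `[a, b]) f x)); last first.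
  rewrite /Rintegral fine_le//; [exact: integrable_fin_num iab|exact: integrable_fin_num fi|].
  by apply: ge0_subset_integral => //; exact: measurable_int fi.
have icst : mu.-integrable `[a, b] (EFin \o cst (g c)).
  by apply: cont_integrable_itv => x _; exact: cst_continuous.
apply: (@lt_le_trans _ _ (\int[mu]_(x in `[a, b]) cst (g c) x)); last first.
  apply: le_Rintegral => // x /=; rewrite in_itv/= => xab.
  by have /andP[_] := gf x xab; apply: le_trans; apply: gc; rewrite in_itv.
rewrite Rintegral_cst//= lebesgue_measure_itv/= lte_fin ab -EFinD/=.
by rewrite mulr_gt0// subr_gt0.
Qed.

Lemma Rintegral_gt0 (D : set R) (f : R -> R) (a b : R) : measurable D ->
  mu.-integrable D (EFin \o f) -> (forall x, D x -> 0 <= f x) -> a < b ->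
  `[a, b] `<=` D -> (forall x, a <= x <= b -> {for x, continuous f}) ->
  (forall x, a <= x <= b -> 0 < f x) -> 0 < \int[mu]_(x in D) f x.
Proof.
move=> mD fi f0 ab abD cf fp; apply: (Rintegral_gt0_minorant mD fi f0 ab abD cf).
by move=> x /fp ->; rewrite lexx.
Qed.

End positivity.

Section gamma.
Context {R : realType}.
Notation mu := (@lebesgue_measure R).

Lemma ln_le_subr1 (x : R) : 0 < x -> ln x <= x - 1.
Proof. by move=> x0; have := expR_ge1Dx (ln x); rewrite lnK ?posrE//; lra. Qed.

(** This is ln y <= y - 1 at y = (1 + t)/p, which also gives the constant p^p e^{1-p}. *)
Lemma powR1D_le (p : R) : 0 < p ->
  exists2 C : R, 0 < C & forall t : R, 0 < t -> expR (- t) <= C * expR (- (p * ln (1 + t))).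
Proof.
move=> p0; exists (expR (1 + p * ln p - p)) => [|t t0]; first exact: expR_gt0.
have t1 : 0 < 1 + t by rewrite addr_gt0.
rewrite -expRD ler_expR.
have := @ln_le_subr1 ((1 + t) / p) (divr_gt0 t1 p0).
rewrite ln_div ?posrE// -(ler_pM2l p0) !mulrBr mulr1.
have -> : p * ((1 + t) / p) = 1 + t by field; rewrite gt_eqF.
lra.
Qed.

Lemma cvg0_powR (z : R) : 0 < z -> expR (z * ln t) @[t --> 0^'+] --> (0 : R).
Proof.
move=> z0; apply/cvgr0Pnorm_le => e e0; near=> t.
have t0 : 0 < t by near: t; exact: nbhs_right_gt.
rewrite ger0_norm ?expR_ge0// -[leRHS]lnK ?posrE// ler_expR.
rewrite mulrC -ler_pdivlMr// -[leRHS]expRK ler_ln ?posrE ?expR_gt0//.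
by near: t; apply: nbhs_right_le; exact: expR_gt0.
Unshelve. all: by end_near. Qed.

Lemma cvgVy : (x : R)^-1 @[x --> +oo] --> (0 : R).
Proof.
apply/(@gtr0_cvgV0 R R _ _ (fun x : R => x)) => //.
exact: nbhs_pinfty_gt.
Qed.

Lemma powR_ln (t p : R) : 0 < t -> t `^ p = expR (p * ln t).
Proof. by move=> t0; rewrite /powR gt_eqF. Qed.

Definition gamma_integrand (z t : R) : R := t `^ (z - 1) * expR (- t).

Lemma gamma_integrandE (z t : R) : 0 < t ->
  gamma_integrand z t = expR ((z - 1) * ln t) * expR (- t).
Proof. by move=> t0; rewrite /gamma_integrand powR_ln. Qed.

Lemma gamma_integrand_ge0 z t : 0 <= gamma_integrand z t.
Proof. by rewrite mulr_ge0 ?powR_ge0 ?expR_ge0. Qed.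

Lemma gamma_integrand_cont z t : 0 < t -> {for t, continuous (gamma_integrand z)}.
Proof. by move=> t0; apply: der_continuous; rewrite /gamma_integrand; der. Qed.

Lemma gamma_integrable (z : R) : 0 < z ->
  mu.-integrable `]0, +oo[ (EFin \o gamma_integrand z).
Proof.
move=> z0; have z1 : 0 < z + 1 by rewrite addr_gt0.
have [C C0 hC] := powR1D_le z1.
(* The majorant t^{z-1} (1 + t)^{-z-1} serves both ends at once and has the antiderivative (t/(1 +
   t))^z / z. *)
pose f t : R := expR ((z - 1) * ln t - (z + 1) * ln (1 + t)).
pose F t : R := expR (z * (ln t - ln (1 + t))) / z.
have [fi _] : mu.-integrable `]0, +oo[ (EFin \o f) /\
    \int[mu]_(t in `]0, +oo[) f t = z^-1 - 0.
  apply: (@ge0_FTCy R f F).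
  - move=> t t0; have t1 : 0 < 1 + t by rewrite addr_gt0.
    apply: der_eq; first by rewrite /F; der.
    rewrite /= /f.
    have -> : (z - 1) * ln t - (z + 1) * ln (1 + t) =
      z * (ln t - ln (1 + t)) - ln t - ln (1 + t) by ring.
    rewrite !expRD !expRN !lnK ?posrE//; field.
    by rewrite !gt_eqF.
  - move=> t t0; have t1 : 0 < 1 + t by rewrite addr_gt0.
    by apply: der_continuous; rewrite /f; der.
  - apply: (@squeeze_cvgr _ _ _ _ (cst 0) (fun t => expR (z * ln t) / z)); last 2 first.
    + exact: cvg_cst.
    + rewrite -[X in _ --> X](mul0r z^-1).
      by apply: cvgM; [exact: cvg0_powR|exact: cvg_cst].
    near=> t; have t0 : 0 < t by near: t; exact: nbhs_right_gt.
    rewrite divr_ge0 ?expR_ge0 ?(ltW z0)//= ler_pM2r ?invr_gt0// ler_expR.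
    by rewrite ler_pM2l// gerBl ln_ge0// lerDl ltW.
  - rewrite -[X in _ --> X]mul1r; apply: cvgM; last exact: cvg_cst.
    rewrite -[X in _ --> X]expR0; apply: continuous_cvg; first exact: continuous_expR.
    rewrite -[X in _ --> X](mulr0 z); apply: cvgM; first exact: cvg_cst.
    apply: (@squeeze_cvgr _ _ _ _ (fun t => - t^-1) (cst 0)); last 2 first.
    + rewrite -[X in _ --> X]oppr0; apply: cvgN; exact: cvgVy.
    + exact: cvg_cst.
    near=> t; have t0 : 0 < t by near: t; exact: nbhs_pinfty_gt.
    have t1 : 0 < 1 + t by rewrite addr_gt0.
    rewrite subr_le0 ler_ln ?posrE// lerDr ler01 andbT.
    rewrite -opprB lerN2 -ln_div ?posrE// (le_trans (ln_le_subr1 _)) ?divr_gt0//.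
    by rewrite mulrDl divff ?gt_eqF// mul1r addrK.
  - by move=> t _; exact: expR_ge0.
apply: le_integrableR (integrableZR C (measurable_itv `]0, +oo[) fi) => //.
  apply: open_continuous_measurable_fun; first exact: interval_open.
  by move=> t; rewrite inE/= in_itv/= andbT => t0; exact: gamma_integrand_cont.
move=> t /=; rewrite in_itv/= andbT => t0.
rewrite ger0_norm ?gamma_integrand_ge0// gamma_integrandE// /f expRD mulrCA.
by rewrite ler_wpM2l ?expR_ge0// hC.
Unshelve. all: by end_near. Qed.

Lemma Gamma_gt0 (z : R) : 0 < z -> 0 < Gamma z.
Proof.
move=> z0; apply: (Rintegral_gt0 (a := 1) (b := 2) _ (gamma_integrable z0)) => //.
- by move=> x _; exact: gamma_integrand_ge0.
- by rewrite ltr1n.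
- by apply: subset_itv; rewrite bnd_simp.
- by move=> x /andP[x1 _]; apply: gamma_integrand_cont; rewrite (lt_le_trans _ x1).
- move=> x /andP[x1 _].
  by rewrite mulr_gt0 ?expR_gt0// powR_gt0// (lt_le_trans _ x1).
Qed.

Lemma gamma_integrandS (z t : R) : 0 < t ->
  gamma_integrand (z + 1) t = t * gamma_integrand z t.
Proof.
move=> t0; rewrite !gamma_integrandE// mulrA; congr (_ * _).
have -> : (z + 1 - 1) * ln t = ln t + (z - 1) * ln t by ring.
by rewrite expRD lnK.
Qed.

Lemma GammaS (z : R) : 0 < z -> Gamma (z + 1) = z * Gamma z.
Proof.
move=> z0; have z1 : 0 < z + 1 by rewrite addr_gt0.
have i0 := gamma_integrable z0; have i1 := gamma_integrable z1.
have iz := integrableZR z (measurable_itv `]0, +oo[) i0.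
apply/eqP; rewrite -subr_eq0 -RintegralZl// -RintegralB//; apply/eqP.
(* Integration by parts: the integrand is the derivative of -t^z e^{-t}, which vanishes at both
   ends. *)
rewrite (@FTCy R (fun t => gamma_integrand (z + 1) t - z * gamma_integrand z t)
  (fun t => - (expR (z * ln t) * expR (- t))) 0 0 0) ?subr0//.
- move=> t t0; apply: der_eq; first by der.
  rewrite /= !gamma_integrandE//.
  have -> : (z + 1 - 1) * ln t = z * ln t by ring.
  have -> : (z - 1) * ln t = z * ln t - ln t by ring.
  by rewrite expRD (expRN (ln t)) lnK ?posrE//; field; rewrite gt_eqF.
- move=> t t0; apply: cvgB; first exact: gamma_integrand_cont.
  by apply: cvgM; [exact: cvg_cst|exact: gamma_integrand_cont].
- rewrite -[X in _ --> X]oppr0 -[X in _ --> - X](mul0r (expR (- 0))).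
  apply: cvgN; apply: cvgM; first exact: cvg0_powR.
  apply: cvg_at_right_filter; apply: (@der_continuous _ (fun t => expR (- t))); der.
- rewrite -[X in _ --> X]oppr0; apply: cvgN.
  have [C C0 hC] := powR1D_le z1.
  apply: (@squeeze_cvgr _ _ _ _ (cst 0) (fun t => C * t^-1)); last 2 first.
  + exact: cvg_cst.
  + rewrite -[X in _ --> X](mulr0 C); apply: cvgM; [exact: cvg_cst|exact: cvgVy].
  near=> t; have t0 : 0 < t by near: t; exact: nbhs_pinfty_gt.
  have t1 : 0 < 1 + t by rewrite addr_gt0.
  rewrite mulr_ge0 ?expR_ge0//=.
  apply: (le_trans (ler_wpM2l (expR_ge0 _) (hC _ t0))).
  rewrite mulrCA -expRD ler_pM2l// -[leRHS]lnK ?posrE ?invr_gt0// ler_expR lnV ?posrE//.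
  have : ln t <= ln (1 + t) by rewrite ler_ln ?posrE// lerDr.
  by rewrite -(ler_pM2l z1); lra.
- exact: integrableBR.
Unshelve. all: by end_near. Qed.

Lemma Gamma_derivative (z : R) : 0 < z ->
  [/\ mu.-integrable `]0, +oo[ (EFin \o (fun t => ln t * gamma_integrand z t)),
   derivable (@Gamma R) z 1 &
   derive1 (@Gamma R) z = \int[mu]_(t in `]0, +oo[) (ln t * gamma_integrand z t)].
Proof.
move=> z0.
(* With u = z/2 this keeps u - d = z/4 positive, so both gamma integrands in [G] are integrable. *)
pose d := z / 4; have d0 : 0 < d by rewrite divr_gt0.
pose u := z / 2; pose v := z + 1.
have uz : u < z by rewrite /u; lra.
have zv : z < v by rewrite /v; lra.
have u0 : 0 < u - d by rewrite /u /d; lra.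
have v0 : 0 < v + d by rewrite /v /d; lra.
pose G t := d^-1 * (gamma_integrand (u - d) t + gamma_integrand (v + d) t).
have iG : mu.-integrable `]0, +oo[ (EFin \o G).
  by apply: integrableZR => //; apply: integrableDR => //; exact: gamma_integrable.
have G0 t : 0 <= G t.
  by rewrite mulr_ge0 ?invr_ge0 ?(ltW d0)// addr_ge0// gamma_integrand_ge0.
have dg x t : 0 < t -> has_der (gamma_integrand ^~ t) x (ln t * gamma_integrand x t).
  move=> t0; rewrite (_ : gamma_integrand ^~ t =
      fun x => expR ((x - 1) * ln t) * expR (- t)); last first.
    by apply/funext => y; rewrite gamma_integrandE.
  by rewrite gamma_integrandE//; apply: der_eq; [der|rewrite /=; ring].
(* The logarithm costs a power of t, by d |ln t| <= e^{d |ln t|}; the exponent u - d dominates for t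
   < 1 and v + d for t >= 1. *)
have bound x t : u < x < v -> 0 < t -> `|ln t * gamma_integrand x t| <= G t.
  move=> /andP[ux xv] t0.
  rewrite normrM [`|gamma_integrand _ _|]ger0_norm ?gamma_integrand_ge0//.
  rewrite /G !gamma_integrandE// -mulrDl !mulrA ler_wpM2r ?expR_ge0//.
  rewrite mulrC ler_pdivlMl//.
  have h1 : d * `|ln t| <= expR (d * `|ln t|).
    by have := expR_ge1Dx (d * `|ln t|); lra.
  rewrite mulrCA (le_trans (ler_wpM2l (expR_ge0 _) h1))// -expRD.
  have [l0|l0] := leP 0 (ln t).
    rewrite (ger0_norm l0) (le_trans (y := expR ((v + d - 1) * ln t)))//.
      by rewrite ler_expR -mulrDl ler_wpM2r//; lra.
    by rewrite lerDr expR_ge0.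
  rewrite (ltr0_norm l0) (le_trans (y := expR ((u - d - 1) * ln t)))//.
    by rewrite ler_expR mulrN -mulrBl ler_wnM2r ?(ltW l0)//; lra.
  by rewrite lerDl expR_ge0.
pose f x t := gamma_integrand x t.
have zI : `]u, v[%classic z by rewrite /= in_itv/= uz.
have fi x : `]u, v[%classic x -> mu.-integrable `]0, +oo[ (EFin \o f x).
  by rewrite /= in_itv/= => /andP[ux _]; apply: gamma_integrable; rewrite (lt_trans _ ux)// divr_gt0.
have df x t : `]u, v[%classic x -> `]0, +oo[%classic t -> derivable (f ^~ t) x 1.
  by move=> _ /=; rewrite in_itv/= andbT => /(dg x)[].
have dfE x t : 0 < t -> partial1of2 f x t = ln t * gamma_integrand x t.
  by move=> t0; rewrite partial1of2E; have [_ ->] := dg x t t0.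
have fG x t : `]u, v[%classic x -> `]0, +oo[%classic t -> `|partial1of2 f x t| <= G t.
  by rewrite /= !in_itv/= andbT => xuv t0; rewrite dfE// bound.
split.
- apply: le_integrableR iG => //.
    apply: open_continuous_measurable_fun; first exact: interval_open.
    move=> t; rewrite inE/= in_itv/= andbT => t0; apply: cvgM.
      exact: continuous_ln.
    exact: gamma_integrand_cont.
  by move=> t /=; rewrite in_itv/= andbT => t0; apply: (bound z); rewrite ?uz.
- exact: (@derivable_under_integral R _ _ mu f _ (measurable_itv _) z u v zI fi df G G0 iG fG).
- rewrite (@differentiation_under_integral R _ _ mu f _ (measurable_itv _) z u v zI fi df G G0 iG fG).
  by apply: eq_Rintegral => t; rewrite inE/= in_itv/= andbT => t0; rewrite -dfE.
Qed.

Lemma digammaS (z : R) : 0 < z -> digamma (z + 1) = digamma z + z^-1.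
Proof.
move=> z0; have z1 : 0 < z + 1 by rewrite addr_gt0.
have [_ d0 _] := Gamma_derivative z0; have [_ d1 _] := Gamma_derivative z1.
have dG := der_derive1 d0; have dG1 := der_derive1 d1.
have dz := der_mul (der_id z) dG.
have ds := der_comp (g := fun x => x + 1) dG1 (der_add (der_id z) (der_cst 1 z)).
have dz' : has_der (fun x => x * Gamma x) z (derive1 (@Gamma R) (z + 1) * (1 + 0)).
  apply: near_eq_is_derive ds; near=> x; rewrite GammaS//.
  by near: x; exact: lt_nbhsr.
have := der_unique dz dz'; rewrite addr0 mulr1 mul1r /digamma GammaS// => <-.
have g0 := Gamma_gt0 z0; by field; rewrite !gt_eqF.
Unshelve. all: by end_near. Qed.

(** Tangent of ln at z, averaged against the Gamma(z) density, whose mean is z: the term t/z - 1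
    integrates to 0. *)
Lemma digamma_le_ln (z : R) : 0 < z -> digamma z <= ln z.
Proof.
move=> z0; have z1 : 0 < z + 1 by rewrite addr_gt0.
have [i1 _ dE] := Gamma_derivative z0; rewrite /digamma dE.
have g0 := Gamma_gt0 z0; rewrite ler_pdivrMr//.
have i0 := gamma_integrable z0; have is1 := gamma_integrable z1.
have ia := integrableZR (ln z - 1) (measurable_itv `]0, +oo[) i0.
have ib := integrableZR z^-1 (measurable_itv `]0, +oo[) is1.
have -> : ln z * Gamma z = \int[mu]_(t in `]0, +oo[)
    ((ln z - 1) * gamma_integrand z t + z^-1 * gamma_integrand (z + 1) t).
  rewrite RintegralD// !RintegralZl// -![Rintegral _ _ _]/(Gamma _) GammaS//.
  by field; rewrite gt_eqF.
apply: le_Rintegral => //; first exact: integrableDR.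
move=> t /=; rewrite in_itv/= andbT => t0.
rewrite gamma_integrandS// [z^-1 * _]mulrA -mulrDl ler_wpM2r ?gamma_integrand_ge0//.
have := @ln_le_subr1 (t / z) (divr_gt0 t0 z0).
by rewrite ln_div ?posrE//; rewrite [z^-1 * t]mulrC; lra.
Qed.

(** The opposite bound ln t >= ln z + 1 - z/t, averaged against the Gamma(z + 1) density, for which
    1/t has mean 1/z. *)
Lemma ln_le_digamma (z : R) : 0 < z -> ln z <= digamma (z + 1).
Proof.
move=> z0; have z1 : 0 < z + 1 by rewrite addr_gt0.
have [i1 _ dE] := Gamma_derivative z1; rewrite /digamma dE.
have g0 := Gamma_gt0 z0; have g1 := Gamma_gt0 z1; rewrite ler_pdivlMr//.
have i0 := gamma_integrable z0; have is1 := gamma_integrable z1.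
have ia := integrableZR (ln z + 1) (measurable_itv `]0, +oo[) is1.
have ib := integrableZR z (measurable_itv `]0, +oo[) i0.
have -> : ln z * Gamma (z + 1) = \int[mu]_(t in `]0, +oo[)
    ((ln z + 1) * gamma_integrand (z + 1) t - z * gamma_integrand z t).
  rewrite RintegralB// !RintegralZl// -![Rintegral _ _ _]/(Gamma _) GammaS//.
  by ring.
apply: le_Rintegral => //; first exact: integrableBR.
move=> t /=; rewrite in_itv/= andbT => t0.
rewrite gamma_integrandS// [ln t * _]mulrA [(ln z + 1) * _]mulrA -mulrBl ler_wpM2r ?gamma_integrand_ge0//.
have h : ln z - ln t <= z / t - 1.
  by rewrite -ln_div ?posrE//; apply: ln_le_subr1; exact: divr_gt0.
have := ler_wpM2l (ltW t0) h.
have -> : t * (z / t - 1) = z - t by field; rewrite gt_eqF.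
by rewrite mulrBr; lra.
Qed.

End gamma.

(** * Identification of the kernel with the digamma function *)

Section kern_digamma.
Context {R : realType}.

(** This difference is 2-periodic, since both functions satisfy the same recurrence, and it decays
    like 1/s; hence it vanishes. *)
Let defect (s : R) := kern s - ln 2 - digamma ((1 + s) / 2).

Let defectD2 (s : R) : 0 <= s -> defect (s + 2) = defect s.
Proof.
move=> s0; have s1 : 0 < s + 1 by rewrite ltr_wpDl.
rewrite /defect (kernD2 s0).
have -> : (1 + (s + 2)) / 2 = (1 + s) / 2 + 1 by field.
rewrite digammaS ?divr_gt0 1?addrC//.
by field; rewrite gt_eqF.
Qed.

Let defect_le (s : R) : 2 <= s -> `|defect s| <= 8 / s.
Proof.
move=> s2; have s0 : 0 < s by rewrite (lt_le_trans _ s2).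
have s1 : 0 < s + 1 by rewrite addr_gt0.
have s1' : 0 < s - 1 by lra.
have z0 : 0 < (1 + s) / 2 - 1 by lra.
have h1 : `|kern s - ln (s + 1)| <= 2 / s.
  by rewrite (le_trans (kern_asymptotic (ltW s0)))// ler_pM2l// lef_pV2 ?posrE// lerDl.
have zp : 0 < (1 + s) / 2 by lra.
have h2 := digamma_le_ln zp; have := ln_le_digamma z0; rewrite subrK => h3.
have h4 : ln ((1 + s) / 2) = ln (s + 1) - ln 2 by rewrite [1 + s]addrC ln_div ?posrE.
have h5 : ln ((1 + s) / 2) - ln ((1 + s) / 2 - 1) <= 4 / s.
  rewrite -ln_div ?posrE//; have := ln_le_subr1 (divr_gt0 zp z0).
  have -> : (1 + s) / 2 / ((1 + s) / 2 - 1) - 1 = 2 / (s - 1).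
    by field; rewrite ?gt_eqF//; lra.
  move=> /le_trans; apply.
  by rewrite ler_pdivrMr// mulrAC ler_pdivlMr//; lra.
(* The kernel contributes an error 2/s and the digamma function 4/s; the last 2/s is slack. *)
have h6 : 8 / s = 2 / s + 4 / s + 2 / s by ring.
have h7 : 0 < 2 / s by rewrite divr_gt0.
by move: h1; rewrite !ler_norml h6 /defect; move: (2 / s) (4 / s) h5 h7 => a b; lra.
Qed.

Lemma kern_digamma (s : R) : 0 <= s -> kern s = ln 2 + digamma ((1 + s) / 2).
Proof.
move=> s0; suff : defect s = 0 by rewrite /defect; lra.
have per n : defect (s + 2 * n%:R) = defect s.
  elim: n => [|n IH]; first by rewrite mulr0 addr0.
  by rewrite -(natr1 n) mulrDr mulr1 addrA defectD2 ?addr_ge0 ?mulr_ge0.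
apply/eqP/negPn/negP => d0.
have dp : 0 < `|defect s| by rewrite normr_gt0.
pose n := (Num.truncn (8 / `|defect s|)).+1.
have hn : 8 / `|defect s| < n%:R by exact: truncnS_gt.
have n1 : (1 : R) <= n%:R by rewrite ler1n.
have sn : 2 <= s + 2 * n%:R by lra.
have := defect_le sn; rewrite per ler_pdivlMr; last by lra.
move: hn; rewrite ltr_pdivrMr// => hn; apply/negP; rewrite -ltNge.
rewrite (lt_le_trans hn)// mulrC ler_pM2l//; lra.
Qed.

End kern_digamma.

(** * The arcsine weight *)

Section arcsin.
Context {R : realType}.
Notation mu := (@lebesgue_measure R).
Implicit Types x y : R.

Lemma asin_acos x : -1 <= x <= 1 -> asin x = pi / 2 - acos x.
Proof.
move=> x1; have /andP[a0 api] : 0 <= acos x <= pi.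
  by rewrite acos_ge0// acos_lepi.
have sE : sin (pi / 2 - acos x) = x.
  by rewrite sinB sin_pihalf cos_pihalf mul1r mul0r subr0 acosK// in_itv.
by rewrite -[in LHS]sE sinK// in_itv/=; apply/andP; split; lra.
Qed.

Lemma asin_odd x : -1 <= x <= 1 -> asin (- x) = - asin x.
Proof. by move=> x1; rewrite !asin_acos ?acosN//; [field|lra..]. Qed.

Lemma asin_eq0 : asin (0 : R) = 0.
Proof. by rewrite asin_acos ?acos0 ?subrr//; lra. Qed.

Lemma asin_gt0 x : 0 < x < 1 -> 0 < asin x.
Proof.
move=> /andP[x0 x1]; have x11 : -1 <= x <= 1 by lra.
rewrite asin_acos// subr_gt0 -ltr_cos ?in_itv/= ?acos_ge0 ?acos_lepi//.
  by rewrite cos_pihalf acosK ?in_itv.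
by have := pi_gt0 R; lra.
Qed.

Lemma cvg1_acos : acos x @[x --> 1^'-] --> (0 : R).
Proof.
apply/cvgr0Pnorm_le => e e0; have [pie|epi] := ltP pi e.
  near=> x.
  have x1 : x < 1 by near: x; exact: nbhs_left_lt.
  have x0 : 0 < x by near: x; apply: nbhs_left_gt; exact: ltr01.
  by rewrite ger0_norm ?acos_ge0 ?(le_trans _ (ltW pie)) ?acos_lepi//; lra.
have ce1 : cos e < 1.
  by rewrite -cos0 ltr_cos ?in_itv//= ?lexx ?pi_ge0// ?epi ?(ltW e0).
near=> x.
have x1 : x < 1 by near: x; exact: nbhs_left_lt.
have x0 : 0 < x by near: x; apply: nbhs_left_gt; exact: ltr01.
have x11 : -1 <= x <= 1 by lra.
have a0 : 0 <= acos x by exact: acos_ge0.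
have xe : cos e <= x by near: x; exact: nbhs_left_ge.
rewrite ger0_norm//.
rewrite leNgt -ltr_cos ?in_itv/= ?acos_lepi ?a0 ?epi ?(ltW e0)//.
by rewrite acosK ?in_itv// -leNgt.
Unshelve. all: by end_near. Qed.

Lemma cvgN1_acos : acos x @[x --> (-1)^'+] --> (pi : R).
Proof.
have h : pi - acos x @[x --> 1^'-] --> (pi - 0 : R).
  by apply: cvgB; [exact: cvg_cst|exact: cvg1_acos].
rewrite subr0 in h; apply/cvg_at_rightNP; rewrite opprK; apply: cvg_trans h.
apply: near_eq_cvg; near=> x => /=.
have x1 : x < 1 by near: x; exact: nbhs_left_lt.
have x0 : 0 < x by near: x; apply: nbhs_left_gt; exact: ltr01.
by rewrite acosN//; lra.
Unshelve. all: by end_near. Qed.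

Let tau x := x / Num.sqrt (1 - x ^+ 2).

Let sq_gt0 x : -1 < x < 1 -> 0 < 1 - x ^+ 2.
Proof.
move=> x1; have -> : 1 - x ^+ 2 = (1 - x) * (1 + x) by ring.
by apply: mulr_gt0; lra.
Qed.

Let atan_tau x : -1 < x < 1 -> atan (tau x) = asin x.
Proof.
move=> x1; have x11 : -1 <= x <= 1 by lra.
rewrite /tau -(cos_asin x11) -[X in X / _](asinK (x := x)) ?in_itv//.
rewrite -[_ / _]/(tan _) tanK// in_itv/= asin_ltpi2 ?asin_gtNpi2//; lra.
Qed.

(** From asin x = atan(tau x), this is tau/(1 + y^2 tau^2) divided by x. Integrating over y in (0,
    1) gives the weight, while integrating over x first gives pi/(1 + y). *)
Let k (x y : R) := Num.sqrt (1 - x ^+ 2) / (1 - x ^+ 2 + y ^+ 2 * x ^+ 2).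

Let k_denom x y : -1 < x < 1 -> 0 < 1 - x ^+ 2 + y ^+ 2 * x ^+ 2.
Proof. by move=> /sq_gt0 h; rewrite ltr_pwDl// mulr_ge0 ?sqr_ge0. Qed.

Let k_ge0 x y : -1 < x < 1 -> 0 <= k x y.
Proof. by move=> x1; rewrite divr_ge0 ?sqrtr_ge0// ltW// k_denom. Qed.

Let k_inner_y x : -1 < x < 1 -> x != 0 ->
  (\int[mu]_(y in `]0%R, 1%R[) (k x y)%:E = (asin x / x)%:E)%E.
Proof.
move=> x1 x0; have s0 := sq_gt0 x1.
have sE : Num.sqrt (1 - x ^+ 2) ^+ 2 = 1 - x ^+ 2 by rewrite sqr_sqrtr// ltW.
have sp : 0 < Num.sqrt (1 - x ^+ 2) by rewrite sqrtr_gt0.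
have cont y : {for y, continuous (fun y => atan (y * tau x) / x)}.
  by apply: der_continuous; der.
have [ik kE] : mu.-integrable `]0, 1[ (EFin \o k x) /\ \int[mu]_(y in `]0, 1[) k x y =
    atan (1 * tau x) / x - atan (0 * tau x) / x.
  apply: (@ge0_FTCoo R (k x) (fun y => atan (y * tau x) / x)) => //.
  - move=> y _; have kd := k_denom y x1.
    apply: der_eq; first by der.
    move: sE sp kd; rewrite /= /k /tau; move: (Num.sqrt _) => s <- sp kd.
    field; rewrite x0 !gt_eqF//= exprMn; exact: kd.
  - move=> y _; apply: der_continuous; rewrite /k; der.
    by rewrite gt_eqF// k_denom.
  - exact: cvg_at_right_filter (cont 0).
  - exact: cvg_at_left_filter (cont 1).
  - by move=> y _; exact: k_ge0.
move: kE; rewrite mul1r mul0r atan0 mul0r subr0 atan_tau// => <-.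
by rewrite /Rintegral fineK//; exact: integrable_fin_num ik.
Qed.

Let cvg_tau y : 0 < y -> atan (y * tau x) @[x --> 1^'-] --> (pi / 2 : R).
Proof.
move=> y0; have h : y * tau x @[x --> 1^'-] --> +oo.
  apply/gtr0_cvgV0.
    near=> x; have x1 : x < 1 by near: x; exact: nbhs_left_lt.
    have x0 : 0 < x by near: x; apply: nbhs_left_gt; exact: ltr01.
    by rewrite mulr_gt0// divr_gt0// sqrtr_gt0 sq_gt0//; lra.
  have -> : unstable.inv_fun (fun x => y * tau x) = fun x => (y * x)^-1 * Num.sqrt (1 - x ^+ 2).
    by apply/funext => x; rewrite /= /tau mulrA invf_div mulrC.
  apply: cvg_at_left_filter.
  rewrite -[X in _ --> X](mulr0 (y * 1)^-1); apply: cvgM.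
    apply: (@der_continuous _ (fun x => (y * x)^-1)); der.
    by rewrite mulr1 gt_eqF.
  rewrite -[X in _ --> X](@sqrtr0 R); apply: continuous_cvg; first exact: sqrt_continuous.
  rewrite -[X in _ --> X](subrr (1 : R)) -[X in _ --> _ - X](expr1n _ 2).
  by apply: (@der_continuous _ (fun x : R => 1 - x ^+ 2)); der.
exact: (cvg_comp _ _ h (@cvgy_atan R)).
Unshelve. all: by end_near. Qed.

Let k_inner_x y : 0 < y < 1 ->
  (\int[mu]_(x in `](-1)%R, 1%R[) (k x y)%:E = (pi / (1 + y))%:E)%E.
Proof.
move=> /andP[y0 y1].
have yy : 1 - y ^+ 2 != 0 by rewrite gt_eqF//; apply: sq_gt0; lra.
(* The derivatives of asin x and y atan(y tau x) differ by (1 - y^2) [k x y]. *)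
pose F x := (asin x - y * atan (y * tau x)) / (1 - y ^+ 2).
have F1 : F x @[x --> 1^'-] --> (pi / 2 - 0 - y * (pi / 2)) / (1 - y ^+ 2).
  apply: cvgM; last exact: cvg_cst.
  apply: cvgB; last by apply: cvgM; [exact: cvg_cst|exact: cvg_tau].
  apply: (@cvg_trans _ ((fun x => pi / 2 - acos x) @ 1^'-)).
    apply: near_eq_cvg; near=> x; rewrite asin_acos//.
    have x1 : x < 1 by near: x; exact: nbhs_left_lt.
    have x0 : 0 < x by near: x; apply: nbhs_left_gt; exact: ltr01.
    by lra.
  by apply: cvgB; [exact: cvg_cst|exact: cvg1_acos].
have FN x : -1 <= x <= 1 -> F (- x) = - F x.
  move=> x1; rewrite /F asin_odd// /tau sqrrN mulNr mulrN atanN; field.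
  by [].
have F0 : F x @[x --> (-1)^'+] --> - ((pi / 2 - 0 - y * (pi / 2)) / (1 - y ^+ 2)).
  apply/cvg_at_rightNP; rewrite opprK.
  apply: (cvg_trans _ (cvgN F1)); apply: near_eq_cvg; near=> x => /=.
  have x1 : x < 1 by near: x; exact: nbhs_left_lt.
  have x0 : 0 < x by near: x; apply: nbhs_left_gt; exact: ltr01.
  by rewrite FN//; lra.
have [ik kE] : mu.-integrable `]-1, 1[ (EFin \o k ^~ y) /\ \int[mu]_(x in `]-1, 1[) k x y =
    (pi / 2 - 0 - y * (pi / 2)) / (1 - y ^+ 2) - - ((pi / 2 - 0 - y * (pi / 2)) / (1 - y ^+ 2)).
  apply: (@ge0_FTCoo R (k ^~ y) F _ _ _ _ _ _ _ F0 F1).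
  - by lra.
  - move=> x x1; have s0 := sq_gt0 x1.
    have sE : Num.sqrt (1 - x ^+ 2) ^+ 2 = 1 - x ^+ 2 by rewrite sqr_sqrtr// ltW.
    have sp : 0 < Num.sqrt (1 - x ^+ 2) by rewrite sqrtr_gt0.
    have kd := k_denom y x1.
    apply: der_eq; first by rewrite /F /tau; der => //; rewrite gt_eqF.
    move: sE sp kd; rewrite /= /k; move: (Num.sqrt _) => s sE sp kd.
    have xE : x ^+ 2 = 1 - s ^+ 2 by rewrite sE; ring.
    have kd2 : 0 < s ^+ 2 + (y * x) ^+ 2 by rewrite exprMn sE.
    rewrite -sE.
    by field; rewrite yy !gt_eqF.
  - move=> x x1; apply: der_continuous; rewrite /k; der; first exact: sq_gt0.
    by rewrite gt_eqF// k_denom.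
  - by move=> x; exact: k_ge0.
have -> : pi / (1 + y) = \int[mu]_(x in `]-1, 1[) k x y.
  rewrite kE; field; rewrite yy gt_eqF//; lra.
by rewrite /Rintegral fineK//; exact: integrable_fin_num ik.
Unshelve. all: by end_near. Qed.

Lemma arcsin_weight_ge0 x : -1 < x < 1 -> 0 <= arcsin_weight x.
Proof.
rewrite /arcsin_weight => x1; have [->|x0] := eqVneq x 0; first by rewrite invr0 mulr0.
by rewrite -lee_fin -k_inner_y//; apply: integral_ge0 => y _; rewrite lee_fin k_ge0.
Qed.

(** The point 0 is split off, since the convention 0^-1 = 0 makes the quotient jump there. *)
Lemma arcsin_weight_measurable :
  measurable_fun (`]-1, 1[%classic : set R) (@arcsin_weight R).
Proof.
have cont (a b : R) : -1 <= a -> b <= 1 -> 0 \notin `]a, b[ ->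
    measurable_fun (`]a, b[%classic : set R) (@arcsin_weight R).
  move=> a1 b1 n0; apply: open_continuous_measurable_fun; first exact: interval_open.
  move=> x; rewrite inE/= => xab; apply: der_continuous; rewrite /arcsin_weight; der.
    by move: xab; rewrite in_itv/=; lra.
  by apply: contraNneq n0 => <-.
have -> : `]-1, 1[%classic = `]-1, 0[ `|` ([set 0] `|` `]0, 1[) :> set R.
  apply/seteqP; split => x /=; rewrite !in_itv/=.
    by have [x0|x0|->] := ltgtP x 0; [left|right; right|right; left]; lra.
  by move=> [|[->|]]; lra.
have m0 : measurable (`]0, 1[%classic : set R) by [].
have m1 : measurable ([set 0] : set R) by exact: measurable_set1.
apply: (measurable_funU _ (measurable_itv _) (measurableU _ _ m1 m0)).2; split.
  by apply: cont => //; rewrite in_itv/= ltxx andbF.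
apply: (measurable_funU _ m1 m0).2; split; first exact: measurable_fun_set1.
by apply: cont => //; rewrite in_itv/= ltxx.
Qed.

(** Tonelli for [k]: the outer integral of pi/(1 + y) over (0, 1) is pi ln 2. *)
Lemma arcsin_weight_integral :
  mu.-integrable `]-1, 1[ (EFin \o @arcsin_weight R) /\
  \int[mu]_(x in `]-1, 1[) arcsin_weight x = pi * ln 2.
Proof.
(* Real powers replace the square root and the inverse in [k]; joint measurability then follows from
   that of powers. *)
pose f (p : measurableTypeR R * measurableTypeR R) : R :=
  (1 - p.1 ^+ 2) `^ 2^-1 * (1 - p.1 ^+ 2 + p.2 ^+ 2 * p.1 ^+ 2) `^ (-1).
have fE x y : -1 < x < 1 -> f (x, y) = k x y.
  move=> x1; rewrite /f /k powR12_sqrt ?(ltW (sq_gt0 x1))//.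
  by rewrite powR_inv1// ltW// k_denom.
have m1 : measurable_fun setT (fun p : measurableTypeR R * measurableTypeR R => p.1 ^+ 2 : R).
  by apply: measurable_funX; exact: measurable_fst.
have m2 : measurable_fun setT (fun p : measurableTypeR R * measurableTypeR R => p.2 ^+ 2 : R).
  by apply: measurable_funX; exact: measurable_snd.
have m3 : measurable_fun setT (fun p : measurableTypeR R * measurableTypeR R => 1 - p.1 ^+ 2 : R).
  by apply: measurable_funB => //; exact: measurable_cst.
have m4 : measurable_fun setT (fun p : measurableTypeR R * measurableTypeR R =>
    1 - p.1 ^+ 2 + p.2 ^+ 2 * p.1 ^+ 2 : R).
  by apply: measurable_funD => //; exact: measurable_funM.
have mp (p : R) : measurable_fun [set: R] (@powR R ^~ p) by exact: measurable_powR.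
have mf : measurable_fun setT f.
  apply: measurable_funM.
    by have := measurableT_comp (mp 2^-1) m3.
  by have := measurableT_comp (mp (-1)) m4.
(* At x = 0 the integral of [k] over y is 1 but the weight is 0 by convention, so the point is
   removed. *)
pose A : set R := `]-1, 1[ `\ 0.
have mA : measurable A by apply: measurableD.
have := @Rtonelli R A `]0, 1[ f mA (measurable_itv _) mf.
have -> : (\int[mu]_(x in A) \int[mu]_(y in `]0%R, 1%R[) (f (x, y))%:E =
    \int[mu]_(x in `](-1)%R, 1%R[) (arcsin_weight x)%:E)%E.
  rewrite -[RHS](@integral_setD1 _ _ 0)//; last first.
    apply/measurable_EFinP; apply: measurable_funS arcsin_weight_measurable => //.
  apply: eq_integral => x; rewrite inE => -[/=]; rewrite in_itv/= => x1 /eqP x0.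
  rewrite -k_inner_y//; apply: eq_integral => y _.
  by rewrite fE.
have -> : (\int[mu]_(y in `]0%R, 1%R[) \int[mu]_(x in A) (f (x, y))%:E =
    \int[mu]_(y in `]0%R, 1%R[) (pi / (1 + y))%:E)%E.
  apply: eq_integral => y; rewrite inE/= in_itv/= => y1.
  rewrite -k_inner_x// integral_setD1//; last first.
    apply/measurable_EFinP; apply: measurable_funTS.
    exact: measurableT_comp mf (measurable_pair2 y).
  by apply: eq_integral => x; rewrite inE/= in_itv/= => x1; rewrite fE.
have [iy yE] : mu.-integrable `]0, 1[ (EFin \o (fun y : R => pi / (1 + y))) /\
    \int[mu]_(y in `]0, 1[) (pi / (1 + y)) = pi * ln (1 + 1) - pi * ln (1 + 0) :> R.
  have cF (y : R) : 0 <= y -> has_der (fun y => pi * ln (1 + y)) y (pi / (1 + y)).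
    move=> y0; have y1 : 0 < 1 + y by rewrite ltr_pwDl.
    by apply: der_eq; [der|rewrite /=; field; rewrite gt_eqF].
  apply: (@ge0_FTCoo R _ (fun y => pi * ln (1 + y))) => //.
  - by move=> y /andP[y0 _]; apply: cF; exact: ltW.
  - move=> y /andP[y0 _]; apply: der_continuous; der.
    by rewrite gt_eqF// ltr_pwDl// ltW.
  - exact: (cvg_at_right_filter (der_continuous (cF 0 (lexx 0)))).
  - exact: (cvg_at_left_filter (der_continuous (cF 1 ler01))).
  - by move=> y /andP[y0 _]; rewrite divr_ge0 ?pi_ge0// addr_ge0// ltW.
have -> : (\int[mu]_(y in `]0%R, 1%R[) (pi / (1 + y))%:E = (pi * ln 2)%:E)%E.
  move: yE; rewrite addr0 ln1 mulr0 subr0 -[1 + 1]/2%:R => <-.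
  by rewrite /Rintegral fineK//; exact: integrable_fin_num iy.
move=> E; have {}E : (\int[mu]_(x in `](-1)%R, 1%R[) (arcsin_weight x)%:E = (pi * ln 2)%:E)%E.
  apply: E => x y [/=]; rewrite !in_itv/= => x1 _ y1.
  by rewrite fE// k_ge0.
split; last by rewrite /Rintegral E.
apply/integrableP; split; first by apply/measurable_EFinP; exact: arcsin_weight_measurable.
suff -> : (\int[mu]_(x in `](-1)%R, 1%R[) `|(EFin \o @arcsin_weight R) x| = (pi * ln 2)%:E)%E by rewrite ltry.
rewrite -E; apply: eq_integral => x; rewrite inE/= in_itv/= => x1.
by rewrite ger0_norm// arcsin_weight_ge0.
Qed.

(* The antiderivative below uses 0^-1 = 0 when m = 0. *)
Lemma asin_cos_integral (m : nat) :
  mu.-integrable `]-1, 1[ (EFin \o (fun x => asin x * cos (m.*2.+1%:R * acos x))) ->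
  \int[mu]_(x in `]-1, 1[) (asin x * cos (m.*2.+1%:R * acos x)) =
  pi / 2 * (m.*2.+2%:R^-1 - m.*2%:R^-1).
Proof.
move=> im.
pose S (a t : R) := (pi / 2 - t) * cos (a * t) / a + sin (a * t) / a ^+ 2.
have dS (a t : R) : has_der (S a) t (- ((pi / 2 - t) * sin (a * t))).
  apply: der_eq; first by rewrite /S; der.
  rewrite /=; have [->|a0] := eqVneq a 0.
    by rewrite !mul0r sin0 cos0 invr0 expr0n /= invr0; ring.
  by field.
(* After x = cos t, the product 2 sin t cos((2m+1)t) splits as sin((2m+2)t) - sin(2mt). *)
pose G t := (S m.*2.+2%:R t - S m.*2%:R t) / 2.
have dG t : has_der G t (- ((pi / 2 - t) * cos (m.*2.+1%:R * t) * sin t)).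
  apply: der_eq; first by apply: der_mul; [apply: der_add; [exact: dS|apply: der_opp; exact: dS]|exact: der_cst].
  rewrite /=.
  have -> : m.*2.+2%:R * t = m.*2.+1%:R * t + t by rewrite -[m.*2.+2]addn1 natrD; ring.
  have -> : m.*2%:R * t = m.*2.+1%:R * t - t by rewrite -[m.*2.+1]addn1 natrD; ring.
  by rewrite sinD sinB; field.
have piS (j : nat) : j.+1.*2%:R * pi = j.*2%:R * pi + pi + pi :> R.
  by rewrite doubleS -[j.*2.+2]addn2 natrD; ring.
have cosn (j : nat) : cos (j.*2%:R * pi) = 1 :> R.
  by elim: j => [|j IH]; rewrite ?mul0r ?cos0// piS !cosDpi opprK.
have sinn (j : nat) : sin (j.*2%:R * pi) = 0 :> R.
  by elim: j => [|j IH]; rewrite ?mul0r ?sin0// piS !sinDpi opprK.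
rewrite (@FTCoo R _ (fun x => G (acos x)) (-1) 1 (G pi) (G 0))//.
- rewrite /G /S !mulr0 sin0 cos0 -doubleS !cosn !sinn; set a := m.*2.+2%:R^-1.
  by move: (m.*2%:R^-1) a => b a; rewrite !mulr1 !mul0r !addr0; field.
- move=> x x1; have x11 : -1 <= x <= 1 by lra.
  apply: der_eq; first exact: (der_comp (dG _) (der_acos x1 (der_id x))).
  rewrite /= -sin_acos// asin_acos//; field.
  by rewrite sin_acos// gt_eqF// sqrtr_gt0 sq_gt0.
- by move=> x x1; apply: der_continuous; der.
- exact: (cvg_comp _ _ cvgN1_acos (der_continuous (dG _))).
- exact: (cvg_comp _ _ cvg1_acos (der_continuous (dG _))).
Qed.

End arcsin.

(** * Chebyshev moments of the arcsine weight *)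

Section weight_functional.
Context {R : realType}.
Notation mu := (@lebesgue_measure R).
Implicit Types p q : {poly R}.

Definition wint p : R := \int[mu]_(x in `]-1, 1[) (p.[x] * arcsin_weight x).

Lemma horner_bound p : exists2 M, 0 <= M & forall x : R, -1 < x < 1 -> `|p.[x]| <= M.
Proof.
exists (\sum_(i < size p) `|p`_i|) => [|x x1]; first exact: sumr_ge0.
rewrite horner_coef (le_trans (ler_norm_sum _ _ _))// ler_sum// => i _.
rewrite normrM ler_piMr// normrX exprn_ile1//.
by rewrite ler_norml; apply/andP; split; lra.
Qed.

Lemma horner_measurable p (D : set R) : measurable_fun D (horner p).
Proof.
apply: measurable_funTS; apply: continuous_measurable_fun.
exact: continuous_horner.
Qed.

Lemma wint_integrable p : mu.-integrable `]-1, 1[ (EFin \o (fun x => p.[x] * arcsin_weight x)).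
Proof.
have [M M0 pM] := horner_bound p.
apply: le_integrableR (integrableZR M (measurable_itv `]-1, 1[) (@arcsin_weight_integral R).1) => //.
  by apply: measurable_funM; [exact: horner_measurable|exact: arcsin_weight_measurable].
move=> x /=; rewrite in_itv/= => x1; rewrite normrM (ger0_norm (arcsin_weight_ge0 x1)).
by rewrite ler_wpM2r ?arcsin_weight_ge0// pM.
Qed.

Lemma wintD p q : wint (p + q) = wint p + wint q.
Proof.
rewrite /wint -RintegralD//; [|exact: wint_integrable..].
by apply: eq_Rintegral => x _; rewrite hornerD mulrDl.
Qed.

Lemma wintZ a p : wint (a *: p) = a * wint p.
Proof.
rewrite /wint -RintegralZl//; last exact: wint_integrable.
by apply: eq_Rintegral => x _; rewrite hornerZ -mulrA.
Qed.

Lemma wint_eq p q : (forall x, -1 < x < 1 -> p.[x] = q.[x]) -> wint p = wint q.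
Proof.
by move=> pq; apply: eq_Rintegral => x; rewrite inE/= in_itv/= => x1; rewrite pq.
Qed.

Lemma wint0 : wint 0 = 0.
Proof. by rewrite -(scale0r (0 : {poly R})) wintZ mul0r. Qed.

Lemma wint_sum n (f : 'I_n -> {poly R}) : wint (\sum_(i < n) f i) = \sum_(i < n) wint (f i).
Proof. by elim/big_ind2 : _ => [|? ? ? ? <- <-|]; rewrite ?wint0 ?wintD. Qed.

Lemma poly_vanish p (a b : R) : a < b -> (forall x, a < x < b -> p.[x] = 0) -> p = 0.
Proof.
move=> ab pz; apply/eqP/negPn/negP => p0.
(* These are [size p] distinct interior points, one more than a nonzero p can have as roots. *)
pose rs := [seq a + (b - a) * (i.+1%:R / (size p).+1%:R) | i <- iota 0 (size p)].
have ba : 0 < b - a by rewrite subr_gt0.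
have sp0 : 0 < (size p).+1%:R :> R by rewrite ltr0n.
have := max_poly_roots (rs := rs) p0; rewrite size_map size_iota ltnn => h.
suff : false by []. apply: h.
  rewrite /rs all_map; apply/allP => i; rewrite mem_iota add0n => /andP[_ isp] /=.
  rewrite /root pz//; rewrite ltrDl mulr_gt0 ?divr_gt0 ?ltr0n//= -ltrBrDl.
  by rewrite gtr_pMr// ltr_pdivrMr// mul1r ltr_nat ltnS.
rewrite map_inj_uniq ?iota_uniq// => i j /addrI /(mulfI (lt0r_neq0 ba)).
by move=> /(mulIf (invr_neq0 (lt0r_neq0 sp0)))/eqP; rewrite eqr_nat => /eqP[].
Qed.

Lemma arcsin_weight_gt0 (x : R) : 0 < x < 1 -> 0 < arcsin_weight x.
Proof. by move=> x1; rewrite divr_gt0 ?asin_gt0//; case/andP: x1. Qed.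

(** A nonroot is sought in (0, 1) rather than (-1, 1): there the weight is continuous and positive,
    whereas its value at 0 is 0. *)
Lemma wint_sqr_gt0 p : p != 0 -> 0 < wint (p * p).
Proof.
move=> p0; have [x x1 px] : exists2 x : R, 0 < x < 1 & p.[x] != 0.
  apply: contrapT => h; move/eqP: p0; apply.
  apply: (@poly_vanish p 0 1) => // x x1.
  by apply/eqP/negPn/negP => px; apply: h; exists x.
have cp y : {for y, continuous (horner p)} by exact: continuous_horner.
have : nbhs x [set y | (0 < y < 1) /\ p.[y] != 0].
  have x01 : x \in `]0, 1[ by rewrite in_itv.
  apply: filterS2 (near_in_itvoo x01) (cvgr_neq0 _ (cp x) px) => y /=.
  by rewrite in_itv.
move=> /nbhs_ballP[e /= e0 he].
have hx y : x - e / 2 <= y <= x + e / 2 -> 0 < y < 1 /\ p.[y] != 0.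
  move=> yx; apply: he; rewrite /ball/= ltr_norml; apply/andP; split; lra.
apply: (Rintegral_gt0 (a := x - e / 2) (b := x + e / 2) _ (wint_integrable (p * p))) => //.
- move=> y /=; rewrite in_itv/= => y1; rewrite hornerM mulr_ge0 ?arcsin_weight_ge0//.
  exact: sqr_ge0.
- by lra.
- by move=> y /=; rewrite !in_itv/= => /hx[/andP[y0 ->] _]; rewrite (lt_trans _ y0)//; lra.
- move=> y /hx[/andP[y0 y1] _]; apply: cvgM; first exact: continuous_horner.
  apply: der_continuous; rewrite /arcsin_weight; der; first by lra.
  by rewrite gt_eqF.
- move=> y /hx[y1 py]; rewrite hornerM mulr_gt0 ?arcsin_weight_gt0//.
  by rewrite -expr2 exprn_even_gt0.
Qed.

(** Consecutive Chebyshev polynomials of the first kind; the pair turns the three-term recurrence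
    into structural recursion. *)
Fixpoint cheb_pair (k : nat) : {poly R} * {poly R} :=
  if k is k'.+1 then
    let: (a, b) := cheb_pair k' in (b, 2 *: ('X * b) - a)
  else (1, 'X).

Definition cheb k := (cheb_pair k).1.

Lemma chebSS k : cheb k.+2 = 2 *: ('X * cheb k.+1) - cheb k.
Proof. by rewrite /cheb /=; case: (cheb_pair k). Qed.

Lemma horner_cheb k t : (cheb k).[cos t] = cos (k%:R * t).
Proof.
suff [] : (cheb k).[cos t] = cos (k%:R * t) /\ (cheb k.+1).[cos t] = cos (k.+1%:R * t) by [].
elim: k => [|k [IH1 IH2]].
  by rewrite /cheb /= hornerC hornerX mul0r cos0 mul1r.
split => //; rewrite chebSS hornerD hornerN hornerZ hornerM hornerX IH1 IH2.
have -> : k.+2%:R * t = k.+1%:R * t + t by rewrite -[k.+2]addn1 natrD; ring.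
have -> : k%:R * t = k.+1%:R * t - t by rewrite -[k.+1]addn1 natrD; ring.
by rewrite cosB cosD; ring.
Qed.

Lemma size_cheb k : (size (cheb k) <= k.+1)%N.
Proof.
suff [] : (size (cheb k) <= k.+1)%N /\ (size (cheb k.+1) <= k.+2)%N by [].
elim: k => [|k [IH1 IH2]].
  by rewrite /cheb /= size_poly1 size_polyX.
split => //; rewrite chebSS (leq_trans (size_polyD _ _))// geq_max size_polyN.
rewrite (leq_trans IH1)//; last by rewrite leqW.
rewrite andbT (leq_trans (size_scale_leq _ _))// (leq_trans (size_polyMleq _ _))//.
by rewrite size_polyX.
Qed.

Lemma horner_cheb_acos k (x : R) : -1 <= x <= 1 -> (cheb k).[x] = cos (k%:R * acos x).
Proof. by move=> x1; rewrite -horner_cheb acosK// in_itv. Qed.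

(** Increments of the kernel, of which two consecutive ones have an elementary sum by [kernD2]. *)
Let d m := kern m.+1%:R - kern m%:R : R.

Let dD m : d m + d m.+1 = 2 / m.+1%:R.
Proof.
have := @kernD2 R m%:R (ler0n _ _); rewrite -natrD addn2 natr1 /d => ->.
by move: (kern _) (kern _) (2 / _) => a b c; ring.
Qed.

(** The sum T_{2m} + T_{2m+2} equals 2x T_{2m+1}, and the factor x cancels the denominator of the
    weight. *)
Let wint_cheb_step m : wint (cheb m.*2) + wint (cheb m.*2.+2) =
  pi * (m.*2.+2%:R^-1 - m.*2%:R^-1).
Proof.
rewrite -wintD chebSS addrC subrK wintZ.
have E x : -1 < x < 1 -> ('X * cheb m.*2.+1).[x] * arcsin_weight x =
    asin x * cos (m.*2.+1%:R * acos x).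
  move=> x1; rewrite hornerM hornerX horner_cheb_acos; last by lra.
  rewrite /arcsin_weight; have [->|x0] := eqVneq x 0.
    by rewrite asin_eq0 !mul0r.
  by move: (cos _) (asin x) => a b; field.
rewrite /wint (_ : \int[mu]_(x in _) _ = pi / 2 * (m.*2.+2%:R^-1 - m.*2%:R^-1)).
  by move: (m.*2.+2%:R^-1) (m.*2%:R^-1) pi => a b c; field.
rewrite -asin_cos_integral; first by apply: eq_Rintegral => x; rewrite inE/= in_itv/=; exact: E.
have := wint_integrable ('X * cheb m.*2.+1); apply: eq_integrable => // x.
by rewrite inE/= in_itv/= => /E ->.
Qed.

Lemma wint_cheb0 : 4 * wint (cheb 0) = pi * (2 * (kern 1 - kern 0)).
Proof.
rewrite kern1B0 (_ : wint (cheb 0) = pi * ln 2); first by move: (ln 2) pi => a b; ring.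
rewrite -(@arcsin_weight_integral R).2; apply: eq_Rintegral => x _.
by rewrite /cheb /= hornerC mul1r.
Qed.

(** Induction on m: sums of consecutive terms agree on the two sides, by [wint_cheb_step] and [dD],
    and [wint_cheb0] starts the induction. *)
Lemma wint_cheb m :
  4 * wint (cheb m.+1.*2) = pi * (kern m.+2%:R - 2 * kern m.+1%:R + kern m%:R).
Proof.
suff -> : 4 * wint (cheb m.+1.*2) = pi * (d m.+1 - d m).
  by rewrite /d; move: (kern _) (kern _) (kern _) => a b c; ring.
have E (k : nat) : k.+1.*2%:R^-1 = 2^-1 / k.+1%:R :> R.
  by rewrite -muln2 natrM invfM mulrC.
elim: m => [|m IH].
  have := wint_cheb_step 0; have := dD 0; have := wint_cheb0.
  rewrite -/(d 0) double0 invr0 subr0 -[1.*2]/2%N divr1.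
  move: (d 0) (d 1) (wint _) (wint _) pi => a b c e p h1 h2 h3.
  by nra.
have := wint_cheb_step m.+1; have := dD m; have := dD m.+1.
rewrite -(doubleS m.+1) !E; move: IH.
move: (m.+1%:R^-1) (m.+2%:R^-1) (d m) (d m.+1) (d m.+2) (wint _) (wint _) pi => s t a b c e f p h1 h2 h3.
by nra.
Qed.

End weight_functional.

(** * The coefficient vector *)

Local Open Scope complex_scope.

Section trigonometric_coefficients.
Context {R : realType}.

Lemma cisD (a b : R) : cis (a + b) = cis a * cis b.
Proof. by rewrite /cis cosD sinD; congr (_ +i* _); ring. Qed.

Lemma cis_neq0 (a : R) : cis a != 0.
Proof.
apply/eqP => -[c0 s0]; have := @cos2Dsin2 R a; rewrite c0 s0 expr0n addr0 => /eqP.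
by rewrite eq_sym oner_eq0.
Qed.

Lemma cis0 : cis 0 = 1 :> R[i].
Proof. by rewrite /cis cos0 sin0. Qed.

Lemma cis_natM (k : nat) (a : R) : cis (k%:R * a) = cis a ^+ k.
Proof.
elim: k => [|k IH]; first by rewrite mul0r expr0 cis0.
by rewrite -natr1 mulrDl mul1r cisD IH exprSr.
Qed.

Lemma Re_sum n (f : 'I_n -> R[i]) :
  complex.Re (\sum_(i < n) f i) = \sum_(i < n) complex.Re (f i).
Proof. by apply: (big_morph (@complex.Re R)) => // -[a b] [c d]. Qed.

Lemma Im_sum n (f : 'I_n -> R[i]) :
  complex.Im (\sum_(i < n) f i) = \sum_(i < n) complex.Im (f i).
Proof. by apply: (big_morph (@complex.Im R)) => // -[a b] [c d]. Qed.

Definition natdist (i j : nat) : nat := (i - j + (j - i))%N.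

Lemma natdistE (i j : nat) : `|i%:R - j%:R| = (natdist i j)%:R :> R.
Proof.
rewrite /natdist; have [ij|ji] := leqP i j.
  rewrite (eqP ij) add0n distrC ger0_norm ?subr_ge0 ?ler_nat// natrB//.
rewrite (eqP (ltnW ji)) addn0 ger0_norm ?subr_ge0 ?ler_nat ?natrB//; exact: ltnW.
Qed.

Section system.
Variable P : nat -> {poly R}.
Hypothesis hP : orthogonal_system P.

(** Orthogonality to each lower P_m extends to all polynomials of smaller degree by cancelling
    leading coefficients one degree at a time. *)
Lemma orthogonal_lower n (q : {poly R}) : (size q <= n)%N -> wint (q * P n) = 0.
Proof.
case: hP => sP oP _.
elim: {q}(size q) {-2}q (leqnn (size q)) => [|m IH] q sq qn.
  by move: sq; rewrite leqn0 size_poly_eq0 => /eqP ->; rewrite mul0r wint0.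
have [sqm|] := leqP (size q) m; first exact: IH.
move=> msq; have sqE : size q = m.+1 by apply/eqP; rewrite eqn_leq sq.
pose c := lead_coef q / lead_coef (P m).
have Pm0 : lead_coef (P m) != 0 by rewrite lead_coef_eq0 -size_poly_eq0 sP.
have q0 : lead_coef q != 0 by rewrite lead_coef_eq0 -size_poly_eq0 sqE.
pose r := q - c *: P m.
have sr : (size r <= m)%N.
  apply/leq_sizeP => j mj; rewrite coefB coefZ.
  have [->|jm] := eqVneq j m.
    rewrite /c !lead_coefE sqE sP /= divfK ?subrr//.
    by move: Pm0; rewrite lead_coefE sP.
  have mj' : (m < j)%N by rewrite ltn_neqAle eq_sym jm.
  by rewrite !nth_default ?mulr0 ?subr0// ?sP// sqE.
have -> : q = r + c *: P m by rewrite subrK.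
have mn : m != n by rewrite neq_ltn -sqE qn.
rewrite mulrDl wintD -scalerAl wintZ IH// ?(leq_trans sr)//; last by rewrite (leq_trans _ qn)// sqE.
rewrite add0r (_ : wint _ = 0) ?mulr0// -(oP _ _ mn).
by apply: eq_Rintegral => x _; rewrite hornerM.
Qed.

Variables (n : nat) (v : 'cV[R]_n.+1).
Hypothesis hv : trig_coefficients P v.

Lemma trig_re t : cos (n%:R * t) * (P n).[cos t] = \sum_(k < n.+1) v k 0 * cos (2 * k%:R * t).
Proof.
have := congr1 (@complex.Re R) (hv t); rewrite Re_sum /= mulr0 subr0 => ->.
by apply: eq_bigr => k _; rewrite /= mul0r subr0.
Qed.

Lemma trig_im t : sin (n%:R * t) * (P n).[cos t] = \sum_(k < n.+1) v k 0 * sin (2 * k%:R * t).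
Proof.
have := congr1 (@complex.Im R) (hv t); rewrite Im_sum /= mulr0 add0r => ->.
by apply: eq_bigr => k _; rewrite /= mul0r addr0.
Qed.

(** Real part of the expansion multiplied by e^{-2i theta sqrt(-1)}. On the right stands P_n times a
    Chebyshev polynomial of degree |2i - n|, which is below n for 0 < i < n. *)
Lemma trig_shift (i : nat) t : \sum_(k < n.+1) v k 0 * cos (2 * (k%:R - i%:R) * t) =
  cos ((2 * i%:R - n%:R) * t) * (P n).[cos t].
Proof.
have -> : (2 * i%:R - n%:R) * t = 2 * i%:R * t - n%:R * t by ring.
rewrite cosB mulrDl -[cos _ * cos _ * _]mulrA -[sin _ * sin _ * _]mulrA trig_re trig_im !mulr_sumr -big_split/=.
apply: eq_bigr => k _.
have -> : 2 * (k%:R - i%:R) * t = 2 * k%:R * t - 2 * i%:R * t by ring.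
by rewrite cosB; ring.
Qed.

Lemma trig_sum1 : \sum_(k < n.+1) v k 0 = 1.
Proof.
have := trig_re 0; rewrite mulr0 cos0 mul1r; case: hP => _ _ -> ->.
by apply: eq_bigr => k _; rewrite mulr0 cos0 mulr1.
Qed.

Lemma poly_vanish_cis (q : {poly R[i]}) : (forall t, q.[cis (2 * t)] = 0) -> q = 0.
Proof.
move=> qz; apply/eqP/negPn/negP => q0.
pose N : R := (size q).+1%:R; have N0 : 0 < N by rewrite ltr0n.
(* The angles i/N lie in [0, 1], inside [0, pi] where cos is injective, so the points are
   distinct. *)
pose rs := [seq cis (2 * (i%:R / N / 2) : R) | i <- iota 0 (size q)].
have := max_poly_roots (rs := rs) q0; rewrite size_map size_iota ltnn => h.
suff : false by []. apply: h.
  by rewrite /rs all_map; apply/allP => i _ /=; rewrite /root qz.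
rewrite map_inj_in_uniq ?iota_uniq// => i j; rewrite !mem_iota !add0n /= => iq jq.
have E (k : nat) : 2 * (k%:R / N / 2) = k%:R / N by field; rewrite gt_eqF.
have I (k : nat) : (k < size q)%N -> k%:R / N \in `[0, pi].
  move=> kq; rewrite in_itv/= divr_ge0 ?ler0n ?(ltW N0)//=.
  rewrite (@le_trans _ _ 1)//; last by rewrite (le_trans _ (pi_ge2 R))// ler1n.
  by rewrite ler_pdivrMr// mul1r ler_nat ltnW// ltnS ltnW.
rewrite !E => -[+ _] => /(cos_inj (I _ iq) (I _ jq))/(mulIf (invr_neq0 (lt0r_neq0 N0))).
by move=> /eqP; rewrite eqr_nat => /eqP.
Qed.

(** P_n(cos theta) is even in theta: changing the sign of theta and multiplying by e^{2in theta}
    reverses the coefficients. *)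
Lemma trig_symmetric k : v k 0 = v (rev_ord k) 0.
Proof.
pose V : {poly R[i]} := \sum_(j < n.+1) (v j 0 - v (rev_ord j) 0)%:C *: 'X^j.
have V0 : V = 0.
  apply: poly_vanish_cis => t; rewrite horner_sum.
  have cE (j : nat) : cis (2 * j%:R * t) = cis (2 * t) ^+ j.
    by rewrite -cis_natM; congr cis; ring.
  under eq_bigr => j _ do rewrite hornerZ hornerXn -cE rmorphB mulrBl.
  rewrite sumrB -hv (reindex_inj rev_ord_inj)/=.
  have -> : \sum_(j < n.+1) (v (rev_ord (rev_ord j)) 0)%:C * cis (2 * (n.+1 - j.+1)%N%:R * t) =
      cis (2 * n%:R * t) * \sum_(j < n.+1) (v j 0)%:C * cis (2 * j%:R * - t).
    rewrite mulr_sumr; apply: eq_bigr => j _; rewrite rev_ordK mulrCA -cisD.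
    have jn : (j <= n)%N by rewrite -ltnS.
    by congr (_ * cis _); rewrite subSS (natrB _ jn); ring.
  rewrite -hv cosN mulrA -cisD.
  have -> : 2 * n%:R * t + n%:R * - t = n%:R * t by ring.
  by rewrite subrr.
have := congr1 (fun p : {poly R[i]} => p`_k) V0; rewrite coef0 coef_sum (bigD1 k)//=.
rewrite big1 ?addr0; last first.
  by move=> j jk; rewrite coefZ coefXn (inj_eq val_inj) eq_sym (negbTE jk) mulr0.
rewrite coefZ coefXn eqxx mulr1 => -[]/eqP.
by rewrite subr_eq0 => /eqP.
Qed.

Definition kern_row (i : nat) : R := \sum_(j < n.+1) v j 0 * kern (natdist i j)%:R.

(** Up to the factor 4/pi, the second difference in i of [kern] at |i - j| is the moment of
    T_{2|i-j|}, also on the diagonal. Summed against v these give the moment of T_{|2i-n|} P_n,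
    which vanishes by orthogonality. *)
Lemma kern_row_diff2 (i : nat) : (0 < i < n)%N ->
  kern_row i.+1 - 2 * kern_row i + kern_row i.-1 = 0.
Proof.
move=> /andP[i0 ij].
have E j : pi * (kern (natdist i.+1 j)%:R - 2 * kern (natdist i j)%:R + kern (natdist i.-1 j)%:R) =
    4 * wint (cheb (natdist i j).*2) :> R.
  have [ltij|ltji|<-] := ltngtP i j.
  - rewrite (_ : natdist i j = (j - i.+1).+1); last by rewrite /natdist; lia.
    rewrite wint_cheb (_ : natdist i.+1 j = (j - i.+1)%N); last by rewrite /natdist; lia.
    rewrite (_ : natdist i.-1 j = (j - i.+1).+2); last by rewrite /natdist; lia.
    by move: (kern _) (kern _) (kern _) => a b c; ring.
  - rewrite (_ : natdist i j = (i - j.+1).+1); last by rewrite /natdist; lia.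
    rewrite wint_cheb (_ : natdist i.+1 j = (i - j.+1).+2); last by rewrite /natdist; lia.
    by rewrite (_ : natdist i.-1 j = (i - j.+1)%N); last by rewrite /natdist; lia.
  - rewrite (_ : natdist i i = 0)%N; last by rewrite /natdist; lia.
    rewrite wint_cheb0 (_ : natdist i.+1 i = 1)%N; last by rewrite /natdist; lia.
    rewrite (_ : natdist i.-1 i = 1)%N; last by rewrite /natdist; lia.
    by move: (kern _) (kern _) => a b; ring.
have pi0 : pi != 0 :> R by rewrite gt_eqF// pi_gt0.
apply: (mulfI pi0); rewrite mulr0 /kern_row mulr_sumr -sumrB -big_split/= mulr_sumr.
have -> : \sum_(j < n.+1) pi * (v j 0 * kern (natdist i.+1 j)%:R -
    2 * (v j 0 * kern (natdist i j)%:R) + v j 0 * kern (natdist i.-1 j)%:R) =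
    4 * \sum_(j < n.+1) v j 0 * wint (cheb (natdist i j).*2).
  rewrite mulr_sumr; apply: eq_bigr => j _.
  rewrite [RHS]mulrCA -E; move: (kern _) (kern _) (kern _) => a b c; ring.
pose q : {poly R} := cheb (natdist i.*2 n).
have -> : \sum_(j < n.+1) v j 0 * wint (cheb (natdist i j).*2) = wint (q * P n).
  under eq_bigr do rewrite -wintZ; rewrite -wint_sum; apply: wint_eq => x x1.
  have <- : cos (acos x) = x by rewrite acosK// in_itv/=; lra.
  rewrite horner_sum hornerM horner_cheb.
  have -> : cos ((natdist i.*2 n)%:R * acos x) = cos ((2 * i%:R - n%:R) * acos x).
    rewrite -natdistE -muln2 natrM mulrC [_%:R * 2]mulrC.
    have [h|h] := ger0P (2 * i%:R - n%:R : R); first by rewrite mulrC.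
    by rewrite mulrN cosN mulrC.
  rewrite -trig_shift; apply: eq_bigr => j _.
  rewrite hornerZ horner_cheb -muln2 natrM -natdistE; congr (_ * _).
  have [h|h] := ger0P (i%:R - j%:R : R).
    by rewrite -cosN; congr cos; ring.
  by congr cos; ring.
rewrite orthogonal_lower ?mulr0// (leq_trans (size_cheb _))//.
by rewrite /natdist; lia.
Qed.

Lemma affine_ends_eq (f : nat -> R) : f n = f 0%N ->
  (forall i, (0 < i < n)%N -> f i.+1 - 2 * f i + f i.-1 = 0) ->
  forall i, (i <= n)%N -> f i = f 0%N.
Proof.
have [->|n0] := posnP n; first by move=> _ _ i; rewrite leqn0 => /eqP ->.
move=> fn f2.
have E i : (i <= n)%N -> f i = f 0%N + i%:R * (f 1%N - f 0%N).
  elim/ltn_ind : i => -[|[|i]] IH iln; first by ring.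
    by ring.
  have /f2 /= : (0 < i.+1 < n)%N by [].
  rewrite (IH i.+1)// 1?ltnW// (IH i)// 1?ltnW// 1?ltnW//.
  by rewrite -!(natr1 _ : _ = _.+1%:R); nra.
have : n%:R * (f 1%N - f 0%N) = 0 by have := E n (leqnn n); rewrite fn; lra.
move=> /eqP; rewrite mulf_eq0 pnatr_eq0 eqn0Ngt n0 /= => /eqP h i /E ->.
by rewrite h mulr0 addr0.
Qed.

(** Vanishing second differences make A v affine in i, and the symmetry of v makes its two ends
    equal. *)
Lemma kern_row_const i : (i <= n)%N -> kern_row i = kern_row 0.
Proof.
apply: affine_ends_eq; last exact: kern_row_diff2.
rewrite /kern_row [LHS](reindex_inj rev_ord_inj)/=; apply: eq_bigr => j _.
rewrite -trig_symmetric; congr (_ * kern _%:R); rewrite /natdist.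
by have := ltn_ord j; lia.
Qed.

(** As A v is constant and v has sum 1, the value v^T A v is that constant. *)
Lemma critical_exponentE : critical_exponent v = kern_row 0.
Proof.
rewrite /critical_exponent mxE.
under eq_bigr => j _ do rewrite mxE mulr_suml.
rewrite exchange_big/= -[RHS]mul1r -trig_sum1 mulr_suml.
apply: eq_bigr => i _; rewrite -(@kern_row_const i) -1?ltnS// /kern_row mulr_sumr.
apply: eq_bigr => j _; rewrite !mxE -natdistE -kern_digamma//.
by rewrite -mulrA [kern _ * _]mulrC.
Qed.

End system.
End trigonometric_coefficients.

Local Close Scope complex_scope.

(** * Definiteness of the kernel matrix *)

Local Open Scope complex_scope.

(** * The value of P_n at 0 for even n *)

Section even_degree.
Context {R : realType}.
Variable P : nat -> {poly R}.
Hypothesis hP : orthogonal_system P.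
Variables (n : nat) (v : 'cV[R]_n.+1).
Hypothesis hv : trig_coefficients P v.
Hypothesis n_even : ~~ odd n.

(** Evenness is read off the trigonometric expansion: all frequencies are even, so t -> pi - t,
    which negates cos t, fixes the cosine sums and negates the sine sums. *)
Lemma even_polynomial : P n \Po (- 'X) = P n.
Proof.
apply/eqP; rewrite -subr_eq0; apply/eqP; apply: (@poly_vanish _ _ (-1) 1); first by lra.
move=> x x1; rewrite hornerD hornerN horner_comp hornerN hornerX.
have xE : cos (acos x) = x by rewrite acosK// in_itv/=; lra.
have h1 := trig_re hv (acos x); have h2 := trig_re hv (pi - acos x).
have h3 := trig_im hv (acos x); have h4 := trig_im hv (pi - acos x).
move: h1 h2 h3 h4; have -> : cos (pi - acos x) = - x.
  by rewrite addrC cosDpi cosN xE.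
rewrite xE.
have piS (j : nat) : 2 * j.+1%:R * pi = 2 * j%:R * pi + pi + pi :> R.
  by rewrite -(natr1 j); ring.
have cosn (j : nat) : cos (2 * j%:R * pi) = 1 :> R.
  by elim: j => [|j IH]; rewrite ?mulr0 ?mul0r ?cos0// piS !cosDpi opprK.
have sinn (j : nat) : sin (2 * j%:R * pi) = 0 :> R.
  by elim: j => [|j IH]; rewrite ?mulr0 ?mul0r ?sin0// piS !sinDpi opprK.
have cosk (j : nat) : cos (2 * j%:R * (pi - acos x)) = cos (2 * j%:R * acos x).
  by rewrite mulrBr cosB cosn sinn mul1r mul0r addr0.
have sink (j : nat) : sin (2 * j%:R * (pi - acos x)) = - sin (2 * j%:R * acos x).
  by rewrite mulrBr sinB cosn sinn mul1r mul0r sub0r.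
have nE : n%:R = 2 * n./2%:R :> R.
  by rewrite -natrM mul2n -[in LHS](odd_double_half n) (negbTE n_even).
rewrite nE cosk sink => c1 c2 s1 s2.
have {}c2 : cos (2 * n./2%:R * acos x) * (P n).[- x] = cos (2 * n./2%:R * acos x) * (P n).[x].
  by rewrite c1 c2; apply: eq_bigr => k _; rewrite cosk.
have {}s2 : sin (2 * n./2%:R * acos x) * (P n).[- x] = sin (2 * n./2%:R * acos x) * (P n).[x].
  apply: oppr_inj; rewrite -mulNr s2 s1 -sumrN; apply: eq_bigr => k _.
  by rewrite sink mulrN.
(* Either factor may vanish at x, so the two identities are combined through cos^2 + sin^2 = 1. *)
have := cos2Dsin2 (2 * n./2%:R * acos x); move: (cos _) (sin _) c2 s2 => c s c2 s2 cs.
have -> : (P n).[- x] = (c ^+ 2 + s ^+ 2) * (P n).[- x] by rewrite cs mul1r.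
rewrite mulrDl !expr2 -!mulrA c2 s2 !mulrA -mulrDl -!expr2 cs mul1r; exact: subrr.
Qed.

(* Otherwise P_n = x^2 q with q of lower degree, and P_n would not be orthogonal
   to q. *)
Lemma even_polynomial_root0 : (P n).[0] != 0.
Proof.
apply/eqP => P0.
have c0 : (P n)`_0 = 0 by rewrite -horner_coef0.
have c1 : (P n)`_1 = 0.
  have := congr1 (fun p : {poly R} => p`_1) even_polynomial.
  have NX : - 'X = (-1) *: 'X :> {poly R} by rewrite scaleN1r.
  rewrite NX comp_polyE coef_sum.
  have [sz|sz] := leqP (size (P n)) 1; first by move=> _; rewrite nth_default.
  rewrite (bigD1 (Ordinal sz))//= big1 ?addr0; last first.
    move=> [j jn] /= j1; rewrite coefZ exprZn coefZ coefXn.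
    rewrite (_ : 1%N == j = false) ?mulr0//.
    by apply: contraNF j1 => /eqP ?; apply/eqP/val_inj.
  by rewrite coefZ expr1 coefZ coefX eqxx mulr1; lra.
pose q := drop_poly 2 (P n).
have PE : P n = q * 'X^2.
  rewrite -[LHS](poly_take_drop 2) (_ : take_poly 2 (P n) = 0) ?add0r//.
  apply/polyP => -[|[|j]]; rewrite coef_take_poly coef0 //=.
have sP : size (P n) = n.+1 by case: hP.
have q0 : q != 0.
  by apply/eqP => q0; move: sP; rewrite PE q0 mul0r size_poly0.
have := orthogonal_lower hP (n := n) (q := q).
rewrite size_drop_poly sP subSS leq_subr => /(_ isT).
have -> : q * P n = (q * 'X) * (q * 'X) by rewrite PE; ring.
by have := @wint_sqr_gt0 R (q * 'X); rewrite mulf_neq0 ?polyX_eq0// => /(_ isT); lra.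
Qed.

(** At theta = pi/2 the exponentials e^{2ik theta} are (-1)^k, so this sum is P_n(0) up to a
    unit. *)
Lemma alternating_sum_neq0 : \sum_(k < n.+1) (-1) ^+ k * v k 0 != 0.
Proof.
apply/eqP => s0; have /eqP := even_polynomial_root0; apply.
have h := hv (pi / 2); rewrite cos_pihalf in h.
have {}h : cis (n%:R * (pi / 2)) * ((P n).[0])%:C = 0.
  rewrite h [RHS](_ : 0 = (\sum_(k < n.+1) (-1) ^+ k * v k 0)%:C); last by rewrite s0.
  rewrite rmorph_sum/=; apply: eq_bigr => k _; rewrite rmorphM rmorphXn/= mulrC; congr (_ * _).
  have -> : 2 * k%:R * (pi / 2) = k%:R * pi :> R by field.
  rewrite cis_natM /cis cospi sinpi; congr (_ ^+ _).
move/eqP: h; rewrite mulf_eq0 (negbTE (cis_neq0 _))/= => /eqP[].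
by [].
Qed.

End even_degree.

(** * The quadratic form of the matrix x^|i-j| *)

Section geometric_form.
Context {R : realType}.
Implicit Types (x : R) (w : nat -> R) (N : nat).

Definition geom_form N x w : R :=
  \sum_(i < N) \sum_(j < N) w i * w j * x ^+ natdist i j.

(** Horner form of the sum of w_i x^{N-i} over i < N, the coupling of index N to all earlier
    ones. *)
Fixpoint geom_tail w x N : R :=
  if N is N'.+1 then x * (geom_tail w x N' + w N') else 0.

Lemma geom_tailE w x N : geom_tail w x N = \sum_(i < N) w i * x ^+ (N - i).
Proof.
elim: N => [|N IH]; first by rewrite big_ord0.
rewrite big_ord_recr/= IH mulrDr mulr_sumr subSnn expr1 [x * w N]mulrC; congr (_ + _).
apply: eq_bigr => i _; rewrite subSn 1?ltnW// exprS; ring.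
Qed.

(** Index N adds 2 w_N T + w_N^2, where T is the tail, completing T^2 to (T + w_N)^2. Writing 1 =
    x^2 + (1 - x^2) in front of it gives the next tail squared and one new square. *)
Lemma geom_formE N x w : geom_form N x w =
  geom_tail w x N ^+ 2 + (1 - x ^+ 2) * \sum_(k < N) (geom_tail w x k + w k) ^+ 2.
Proof.
elim: N => [|N IH]; first by rewrite /geom_form !big_ord0 mulr0 addr0 expr0n.
have -> : geom_form N.+1 x w = geom_form N x w + 2 * w N * geom_tail w x N + w N ^+ 2.
  rewrite /geom_form big_ord_recr/=.
  under eq_bigr do rewrite big_ord_recr/=.
  rewrite big_split/= big_ord_recr/= /natdist subnn expr0 mulr1 expr2.
  rewrite [in X in _ + X + (_ + _)](eq_bigr (fun i : 'I_N => w N * (w i * x ^+ (N - i)))).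
    rewrite [in X in _ + _ + (X + _)](eq_bigr (fun i : 'I_N => w N * (w i * x ^+ (N - i)))).
      by rewrite -mulr_sumr -geom_tailE; ring.
    by move=> i _; rewrite (_ : (i - N)%N = 0%N) ?addn0 ?mulrA//; have := ltn_ord i; lia.
  move=> i _; rewrite (_ : (i - N)%N = 0%N) ?add0n; last by have := ltn_ord i; lia.
  by rewrite mulrA [w N * _]mulrC.
by rewrite IH big_ord_recr/=; ring.
Qed.

Lemma geom_form_ge0 N x w : 0 <= x <= 1 -> 0 <= geom_form N x w.
Proof.
move=> x1; rewrite geom_formE addr_ge0 ?sqr_ge0// mulr_ge0 ?sumr_ge0//.
  by rewrite subr_ge0 expr_le1; case/andP: x1.
by move=> i _; exact: sqr_ge0.
Qed.

(** If all squares vanish, then every T_k + w_k is 0; the recursion makes each T_k vanish too, and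
    with it w_k. *)
Lemma geom_form_gt0 N x w : 0 < x < 1 -> (exists2 k, (k < N)%N & w k != 0) ->
  0 < geom_form N x w.
Proof.
move=> /andP[x0 x1] [k kN wk]; rewrite lt_neqAle geom_form_ge0 ?(ltW x0) ?(ltW x1)// andbT.
apply: contraNneq wk => /esym/eqP; rewrite geom_formE.
have x2 : 0 < 1 - x ^+ 2 by rewrite subr_gt0 expr_lt1// ltW.
have s0 : 0 <= \sum_(k < N) (geom_tail w x k + w k) ^+ 2.
  by apply: sumr_ge0 => i _; exact: sqr_ge0.
rewrite paddr_eq0 ?sqr_ge0 ?mulr_ge0 ?(ltW x2)// => /andP[_].
rewrite mulf_eq0 (gt_eqF x2)/= psumr_eq0 => [/allP h|i _]; last exact: sqr_ge0.
have {}h i : (i < N)%N -> geom_tail w x i + w i = 0.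
  move=> iN; have := h (Ordinal iN); rewrite mem_index_enum => /(_ isT).
  by rewrite /= sqrf_eq0 => /eqP.
have z i : (i <= N)%N -> geom_tail w x i = 0.
  by case: i => [//|i] iN /=; rewrite h// mulr0.
by have := h _ kN; rewrite z ?add0r 1?ltnW// => ->.
Qed.

Lemma geom_form_bound N x w : 0 <= x <= 1 ->
  geom_form N x w <= \sum_(i < N) \sum_(j < N) `|w i * w j|.
Proof.
move=> /andP[x0 x1]; apply: ler_sum => i _; apply: ler_sum => j _.
rewrite (le_trans (ler_norm _))// normrM ler_piMr// ger0_norm ?exprn_ge0//.
exact: exprn_ile1.
Qed.

End geometric_form.

Section kernel_matrix.
Context {R : realType}.
Notation mu := (@lebesgue_measure R).

Definition kern_form N (w : nat -> R) : R :=
  \sum_(i < N) \sum_(j < N) w i * w j * kern (natdist i j)%:R.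

Lemma Rintegral_form N (w : nat -> R) (f : nat -> R -> R) (D : set R) : measurable D ->
  (forall m, mu.-integrable D (EFin \o f m)) ->
  mu.-integrable D (EFin \o (fun t =>
    \sum_(i < N) \sum_(j < N) w i * w j * f (natdist i j) t)) /\
  \int[mu]_(t in D) (\sum_(i < N) \sum_(j < N) w i * w j * f (natdist i j) t) =
  \sum_(i < N) \sum_(j < N) w i * w j * \int[mu]_(t in D) f (natdist i j) t.
Proof.
move=> mD fi.
have fj (i j : 'I_N) : mu.-integrable D (EFin \o (fun t => w i * w j * f (natdist i j) t)).
  exact: integrableZR.
split; first by apply: integrable_sumR => // i; apply: integrable_sumR.
rewrite Rintegral_sum//; last by move=> i; exact: integrable_sumR.
apply: eq_bigr => i _; rewrite Rintegral_sum//.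
by apply: eq_bigr => j _; rewrite RintegralZl.
Qed.

Lemma expR_natM (m : nat) (t : R) : expR (- (m%:R * t)) = expR (- t) ^+ m.
Proof. by rewrite -expRM_natl mulrN. Qed.

(** Sum zero kills the term e^{-t}/t, which is common to all entries. What remains is minus a
    positive function of t times the geometric form at e^{-t}. *)
Lemma kern_form_lt0 N (w : nat -> R) : \sum_(i < N) w i = 0 ->
  (exists2 k, (k < N)%N & w k != 0) -> kern_form N w < 0.
Proof.
move=> w0 wk.
have [iE E] := @Rintegral_form N w (fun m => kernel_integrand m%:R) `]0, +oo[
  (measurable_itv _) (fun m => kernel_integrable (ler0n _ m)).
pose g (t : R) := damped sech t / (1 - expR (- t)) * geom_form N (expR (- t)) w.
have gE t : \sum_(i < N) \sum_(j < N) w i * w j * kernel_integrand (natdist i j)%:R t = - g t.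
  rewrite /g /geom_form mulr_sumr -sumrN.
  have -> : \sum_(i < N) \sum_(j < N) w i * w j * kernel_integrand (natdist i j)%:R t =
      \sum_(i < N) (w i * (expR (- t) / t * \sum_(j < N) w j) +
       - (damped sech t / (1 - expR (- t)) * \sum_(j < N) w i * w j * expR (- t) ^+ natdist i j)).
    apply: eq_bigr => i _; rewrite !mulr_sumr -sumrB; apply: eq_bigr => j _.
    by rewrite /kernel_integrand expR_natM; ring.
  by rewrite w0; apply: eq_bigr => i _; rewrite !mulr0 add0r.
have ig : mu.-integrable `]0, +oo[ (EFin \o g).
  have := integrableZR (-1) (measurable_itv _) iE; apply: eq_integrable => // t _.
  by rewrite /= gE mulrNN mul1r.
have e01 (t : R) : 0 < t -> 0 < expR (- t) < 1.
  by move=> t0; rewrite expR_gt0 expRN_lt1.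
have s0 (t : R) : 0 < t -> 0 < damped sech t / (1 - expR (- t)).
  move=> t0; rewrite damped_sech divr_gt0 ?divr_gt0 ?mulr_gt0 ?expR_gt0//.
    by rewrite subr_gt0 expRN_lt1.
have gp (t : R) : 0 < t -> 0 < g t.
  by move=> t0; rewrite mulr_gt0 ?s0// geom_form_gt0// e01.
have -> : kern_form N w = - \int[mu]_(t in `]0, +oo[) g t.
  rewrite -[RHS]mulN1r -RintegralZl//.
  rewrite /kern_form; under eq_bigr do under eq_bigr do rewrite kernE.
  by rewrite -E; apply: eq_Rintegral => t _; rewrite gE mulN1r.
rewrite oppr_lt0; apply: (Rintegral_gt0 (a := 1) (b := 2) _ ig) => //.
- by move=> t /=; rewrite in_itv/= andbT => /gp/ltW.
- by lra.
- by move=> t /=; rewrite !in_itv/= andbT => /andP[t1 _]; lra.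
- move=> t /andP[t1 _]; have t0 : 0 < t by lra.
  have cs : {for t, continuous (fun t => damped sech t / (1 - expR (- t)))}.
    rewrite (_ : damped sech = fun t => 2 * expR (- t) / (1 + expR (- t))); last first.
      by apply/funext => y; rewrite damped_sech.
    apply: der_continuous; der; first by rewrite gt_eqF// addr_gt0// expR_gt0.
    by rewrite gt_eqF// subr_gt0 expRN_lt1.
  apply: cvgM; first exact: cs.
  apply: (@der_continuous _ (fun t => geom_form N (expR (- t)) w)).
  by apply: der_sum => i; apply: der_sum => j; der.
- by move=> t /andP[t1 _]; apply: gp; lra.
Qed.

Lemma kern_incr (m : nat) : kern m%:R < kern m.+1%:R :> R.
Proof.
have [im E] := @kernD1_integral R m%:R (ler0n _ m).
rewrite -subr_gt0 -natr1 {}E.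
have p1 (t : R) : 0 < 1 + expR (- t) by rewrite addr_gt0// expR_gt0.
have f0 (t : R) : 0 < 2 * expR (- ((m%:R + 1) * t)) / (1 + expR (- t)).
  by rewrite divr_gt0// mulr_gt0// expR_gt0.
apply: (Rintegral_gt0 (a := 1) (b := 2) _ im) => //.
- by rewrite ltr1n.
- by move=> t /=; rewrite !in_itv/= andbT => /andP[t1 _]; lra.
- by move=> t _; apply: der_continuous; der; rewrite gt_eqF.
Qed.

(** The integrands of the increments decrease in m. With [kern_incr] this settles the signs in the
    maximum principle for v. *)
Lemma kern_concave (m : nat) :
  kern m.+2%:R - 2 * kern m.+1%:R + kern m%:R < 0 :> R.
Proof.
have [i0 E0] := @kernD1_integral R m%:R (ler0n _ m).
have [i1 E1] := @kernD1_integral R m.+1%:R (ler0n _ m.+1).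
rewrite (_ : _ + _ = - ((kern (m%:R + 1) - kern m%:R) - (kern (m.+1%:R + 1) - kern m.+1%:R))); last first.
  by rewrite !natr1; move: (kern _) (kern _) (kern _) => a b c; ring.
rewrite oppr_lt0 {}E0 {}E1 -RintegralB//.
have p1 (t : R) : 0 < 1 + expR (- t) by rewrite addr_gt0// expR_gt0.
have f0 (t : R) : 0 < t -> 0 < 2 * expR (- ((m%:R + 1) * t)) / (1 + expR (- t)) -
    2 * expR (- ((m.+1%:R + 1) * t)) / (1 + expR (- t)).
  move=> t0; rewrite -mulrBl divr_gt0// -mulrBr mulr_gt0// subr_gt0 ltr_expR.
  by rewrite ltrN2 ltr_pM2r// ltrD2r ltr_nat.
apply: (Rintegral_gt0 (a := 1) (b := 2) _ (integrableBR (measurable_itv _) i0 i1)) => //.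
- by move=> t /=; rewrite in_itv/= andbT => /f0/ltW.
- by rewrite ltr1n.
- by move=> t /=; rewrite !in_itv/= andbT => /andP[t1 _]; lra.
- by move=> t _; apply: der_continuous; der; rewrite gt_eqF.
- by move=> t /andP[t1 _]; apply: f0; lra.
Qed.

End kernel_matrix.

(** * The extremal vector v and its positivity *)

Section extremal_vector.
Context {R : realType}.
Variable P : nat -> {poly R}.
Hypothesis hP : orthogonal_system P.
Variables (n : nat) (v : 'cV[R]_n.+1).
Hypothesis hv : trig_coefficients P v.

Definition matrix_form (x : 'cV[R]_n.+1) : R :=
  \sum_(i < n.+1) \sum_(j < n.+1) x i 0 * x j 0 * kern (natdist i j)%:R.

Lemma matrix_formE (x : 'cV[R]_n.+1) :
  matrix_form x = kern_form n.+1 (fun i => x (inord i) 0).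
Proof.
by apply: eq_bigr => i _; apply: eq_bigr => j _; rewrite !inord_val.
Qed.

Lemma matrix_form_lt0 (x : 'cV[R]_n.+1) : \sum_(i < n.+1) x i 0 = 0 -> x != 0 ->
  matrix_form x < 0.
Proof.
move=> x0 xn; rewrite matrix_formE; apply: kern_form_lt0.
  by rewrite -[RHS]x0; apply: eq_bigr => i _; rewrite inord_val.
have [i xi] : exists i, x i 0 != 0.
  apply: contrapT => h; move/eqP: xn; apply; apply/matrixP => i j; rewrite (ord1 j) mxE.
  by apply/eqP/negPn/negP => xi; apply: h; exists i.
by exists i => //; rewrite inord_val.
Qed.

Lemma kern_row_sum (y : 'cV[R]_n.+1) :
  \sum_(i < n.+1) \sum_(j < n.+1) y i 0 * v j 0 * kern (natdist i j)%:R =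
  critical_exponent v * \sum_(i < n.+1) y i 0.
Proof.
rewrite (critical_exponentE hP hv) mulr_sumr; apply: eq_bigr => i _.
rewrite -(kern_row_const hP hv (i := i)) -1?ltnS// /kern_row mulr_suml.
by apply: eq_bigr => j _; move: (kern _) => c; ring.
Qed.

(* The quadratic form x |-> t phi(x)^2 - x^T A x, whose kernel is spanned by v. *)
Lemma matrix_form_shift (x : 'cV[R]_n.+1) :
  matrix_form (x - phi_form x *: v) =
  matrix_form x - critical_exponent v * phi_form x ^+ 2.
Proof.
set p := phi_form x.
have sym (y z : 'cV[R]_n.+1) :
    \sum_(i < n.+1) \sum_(j < n.+1) y i 0 * z j 0 * kern (natdist i j)%:R =
    \sum_(i < n.+1) \sum_(j < n.+1) z i 0 * y j 0 * kern (natdist i j)%:R.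
  rewrite exchange_big/=; apply: eq_bigr => i _; apply: eq_bigr => j _.
  by rewrite [z i 0 * _]mulrC /natdist addnC.
have -> : matrix_form (x - p *: v) = matrix_form x
    - p * (\sum_(i < n.+1) \sum_(j < n.+1) x i 0 * v j 0 * kern (natdist i j)%:R)
    - p * (\sum_(i < n.+1) \sum_(j < n.+1) v i 0 * x j 0 * kern (natdist i j)%:R)
    + p ^+ 2 * (\sum_(i < n.+1) \sum_(j < n.+1) v i 0 * v j 0 * kern (natdist i j)%:R).
  rewrite !mulr_sumr -!sumrB -big_split/=; apply: eq_bigr => i _.
  rewrite !mulr_sumr -!sumrB -big_split/=; apply: eq_bigr => j _.
  by rewrite !mxE; move: (kern _) => c; ring.
rewrite (sym v x) !kern_row_sum (trig_sum1 hP hv) -/(phi_form x) -/p.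
by move: (critical_exponent v) (matrix_form x) => t m; ring.
Qed.

(** The difference [x - phi_form x *: v] has sum 0, so its form is negative unless it vanishes, and
    by [matrix_form_shift] the hypothesis rules out a negative value. *)
Lemma matrix_form_le0 (x : 'cV[R]_n.+1) :
  critical_exponent v * phi_form x ^+ 2 - matrix_form x <= 0 -> x = phi_form x *: v.
Proof.
move=> h; apply/eqP; rewrite -subr_eq0; apply/negPn/negP => /matrix_form_lt0.
rewrite matrix_form_shift => /(_ _)/lt_geF h2.
suff s0 : \sum_(i < n.+1) (x - phi_form x *: v) i 0 = 0.
  by have := h2 s0; rewrite -subr_le0 opprB => /negbT; rewrite -ltNge; lra.
under eq_bigr do rewrite !mxE.
by rewrite sumrB -mulr_sumr (trig_sum1 hP hv) mulr1 subrr.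
Qed.

Let d (m : nat) : R := kern m.+1%:R - kern m%:R.

Let coef (i j : nat) : R :=
  kern (natdist i.+1 j)%:R - 2 * kern (natdist i j)%:R + kern (natdist i.-1 j)%:R.

Let coef_lt0 (i j : nat) : (0 < i)%N -> i != j -> coef i j < 0.
Proof.
move=> i0; rewrite neq_ltn /coef => /orP[ij|ji].
  rewrite (_ : natdist i.+1 j = (j - i.+1)%N); last by rewrite /natdist; lia.
  rewrite (_ : natdist i j = (j - i.+1).+1); last by rewrite /natdist; lia.
  rewrite (_ : natdist i.-1 j = (j - i.+1).+2); last by rewrite /natdist; lia.
  have := @kern_concave R (j - i.+1); move: (kern _) (kern _) (kern _) => a b c; lra.
rewrite (_ : natdist i.+1 j = (i - j.+1).+2); last by rewrite /natdist; lia.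
rewrite (_ : natdist i j = (i - j.+1).+1); last by rewrite /natdist; lia.
rewrite (_ : natdist i.-1 j = (i - j.+1)%N); last by rewrite /natdist; lia.
exact: kern_concave.
Qed.

(** The distance from i + 1 to j + 1 is that from i to j, so only the first term of one sum and the
    last of the other survive. *)
Let col_sumS (i : nat) : (i <= n)%N ->
  \sum_(j < n.+1) (kern (natdist i.+1 j)%:R : R) - \sum_(j < n.+1) kern (natdist i j)%:R =
  kern i.+1%:R - kern (n - i)%:R.
Proof.
move=> iln; rewrite big_ord_recl [X in _ - X]big_ord_recr/=.
rewrite (_ : natdist i.+1 0 = i.+1); last by rewrite /natdist; lia.
rewrite (_ : natdist i n = n - i)%N; last by rewrite /natdist; lia.
rewrite (eq_bigr (fun j : 'I_n => kern (natdist i j)%:R)) => [|j _]; last first.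
  by congr kern; congr _%:R; rewrite /natdist /bump /=; lia.
by move: (kern _) (kern _) (\sum_(_ < n) _) => a b c; ring.
Qed.

Let coef_sum_gt0 (i : nat) : (0 < i < n)%N -> 0 < \sum_(j < n.+1) coef i j.
Proof.
have aux (a b c e : R) : a < b -> c < e -> 0 < b - c - (a - e) by lra.
move=> /andP[i0 ij].
have h1 := @col_sumS i (ltnW ij); have h2 := @col_sumS i.-1.
rewrite prednK// in h2; have {}h2 := h2 (leq_trans (leq_pred _) (ltnW ij)).
have -> : \sum_(j < n.+1) coef i j =
    (\sum_(j < n.+1) (kern (natdist i.+1 j)%:R : R) - \sum_(j < n.+1) kern (natdist i j)%:R)
    - (\sum_(j < n.+1) (kern (natdist i j)%:R : R) - \sum_(j < n.+1) kern (natdist i.-1 j)%:R).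
  rewrite -!sumrB; apply: eq_bigr => j _; rewrite /coef.
  by move: (kern _) (kern _) (kern _) => a b c; ring.
rewrite h1 h2 (_ : n - i.-1 = (n - i).+1)%N; last by lia.
exact: aux (kern_incr _) (kern_incr _).
Qed.

(** Vanishing second differences of A v with the diagonal term eliminated, so that only weights of
    known sign remain: negative off the diagonal, positive in total. *)
Let coef_row (i : 'I_n.+1) : (0 < i < n)%N ->
  \sum_(j < n.+1 | j != i) coef i j * (v j 0 - v i 0) = - (\sum_(j < n.+1) coef i j) * v i 0.
Proof.
move=> ij.
have <- : \sum_(j < n.+1) coef i j * (v j 0 - v i 0) = - (\sum_(j < n.+1) coef i j) * v i 0.
  under eq_bigr do rewrite mulrBr.
  rewrite sumrB -mulr_suml mulNr -[RHS]add0r; congr (_ - _).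
  transitivity (kern_row v i.+1 - 2 * kern_row v i + kern_row v i.-1); last exact: (kern_row_diff2 hP hv ij).
  rewrite /kern_row mulr_sumr -sumrB -big_split/=; apply: eq_bigr => j _.
  by rewrite /coef; move: (kern _) (kern _) (kern _) => a b c; ring.
by rewrite [RHS](bigD1 i isT) /= subrr mulr0 add0r.
Qed.

(* Maximum principle: at interior points v is a weighted average of its other
   values with positive weights of total mass less than 1. *)
Lemma extremal_vector_gt0 k : 0 < v k 0.
Proof.
have s1 := trig_sum1 hP hv.
pose i := [arg min_(i < ord0 : 'I_n.+1) v i 0]%O.
have imin j : v i 0 <= v j 0.
  by rewrite /i; case: arg_minP => // i0 _ h; exact: h.
pose l := [arg max_(i > ord0 : 'I_n.+1) v i 0]%O.
have lmax j : v j 0 <= v l 0.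
  by rewrite /l; case: arg_maxP => // i0 _ h; exact: h.
have vl : 0 < v l 0.
  rewrite ltNge; apply/negP => vl; have : \sum_(j < n.+1) v j 0 <= 0.
    by apply: sumr_le0 => j _; exact: le_trans (lmax j) vl.
  by rewrite s1 ler10.
apply: lt_le_trans (imin k); rewrite ltNge; apply/negP => vi.
(* At an interior minimum with v_i <= 0 the two sides of [coef_row] have opposite signs, so both
   vanish and v_i = 0. The term of the positive maximum l is then nonzero, a contradiction. *)
have [iint|] := boolP (0 < i < n)%N.
  have cs := coef_sum_gt0 iint; have := coef_row iint.
  have le0 : \sum_(j < n.+1 | j != i) coef i j * (v j 0 - v i 0) <= 0.
    apply: sumr_le0 => j ji; rewrite mulr_le0_ge0 ?subr_ge0//.
    by rewrite ltW// coef_lt0 1?eq_sym//; case/andP: iint.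
  have ge0 : 0 <= - (\sum_(j < n.+1) coef i j) * v i 0.
    by rewrite mulNr -mulrN mulr_ge0 ?oppr_ge0// ltW.
  move=> E; have v0 : v i 0 = 0.
    apply: (mulfI (lt0r_neq0 cs)); rewrite mulr0; move: le0 ge0; rewrite E mulNr.
    by move: (_ * v i 0) => a a0 a1; lra.
  move: E; rewrite v0 mulr0 => /eqP; rewrite -oppr_eq0 -sumrN psumr_eq0.
    move=> /allP h; have lz : l != i by apply: contraTneq vl => ->; rewrite v0 ltxx.
    have := h l (mem_index_enum _); rewrite lz /= oppr_eq0 subr0 mulf_eq0 => /orP[|].
      by rewrite lt_eqF// coef_lt0 1?eq_sym//; case/andP: iint.
    by rewrite gt_eqF.
  move=> j ji; rewrite oppr_ge0 subr0 mulr_le0_ge0//.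
    by rewrite ltW// coef_lt0 1?eq_sym//; case/andP: iint.
  by rewrite -v0 imin.
(* The minimum is at an end, and by symmetry both ends carry it. The positive maximum is therefore
   interior, where [coef_row] has a nonnegative left and a negative right side. *)
rewrite negb_and -leqNgt leqn0 -leqNgt => ibd.
have vbd (j : 'I_n.+1) : (j == 0%N :> nat) || (n <= j)%N -> v j 0 = v i 0.
  move=> jbd; have [->//|->] : j = i \/ j = rev_ord i.
    have jn := ltn_ord j; have iN := ltn_ord i.
    have [ij|ij] := eqVneq (j : nat) i; [left|right]; apply/val_inj => //=.
    by move: ij jbd ibd => /eqP; lia.
  by rewrite -(trig_symmetric hv).
have lint : (0 < l < n)%N.
  rewrite lt0n ltnNge -negb_or; apply/negP => /vbd h.
  by move: vl; rewrite h ltNge vi.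
have cs := coef_sum_gt0 lint; have E := coef_row lint.
have : 0 <= \sum_(j < n.+1 | j != l) coef l j * (v j 0 - v l 0).
  apply: sumr_ge0 => j jl; rewrite mulr_le0 ?subr_le0//.
  by rewrite ltW// coef_lt0 1?eq_sym//; case/andP: lint.
by rewrite E mulNr oppr_ge0 leNgt mulr_gt0.
Qed.

End extremal_vector.

Local Close Scope complex_scope.

(** * Positive definite functions *)

Section Rintegral_real.
Context {R : realType}.
Notation mu := (@lebesgue_measure R).
Implicit Types (D : set R) (f g : R -> R).

Lemma RintegralZR D f (c : R) : measurable D -> mu.-integrable D (EFin \o f) ->
  \int[mu]_(x in D) (c * f x) = c * \int[mu]_(x in D) f x.
Proof. by move=> mD fi; rewrite RintegralZl. Qed.

Lemma RintegralDR D f g : measurable D -> mu.-integrable D (EFin \o f) ->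
  mu.-integrable D (EFin \o g) ->
  \int[mu]_(x in D) (f x + g x) = \int[mu]_(x in D) f x + \int[mu]_(x in D) g x.
Proof. by move=> mD fi gi; rewrite RintegralD. Qed.

Lemma RintegralBR D f g : measurable D -> mu.-integrable D (EFin \o f) ->
  mu.-integrable D (EFin \o g) ->
  \int[mu]_(x in D) (f x - g x) = \int[mu]_(x in D) f x - \int[mu]_(x in D) g x.
Proof. by move=> mD fi gi; rewrite RintegralB. Qed.

Lemma integral_EFin D f : mu.-integrable D (EFin \o f) -> measurable D ->
  (\int[mu]_(x in D) (f x)%:E)%E = (\int[mu]_(x in D) f x)%:E.
Proof. by move=> fi mD; rewrite /Rintegral fineK//; exact: integrable_fin_num. Qed.

End Rintegral_real.

Section test_function_bounds.
Context {R : realType}.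
Notation mu := (@lebesgue_measure R).
Implicit Types F : R -> R.

Lemma variation_pair (A : set R) (f : R -> R) :
  bounded_variation_on A f ->
  exists2 M, 0 <= M & forall x y, A x -> A y -> `|f y - f x| <= M.
Proof.
move=> [M hM].
have h x y : A x -> A y -> x < y -> `|f y - f x| <= M.
  move=> Ax Ay xy; have := hM x [:: y]; rewrite /variation /= big_nat1 /= xy; apply => //.
  by move=> z; rewrite !inE => /orP[]/eqP ->.
exists `|M| => // x y Ax Ay; have [xy|yx|->] := ltgtP x y.
- exact: le_trans (h _ _ Ax Ay xy) (ler_norm M).
- by rewrite distrC; exact: le_trans (h _ _ Ay Ax yx) (ler_norm M).
- by rewrite subrr normr0.
Qed.

Variable F : R -> R.
Hypothesis tF : test_function F.

(** Bounded variation bounds F(x) e^{e|x|} by its size at 0 plus its variation; integrability alone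
    gives no pointwise decay. *)
Lemma test_function_decay : exists2 e, 1 / 2 < e &
  exists2 C, 0 < C & forall x, `|F x| <= C * expR (- (e * `|x|)).
Proof.
have [e e2 [_ /variation_pair[M M0 hM]]] := test_decay tF.
exists e => //; exists (`|F 0| + M + 1) => [|x]; first by rewrite ltr_wpDl// addr_ge0.
rewrite expRN -ler_pdivrMr ?invr_gt0 ?expR_gt0// invrK.
have := hM 0 x I I; rewrite normr0 mulr0 expR0 mulr1 => h.
rewrite -[X in _ * X](ger0_norm (expR_ge0 _)) -normrM.
have := ler_normD (F x * expR (e * `|x|) - F 0) (F 0); rewrite subrK.
move: h; move: (`|_ - _|) (`|F 0|) (`|_ * _|) => a b c; lra.
Qed.

(** The difference quotient at 0 is bounded because its variation is; comparison is made with its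
    value at x = 1. *)
Lemma test_function_slope : exists2 C, 0 < C & forall x, `|F x - F 0| <= C * `|x|.
Proof.
have [M M0 hM] := variation_pair (test_slope tF).
exists (`|F 1 - F 0| + M + 1) => [|x]; first by rewrite ltr_wpDl// addr_ge0.
have [->|x0] := eqVneq x 0; first by rewrite subrr normr0 mulr0.
rewrite -ler_pdivrMr ?normr_gt0// -normf_div.
have := hM 1 x (oner_neq0 R) x0; rewrite divr1 => h.
have := ler_normD ((F x - F 0) / x - (F 1 - F 0)) (F 1 - F 0); rewrite subrK.
move: h; move: (`|_ - _|) (`|F 1 - F 0|) (`|_ / _|) => a b c; lra.
Qed.

Lemma test_function_measurable : measurable_fun setT F.
Proof.
have [e e2 [/integrableP[/measurable_EFinP mf _] _]] := test_decay tF.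
rewrite (_ : F = fun x => (F x * expR (e * `|x|)) * expR (- (e * `|x|))); last first.
  by apply/funext => x; rewrite -mulrA -expRD subrr expR0 mulr1.
apply: measurable_funM => //; apply: measurableT_comp => //.
apply: measurableT_comp => //; exact: measurable_funM.
Qed.

Lemma test_function_continuous0 : F x @[x --> 0] --> F 0.
Proof.
have [C C0 hC] := test_function_slope.
apply/cvgrPdist_le => e e0; apply/nbhs_ballP; exists (e / C); first exact: divr_gt0.
move=> x; rewrite /ball/= sub0r normrN => /ltW xe.
by rewrite distrC (le_trans (hC x))// mulrC -ler_pdivlMr.
Qed.

End test_function_bounds.

Section poisson_kernel.
Context {R : realType}.
Notation mu := (@lebesgue_measure R).

(** Integral of e^{-bu} cos(2 pi z u) over u > 0. Its total mass over z is 1/2, not 1, so each side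
    of the centre carries 1/4. *)
Definition poisson (b z : R) : R := b / (b ^+ 2 + (2 * pi * z) ^+ 2).

Lemma poisson_ge0 b z : 0 < b -> 0 <= poisson b z.
Proof. by move=> b0; rewrite divr_ge0 ?addr_ge0 ?sqr_ge0// ltW. Qed.

Lemma poisson_denom_gt0 (b z : R) : 0 < b -> 0 < b ^+ 2 + (2 * pi * z) ^+ 2.
Proof. by move=> b0; rewrite ltr_pwDl ?sqr_ge0// exprn_gt0. Qed.

Lemma poisson_continuous (b p z : R) : 0 < b ->
  {for z, continuous (fun z => poisson b (z - p))}.
Proof.
move=> b0; apply: der_continuous; rewrite /poisson; der.
by rewrite gt_eqF// poisson_denom_gt0.
Qed.

Lemma poisson_itv (b p y z : R) : 0 < b -> y < z ->
  mu.-integrable `]y, z[ (EFin \o (fun t => poisson b (t - p))) /\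
  \int[mu]_(t in `]y, z[) poisson b (t - p) =
  (atan (2 * pi * (z - p) / b) - atan (2 * pi * (y - p) / b)) / (2 * pi).
Proof.
move=> b0 yz; have pi0 : 0 < pi :> R := pi_gt0 R.
pose T (t : R) := atan (2 * pi * (t - p) / b) / (2 * pi).
have dT t : has_der T t (poisson b (t - p)).
  apply: der_eq; first by rewrite /T; der.
  rewrite /poisson /=.
  have -> : 1 + (2 * pi * (t - p) / b) ^+ 2 = (b ^+ 2 + (2 * pi * (t - p)) ^+ 2) / b ^+ 2.
    by field; rewrite gt_eqF.
  have := poisson_denom_gt0 (t - p) b0; move: (b ^+ 2 + _) => D D0.
  move: (pi : R) pi0 => q q0.
  by field; rewrite !gt_eqF.
rewrite mulrBl; apply: (ge0_FTCoo yz (F := T)).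
- by move=> t _; exact: dT.
- by move=> t _; exact: poisson_continuous.
- exact: (cvg_at_right_filter (der_continuous (dT y))).
- exact: (cvg_at_left_filter (der_continuous (dT z))).
- by move=> t _; exact: poisson_ge0.
Qed.

Lemma poisson_le (b z : R) : 0 < b -> poisson b z <= b^-1.
Proof.
move=> b0; rewrite /poisson ler_pdivrMr ?poisson_denom_gt0// mulrDr expr2.
by rewrite mulrA mulVf ?gt_eqF// mul1r lerDl mulr_ge0 ?sqr_ge0// invr_ge0 ltW.
Qed.

(** Comes from the multiplier 1 - cos(2 pi x u), whose nonnegativity turns positivity of the
    transform into an inequality between averages. *)
Definition poisson_diff (b x y : R) : R :=
  poisson b y - (poisson b (y - x) + poisson b (y + x)) / 2.

Lemma poisson_diff_bound (b x y : R) : 0 < b -> `|poisson_diff b x y| <= 2 / b.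
Proof.
move=> b0; have p0 z := poisson_ge0 z b0; have pb z := poisson_le z b0.
have := (p0 y, p0 (y - x), p0 (y + x)); have := (pb y, pb (y - x), pb (y + x)).
rewrite /poisson_diff; move: (poisson b y) (poisson b (y - x)) (poisson b (y + x)) (b^-1).
move=> p1 p2 p3 c [[h1 h2] h3] [[k1 k2] k3]; rewrite ler_norml; lra.
Qed.

Lemma poisson_diff_measurable (b x : R) : 0 < b ->
  measurable_fun setT (poisson_diff b x).
Proof.
move=> b0; have D0 z : b ^+ 2 + (2 * pi * z) ^+ 2 != 0 by rewrite gt_eqF// poisson_denom_gt0.
apply: continuous_measurable_fun => y; apply: der_continuous.
by rewrite /poisson_diff /poisson; der; exact: D0.
Qed.

Lemma poisson_cos_integral (b x y : R) : 0 < b ->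
  let f u := expR (- (b * u)) * (cos (2 * pi * y * u) * (1 - cos (2 * pi * x * u))) in
  mu.-integrable `]0, +oo[ (EFin \o f) /\
  \int[mu]_(u in `]0, +oo[) f u =
  poisson_diff b x y.
Proof.
move=> b0 f; rewrite /poisson_diff.
have [i1 E1] := exp_cos_integral (2 * pi * y) b0.
have [i2 E2] := exp_cos_integral (2 * pi * (y - x)) b0.
have [i3 E3] := exp_cos_integral (2 * pi * (y + x)) b0.
have i4 := integrableZR 2^-1 (measurable_itv _) (integrableDR (measurable_itv _) i2 i3).
have fE u : f u = expR (- (b * u)) * cos (2 * pi * y * u) -
    2^-1 * (expR (- (b * u)) * cos (2 * pi * (y - x) * u) +
            expR (- (b * u)) * cos (2 * pi * (y + x) * u)).
  rewrite /f.
  have -> : 2 * pi * (y - x) * u = 2 * pi * y * u - 2 * pi * x * u by ring.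
  have -> : 2 * pi * (y + x) * u = 2 * pi * y * u + 2 * pi * x * u by ring.
  by rewrite cosB cosD; field.
split.
  have := integrableBR (measurable_itv _) i1 i4; apply: eq_integrable => // u _.
  by rewrite /= fE.
transitivity (\int[mu]_(u in `]0, +oo[) (expR (- (b * u)) * cos (2 * pi * y * u) -
    2^-1 * (expR (- (b * u)) * cos (2 * pi * (y - x) * u) +
            expR (- (b * u)) * cos (2 * pi * (y + x) * u)))).
  by apply: eq_Rintegral => u _; exact: fE.
rewrite RintegralB// RintegralZl//; last exact: integrableDR.
have PE z : b / (b ^+ 2 + (2 * pi * z) ^+ 2) = poisson b z by [].
by rewrite RintegralD// E1 E2 E3 !PE [2^-1 * _]mulrC.
Qed.

End poisson_kernel.

Section positive_definite.
Context {R : realType}.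
Notation mu := (@lebesgue_measure R).

Variable G : R -> R.
Hypothesis G_int : mu.-integrable setT (EFin \o G).
Hypothesis G_ge0 : forall x, 0 <= G x.
Hypothesis G_pos : forall u, 0 <= \int[mu]_(x in setT) (G x * cos (2 * pi * x * u)).

Let mG : measurable_fun setT G.
Proof. by have /integrableP[/measurable_EFinP] := G_int. Qed.

Let mcos (D : set R) (c : R) : measurable_fun D (fun x => cos (c * x)).
Proof.
apply: measurable_funTS; apply: continuous_measurable_fun => x.
by apply: der_continuous; der.
Qed.

Lemma G_bounded_integrable (h : R -> R) (M : R) : measurable_fun setT h ->
  (forall x, `|h x| <= M) -> mu.-integrable setT (EFin \o (fun x => G x * h x)).
Proof.
move=> mh hM; apply: (le_integrableR _ _ _ (integrableZR M measurableT G_int)) => //.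
  exact: measurable_funM.
by move=> x _; rewrite normrM ger0_norm// mulrC ler_wpM2r.
Qed.

Let cos_bound (t : R) : `|cos t| <= 1.
Proof. by rewrite ler_norml cos_geN1 cos_le1. Qed.

Definition damped_average (b x y u : R) : R :=
  G y * (expR (- (b * u)) * (2 + cos (2 * pi * y * u) * (1 - cos (2 * pi * x * u)))).

Lemma damped_average_ge0 b x y u : 0 <= damped_average b x y u.
Proof.
apply: mulr_ge0; first exact: G_ge0.
apply: mulr_ge0; first exact: expR_ge0.
have := cos_geN1 (2 * pi * y * u); have := cos_le1 (2 * pi * y * u).
have := cos_geN1 (2 * pi * x * u); have := cos_le1 (2 * pi * x * u).
move: (cos _) (cos _) => c c'; nra.
Qed.

Lemma damped_average_measurable b x :
  measurable_fun setT
    (fun p : measurableTypeR R * measurableTypeR R => damped_average b x p.1 p.2).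
Proof.
have m1 : measurable_fun setT (fun p : measurableTypeR R * measurableTypeR R => p.1 : R).
  exact: measurable_fst.
have m2 : measurable_fun setT (fun p : measurableTypeR R * measurableTypeR R => p.2 : R).
  exact: measurable_snd.
have mc : measurable_fun setT (@cos R).
  by apply: continuous_measurable_fun; exact: continuous_cos.
apply: measurable_funM; first by have := measurableT_comp mG m1.
apply: measurable_funM.
  apply: measurableT_comp; first exact: measurable_expR.
  apply: measurableT_comp; first exact: oppr_measurable.
  by apply: measurable_funM => //; exact: measurable_cst.
apply: measurable_funD; first exact: measurable_cst.
apply: measurable_funM.
  apply: (measurableT_comp mc); apply: measurable_funM => //.
  by apply: measurable_funM => //; exact: measurable_cst.
apply: measurable_funB; first exact: measurable_cst.
apply: (measurableT_comp mc); apply: measurable_funM => //; exact: measurable_cst.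
Qed.

Lemma damped_average_integral b x y : 0 < b ->
  (\int[mu]_(u in `]0%R, +oo[) (damped_average b x y u)%:E)%E =
  (G y * (2 / b + poisson_diff b x y))%:E.
Proof.
move=> b0; have [ie eE] := exp_integral b0; have [ik kE] := poisson_cos_integral x y b0.
have m0 : measurable (`]0, +oo[ : set R) by exact: measurable_itv.
have i2 := integrableZR 2 m0 ie.
have iD := integrableDR m0 i2 ik.
have iG := integrableZR (G y) m0 iD.
have fE : damped_average b x y = fun u => G y * (2 * expR (- (b * u)) + expR (- (b * u)) *
    (cos (2 * pi * y * u) * (1 - cos (2 * pi * x * u)))).
  by apply/funext => u; rewrite /damped_average; ring.
rewrite fE (integral_EFin iG m0) (RintegralZR (G y) m0 iD) (RintegralDR m0 i2 ik).
by rewrite (RintegralZR 2 m0 ie) eE kE.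
Qed.

Lemma cos_average_integrable u :
  mu.-integrable setT (EFin \o (fun y => G y * cos (2 * pi * y * u))).
Proof.
have -> : (fun y => G y * cos (2 * pi * y * u)) = (fun y => G y * cos (2 * pi * u * y)).
  by apply/funext => y; congr (_ * cos _); ring.
by apply: (G_bounded_integrable (M := 1)) => [|y]; [exact: mcos|exact: cos_bound].
Qed.

Lemma damped_average_integral2 b x u :
  (\int[mu]_(y in setT) (damped_average b x y u)%:E)%E =
  (expR (- (b * u)) * (2 * \int[mu]_(y in setT) G y +
     (1 - cos (2 * pi * x * u)) * \int[mu]_(y in setT) (G y * cos (2 * pi * y * u))))%:E.
Proof.
have ic := cos_average_integrable u.
have i1 := integrableZR 2 measurableT G_int.
have i2 := integrableZR (1 - cos (2 * pi * x * u)) measurableT ic.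
have iD := integrableDR measurableT i1 i2.
have iE := integrableZR (expR (- (b * u))) measurableT iD.
transitivity (\int[mu]_(y in setT) (expR (- (b * u)) * (2 * G y +
    (1 - cos (2 * pi * x * u)) * (G y * cos (2 * pi * y * u))))%:E)%E.
  by apply: eq_integral => y _; congr (_%:E); rewrite /damped_average; ring.
rewrite (integral_EFin iE measurableT) (RintegralZR _ measurableT iD).
rewrite (RintegralDR measurableT i1 i2).
by rewrite (RintegralZR _ measurableT G_int) (RintegralZR _ measurableT ic).
Qed.

(* Tonelli applied to [damped_average]; the constant 2 only makes it nonnegative. *)
Lemma poisson_average (b x : R) : 0 < b ->
  0 <= \int[mu]_(y in setT) (G y * poisson_diff b x y).
Proof.
move=> b0; pose I := \int[mu]_(y in setT) G y.
pose f (p : measurableTypeR R * measurableTypeR R) : R := damped_average b x p.1 p.2.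
have mf : measurable_fun setT f := damped_average_measurable b x.
have m0 : measurable (`]0, +oo[ : set R) by exact: measurable_itv.
have f0 (y u : R) : [set: R] y -> `]0, +oo[%classic u -> 0 <= f (y, u).
  by move=> _ _; exact: damped_average_ge0.
have E := Rtonelli measurableT m0 mf f0.
have mI := Rtonelli_measurable measurableT m0 mf f0.
have [ie eE] := exp_integral b0.
have iGd : mu.-integrable setT (EFin \o (fun y => G y * poisson_diff b x y)).
  apply: (G_bounded_integrable (M := 2 / b)); first exact: poisson_diff_measurable.
  by move=> y; exact: poisson_diff_bound.
have iG2 := integrableZR (2 / b) measurableT G_int.
have iL := integrableDR measurableT iG2 iGd.
have LE : (\int[mu]_(y in setT) \int[mu]_(u in `]0%R, +oo[) (f (y, u))%:E)%E =
    (2 / b * I + \int[mu]_(y in setT) (G y * poisson_diff b x y))%:E.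
  transitivity (\int[mu]_(y in setT) (2 / b * G y + G y * poisson_diff b x y)%:E)%E.
    apply: eq_integral => y _; rewrite (damped_average_integral x y b0); congr (_%:E); ring.
  by rewrite (integral_EFin iL measurableT) (RintegralDR measurableT iG2 iGd) (RintegralZR _ measurableT G_int).
have ie2 := integrableZR (2 * I) m0 ie.
have I0 : 0 <= I by apply: Rintegral_ge0 => y _.
(* With y integrated first, what exceeds 2 I e^{-bu} is e^{-bu} (1 - cos(2 pi x u)) times the cosine
   transform of G, nonnegative by [G_pos]. The lower bound integrates to 2I/b, which cancels against
   [LE]. *)
have : (\int[mu]_(u in `]0%R, +oo[) (2 * I * expR (- (b * u)))%:E <=
    \int[mu]_(u in `]0%R, +oo[) \int[mu]_(y in setT) (f (y, u))%:E)%E.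
  apply: ge0_le_integral; first exact: m0.
  - move=> u _; rewrite lee_fin; apply: mulr_ge0; last exact: expR_ge0.
    by apply: mulr_ge0; first exact: ler0n.
  - by have /integrableP[] := ie2.
  - exact: mI.
  - move=> u _; rewrite damped_average_integral2 lee_fin mulrC.
    apply: ler_wpM2l; first exact: expR_ge0.
    by rewrite lerDl mulr_ge0// subr_ge0 cos_le1.
rewrite -E LE (integral_EFin ie2 m0) (RintegralZR _ m0 ie) eE lee_fin.
by rewrite mulrAC lerDl.
Qed.

End positive_definite.

(** * Poisson averages as an approximate identity *)

Section approximate_identity.
Context {R : realType}.
Notation mu := (@lebesgue_measure R).

Lemma indic_integral (D : set R) (f : R -> R) : measurable D ->
  mu.-integrable D (EFin \o f) ->
  mu.-integrable setT (EFin \o (fun x => f x * \1_D x)) /\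
  \int[mu]_(x in setT) (f x * \1_D x) = \int[mu]_(x in D) f x.
Proof.
move=> mD fi; split; last by rewrite [RHS]Rintegral_mkcond patch_indic.
by have := (@integrable_mkcond _ (measurableTypeR R) R mu D (EFin \o f) mD).1 fi; rewrite restrict_EFin patch_indic.
Qed.

Lemma pi_quarter : (pi / 2) / (2 * pi) = 4^-1 :> R.
Proof. by move: (pi : R) (pi_gt0 R) => q q0; field; rewrite gt_eqF. Qed.

Lemma poisson_atan_left (b p d : R) : 0 < b -> 0 < d ->
  mu.-integrable `]p - d, p[ (EFin \o (fun t => poisson b (t - p))) /\
  \int[mu]_(t in `]p - d, p[) poisson b (t - p) = atan (2 * pi * d / b) / (2 * pi).
Proof.
move=> b0 d0; have pd : p - d < p by rewrite ltrBlDr ltrDl.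
have [i E] := poisson_itv p b0 pd; split => //; rewrite {}E; congr (_ / _).
rewrite subrr mulr0 mul0r atan0 sub0r -atanN; congr atan.
by rewrite (_ : p - d - p = - d) ?mulrN ?mulNr ?opprK//; ring.
Qed.

Lemma poisson_atan_right (b p d : R) : 0 < b -> 0 < d ->
  mu.-integrable `]p, p + d[ (EFin \o (fun t => poisson b (t - p))) /\
  \int[mu]_(t in `]p, p + d[) poisson b (t - p) = atan (2 * pi * d / b) / (2 * pi).
Proof.
move=> b0 d0; have pd : p < p + d by rewrite ltrDl.
have [i E] := poisson_itv p b0 pd; split => //; rewrite {}E; congr (_ / _).
rewrite subrr mulr0 mul0r atan0 subr0; congr atan.
by rewrite (_ : p + d - p = d)//; ring.
Qed.

Lemma left_limit_ge (f : R -> R) (p l e : R) : f y @[y --> p^'-] --> l -> 0 < e ->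
  exists2 d, 0 < d & forall y, p - d < y < p -> l - e <= f y.
Proof.
move=> /cvgrPdist_le h e0; have [d /= d0 hd] := h _ e0.
exists d => // y /andP[py yp]; have := hd y; rewrite /ball_ /= gtr0_norm ?subr_gt0//.
rewrite ltrBlDr -ltrBlDl => /(_ py yp); rewrite ler_norml; lra.
Qed.

Lemma right_limit_ge (f : R -> R) (p l e : R) : f y @[y --> p^'+] --> l -> 0 < e ->
  exists2 d, 0 < d & forall y, p < y < p + d -> l - e <= f y.
Proof.
move=> /cvgrPdist_le h e0; have [d /= d0 hd] := h _ e0.
exists d => // y /andP[py yp]; have := hd y; rewrite /ball_ /= distrC gtr0_norm ?subr_gt0//.
rewrite ltrBlDl => /(_ yp py); rewrite ler_norml; lra.
Qed.

Variable G : R -> R.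
Hypothesis G_int : mu.-integrable setT (EFin \o G).
Hypothesis G_ge0 : forall x, 0 <= G x.

Lemma poisson_shift_integrable (b p : R) : 0 < b ->
  mu.-integrable setT (EFin \o (fun y => G y * poisson b (y - p))).
Proof.
move=> b0; apply: (G_bounded_integrable G_int G_ge0 (M := b^-1)).
  by apply: continuous_measurable_fun => z; exact: poisson_continuous.
by move=> z; rewrite ger0_norm ?poisson_ge0// poisson_le.
Qed.

(** The two sides are bounded separately, since the one-sided limits at p may differ; away from p
    the nonnegativity of G suffices. *)
Lemma poisson_lower (b p d l r : R) : 0 < b -> 0 < d ->
  (forall y, p - d < y < p -> l <= G y) -> (forall y, p < y < p + d -> r <= G y) ->
  (l + r) * (atan (2 * pi * d / b) / (2 * pi)) <=
  \int[mu]_(y in setT) (G y * poisson b (y - p)).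
Proof.
move=> b0 d0 hl hr; have iG := poisson_shift_integrable p b0.
have [i1 E1] := poisson_atan_left p b0 d0; have [i2 E2] := poisson_atan_right p b0 d0.
have [j1 F1] := indic_integral (measurable_itv _) i1.
have [j2 F2] := indic_integral (measurable_itv _) i2.
have k1 := integrableZR l measurableT j1; have k2 := integrableZR r measurableT j2.
have k := integrableDR measurableT k1 k2.
rewrite mulrDl -{1}E1 -E2 -F1 -F2 -(RintegralZR _ measurableT j1) -(RintegralZR _ measurableT j2).
rewrite -(RintegralDR measurableT k1 k2); apply: (le_Rintegral measurableT k iG) => y _.
rewrite !indicE; have := poisson_ge0 (y - p) b0; have G0 := G_ge0 y.
move: (poisson _ _) => P P0.
have [yl|_] := boolP (y \in `]p - d, p[%classic); have [yr|_] := boolP (y \in `]p, p + d[%classic).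
- move: yl yr; rewrite !inE /= !in_itv /= => /andP[_ yp] /andP[py _].
  by have := lt_trans yp py; rewrite ltxx.
- move: yl; rewrite inE /= in_itv /= => /hl h.
  by rewrite mulr1 !mulr0 addr0 ler_wpM2r.
- move: yr; rewrite inE /= in_itv /= => /hr h.
  by rewrite mulr1 !mulr0 add0r ler_wpM2r.
- by rewrite !mulr0 addr0 mulr_ge0.
Qed.

(** Near 0 the kernel has mass at most 1/2; at distance d or more it is at most b/(2 pi d)^2, which
    vanishes with b. *)
Lemma poisson_upper (b d c : R) : 0 < b -> 0 < d -> 0 <= c ->
  (forall y, - d < y < d -> G y <= c) ->
  \int[mu]_(y in setT) (G y * poisson b (y - 0)) <=
  c / 2 + b / (2 * pi * d) ^+ 2 * \int[mu]_(y in setT) G y.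
Proof.
move=> b0 d0 c0 hc; have iG := poisson_shift_integrable 0 b0.
have pi0 : 0 < pi :> R := pi_gt0 R.
have dd : - d < d by lra.
have [i1 E1] := poisson_itv 0 b0 dd.
have [j1 F1] := indic_integral (measurable_itv _) i1.
have k1 := integrableZR c measurableT j1.
have k2 := integrableZR (b / (2 * pi * d) ^+ 2) measurableT G_int.
have k := integrableDR measurableT k1 k2.
apply: le_trans (_ : \int[mu]_(y in setT) (c * (poisson b (y - 0) * \1_(`]- d, d[%classic) y) +
   b / (2 * pi * d) ^+ 2 * G y) <= _); last first.
  rewrite (RintegralDR measurableT k1 k2) (RintegralZR _ measurableT j1).
  rewrite (RintegralZR _ measurableT G_int) lerD2r ler_wpM2l// F1 E1 !subr0.
  rewrite mulrN mulNr atanN opprK ler_pdivrMr ?mulr_gt0//.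
  have := atan_ltpi2 (2 * pi * d / b); lra.
apply: (le_Rintegral measurableT iG k) => y _; rewrite subr0 indicE.
have := poisson_ge0 y b0; have G0 := G_ge0 y.
have q0 : 0 <= b / (2 * pi * d) ^+ 2 by rewrite divr_ge0 ?sqr_ge0// ltW.
have [yd|yd] := boolP (y \in `]- d, d[%classic).
  move: yd; rewrite inE /= in_itv /= => /hc h P0.
  by rewrite mulr1 -[leLHS]addr0 lerD ?ler_wpM2r// mulr_ge0.
move=> _; rewrite !mulr0 add0r mulrC ler_wpM2r// /poisson.
have y2 : (2 * pi * d) ^+ 2 <= b ^+ 2 + (2 * pi * y) ^+ 2.
  rewrite -[leLHS]add0r lerD ?sqr_ge0// -[leRHS](real_normK (num_real _)).
  have d2 : d <= `|y|.
    rewrite leNgt; apply: contra yd; rewrite ltr_norml inE /= in_itv /= => /andP[-> ->] //.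
  have p2 : 0 < 2 * pi :> R by rewrite mulr_gt0.
  have pd : 0 <= 2 * pi * d by rewrite mulr_ge0 ?(ltW p2) ?(ltW d0).
  by rewrite ler_sqr ?nnegrE ?normr_ge0// normrM (gtr0_norm p2) ler_pM2l.
have dz : 0 < (2 * pi * d) ^+ 2 by rewrite exprn_gt0// !mulr_gt0.
by rewrite ler_pM2l// lef_pV2// posrE// poisson_denom_gt0.
Qed.

Hypothesis G_pos : forall u, 0 <= \int[mu]_(x in setT) (G x * cos (2 * pi * x * u)).
Hypothesis G_even : forall x, G (- x) = G x.
Hypothesis G_mean : forall x, exists l r : R,
  [/\ G y @[y --> x^'-] --> l, G y @[y --> x^'+] --> r & G x = (l + r) / 2].
Hypothesis G_cont0 : G x @[x --> 0] --> G 0.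

Let poisson_lim (p e : R) : 0 < e -> exists2 d0, 0 < d0 & forall d b, 0 < d -> d <= d0 -> 0 < b ->
  (2 * G p - 2 * e) * (atan (2 * pi * d / b) / (2 * pi)) <=
  \int[mu]_(y in setT) (G y * poisson b (y - p)).
Proof.
move=> e0; have [l [r [hl hr E]]] := G_mean p.
have [d1 d10 h1] := left_limit_ge hl e0; have [d2 d20 h2] := right_limit_ge hr e0.
exists (Num.min d1 d2); first by rewrite lt_min d10.
move=> d b d0; rewrite le_min => /andP[dd1 dd2] b0.
have -> : 2 * G p - 2 * e = l - e + (r - e) by rewrite E; field.
apply: poisson_lower => // y /andP[y1 y2].
- by apply: h1; rewrite y2 andbT (le_lt_trans _ y1)// lerB.
- by apply: h2; rewrite y1 (lt_le_trans y2)// lerD.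
Qed.

(* A positive definite function with one-sided limits equals the limit of its
   Poisson averages, which are largest at the origin. *)
Lemma positive_definite_le x : G x <= G 0.
Proof.
apply/ler_addgt0Pr => e0 e00; pose e := e0 / 3.
have e1 : 0 < e by rewrite divr_gt0.
have pi0 : 0 < pi :> R := pi_gt0 R.
have [d1 d10 h1] := poisson_lim x e1.
have [d2 d20 h2] := poisson_lim (- x) e1.
have [d3 d30 h3] : exists2 d, 0 < d & forall y, - d < y < d -> G y <= G 0 + e.
  move/cvgrPdist_le: G_cont0 => /(_ _ e1) /nbhs_ballP[d /= d0 hd].
  exists d => // y yd; have := hd y; rewrite /ball /= sub0r normrN ltr_norml yd.
  by move=> /(_ isT); rewrite ler_norml; lra.
pose d := Num.min d1 (Num.min d2 d3).
have d0 : 0 < d by rewrite !lt_min d10 d20.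
have dd1 : d <= d1 by rewrite ge_min lexx.
have dd2 : d <= d2 by rewrite !ge_min lexx orbT.
have dd3 : d <= d3 by rewrite !ge_min lexx !orbT.
have {}h3 y : - d < y < d -> G y <= G 0 + e.
  by move=> /andP[y1 y2]; apply: h3; rewrite (le_lt_trans _ y1) ?lerN2// (lt_le_trans y2).
pose I := \int[mu]_(y in setT) G y.
(* By [poisson_average] the averages centred at x and -x have mean at most the one centred at 0, and
   evenness gives both the same lower bound. *)
have key b : 0 < b -> (2 * G x - 2 * e) * (atan (2 * pi * d / b) / (2 * pi)) <=
    (G 0 + e) / 2 + b / (2 * pi * d) ^+ 2 * I.
  move=> b0; have c0 : 0 <= G 0 + e by rewrite addr_ge0 ?G_ge0// ltW.
  have U := poisson_upper b0 d0 c0 h3.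
  have L1 := h1 d b d0 dd1 b0; have := h2 d b d0 dd2 b0; rewrite G_even => L2.
  have := poisson_average G_int G_ge0 G_pos x b0.
  have i0 := poisson_shift_integrable 0 b0.
  have i1 := poisson_shift_integrable x b0; have i2 := poisson_shift_integrable (- x) b0.
  have i3 := integrableZR 2^-1 measurableT (integrableDR measurableT i1 i2).
  have -> : \int[mu]_(y in setT) (G y * poisson_diff b x y) =
    \int[mu]_(y in setT) (G y * poisson b (y - 0) -
      2^-1 * (G y * poisson b (y - x) + G y * poisson b (y - - x))).
    by apply: eq_Rintegral => y _; rewrite /poisson_diff subr0 opprK; field.
  rewrite (RintegralBR measurableT i0 i3) (RintegralZR _ measurableT (integrableDR measurableT i1 i2)).
  rewrite (RintegralDR measurableT i1 i2); move: U L1 L2; rewrite -/I.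
  move: (Rintegral _ _ _) (Rintegral _ _ _) (Rintegral _ _ _) (_ / _ * I) (_ * (_ / _)) => A B C D E.
  lra.
suff : (2 * G x - 2 * e) * ((pi / 2) / (2 * pi)) <= (G 0 + e) / 2 + 0 * (2 * pi * d)^-1 * I.
  have -> : (pi / 2) / (2 * pi) = 4^-1 :> R.
    exact: pi_quarter.
  by rewrite /e; lra.
have c1 : (2 * G x - 2 * e) * (atan t / (2 * pi)) @[t --> +oo] -->
    (2 * G x - 2 * e) * ((pi / 2) / (2 * pi)).
  by apply: cvgMr; apply: cvgMl; exact: cvgy_atan.
have c2 : (G 0 + e) / 2 + t^-1 * (2 * pi * d)^-1 * I @[t --> +oo] -->
    (G 0 + e) / 2 + 0 * (2 * pi * d)^-1 * I.
  apply: cvgD; first exact: cvg_cst.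
  by apply: cvgMl; apply: cvgMl; exact: cvgVy.
apply: (ler_cvg_to c1 c2); near=> t; have t0 : 0 < t by near: t; exact: nbhs_pinfty_gt.
have D0 : 0 < 2 * pi * d by rewrite !mulr_gt0.
(* With b = 2 pi d/t the argument of atan becomes t, and b -> 0 becomes t -> +oo with d fixed. *)
have := key (2 * pi * d / t) (divr_gt0 D0 t0).
move: (2 * pi * d) D0 => D D0.
have -> : D / (D / t) = t by field; rewrite !gt_eqF.
by have -> : D / t / D ^+ 2 = t^-1 / D by field; rewrite !gt_eqF.
Unshelve. all: by end_near. Qed.

End approximate_identity.

(** * Quadratic forms of admissible functions *)

Section sech_bounds.
Context {R : realType}.
Notation mu := (@lebesgue_measure R).

Lemma cosh_continuous (x : R) : {for x, continuous (fun x : R => cosh (x / 2))}.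
Proof. by apply: der_continuous; rewrite /cosh; der. Qed.

Lemma cosh_le (x : R) : cosh (x / 2) <= expR (2^-1 * `|x|).
Proof.
rewrite /cosh ler_pdivrMr// [leRHS]mulrC -[2 * _]/((1 + 1) * _) mulrDl !mul1r.
have xn : x <= `|x| := ler_norm x; have nx : - x <= `|x| by rewrite -normrN ler_norm.
apply: lerD; rewrite ler_expR.
  by rewrite mulrC ler_wpM2l// invr_ge0.
by rewrite -mulNr mulrC ler_wpM2l// invr_ge0.
Qed.

Lemma cosh_ge1 (x : R) : 1 <= cosh x.
Proof.
rewrite /cosh ler_pdivlMr// mul1r expRN; have := expR_gt0 x; move: (expR x) => a a0.
rewrite -subr_ge0 (_ : a + a^-1 - 2 = (a - 1) ^+ 2 / a); last by field; rewrite gt_eqF.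
by rewrite divr_ge0 ?sqr_ge0// ltW.
Qed.

Lemma sech_le1 (x : R) : sech x <= 1.
Proof. by rewrite /sech invf_le1 ?cosh_gt0// cosh_ge1. Qed.

Lemma sech_gt0 (x : R) : 0 < sech x.
Proof. by rewrite /sech invr_gt0 cosh_gt0. Qed.

Lemma sech_ge (t : R) : 0 <= t -> expR (- (2^-1 * t)) <= sech t.
Proof.
move=> t0; rewrite expRN /sech lef_pV2 ?posrE ?expR_gt0 ?cosh_gt0//.
by rewrite -{2}(ger0_norm t0) cosh_le.
Qed.

Lemma sech_continuous (x : R) : {for x, continuous (@sech R)}.
Proof. by apply: cvgV; [rewrite gt_eqF// cosh_gt0|exact: cosh_continuous]. Qed.

Lemma admissible_le_sech (F : R -> R) x : admissible F -> F 0 = 1 -> F x <= sech x.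
Proof.
move=> [tF _ F0 posF] F01; pose G x := F x * cosh (x / 2).
have mF := test_function_measurable tF.
have mc : measurable_fun setT (fun x : R => cosh (x / 2)).
  by apply: continuous_measurable_fun => z; exact: cosh_continuous.
have [e e2 [iF _]] := test_decay tF.
have iG : mu.-integrable setT (EFin \o G).
  (* The decay exponent e exceeds 1/2, which is the growth rate of cosh(x/2). *)
  apply: (le_integrableR _ _ _ iF) => //; first exact: measurable_funM.
  move=> y _; rewrite ger0_norm; last exact: mulr_ge0 (F0 y) (ltW (cosh_gt0 _)).
  rewrite ler_wpM2l// (le_trans (cosh_le y))// ler_expR ler_wpM2r//.
  by move: e2; rewrite div1r => /ltW.
have G_pos u : 0 <= \int[mu]_(y in setT) (G y * cos (2 * pi * y * u)).
  have := posF u; rewrite /fourier lecE /= => /andP[_].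
  rewrite (_ : Rintegral _ _ _ = \int[mu]_(y in setT) (G y * cos (2 * pi * y * u)))//.
  by apply: eq_Rintegral => y _; rewrite /cis /= cosN mul0r subr0.
have G0 y : 0 <= G y by exact: mulr_ge0 (F0 y) (ltW (cosh_gt0 _)).
have GE : G 0 = 1.
  have := @sech0 R; rewrite /sech => h.
  by rewrite /G F01 mul1r -[LHS]invrK h invr1.
rewrite /sech -div1r ler_pdivlMr ?cosh_gt0// -[leRHS]GE -/(G x).
apply: (positive_definite_le iG G0 G_pos) => [y|y|].
- by rewrite /G (test_even tF) /cosh mulNr opprK addrC.
- have [l [r [hl hr E]]] := test_mean tF y.
  exists (l * cosh (y / 2)), (r * cosh (y / 2)); split.
  + by apply: cvgM hl _; apply: cvg_at_left_filter; exact: cosh_continuous.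
  + by apply: cvgM hr _; apply: cvg_at_right_filter; exact: cosh_continuous.
  + by rewrite /G E; ring.
- by apply: cvgM; [exact: test_function_continuous0|exact: cosh_continuous].
Qed.

End sech_bounds.

Section remainder.
Context {R : realType}.
Notation mu := (@lebesgue_measure R).

Variables (F : R -> R) (C : R).
Hypothesis mF : measurable_fun setT F.
Hypothesis F0 : F 0 = 1.
Hypothesis F_sech : forall t, 0 < t -> 0 <= sech t - F t <= C * t.

(** The excess of the [psi_of (damped F)] integrand over that of [kern] at s = 0; the terms with
    H(0) = 1 cancel. *)
Definition remainder (t : R) : R := (sech t - F t) * expR (- t / 2) / (1 - expR (- t)).

(** The linear bound on sech - F cancels the pole: t/(1 - e^{-t}) <= 1 + t <= 4 e^{t/4}. Half of the
    factor e^{-t/2} absorbs this growth. *)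
Lemma remainder_bound t : 0 < t -> 0 <= remainder t <= 4 * C * expR (- (4^-1 * t)).
Proof.
move=> t0; have /andP[f0 f1] := F_sech t0.
have d0 : 0 < 1 - expR (- t) by rewrite subr_gt0 expRN_lt1.
have C0 : 0 <= C by rewrite -(pmulr_lge0 _ t0) (le_trans f0).
apply/andP; split; first by rewrite divr_ge0 ?(ltW d0)// mulr_ge0 ?expR_ge0.
have /andP[_ h] := inv_onem_expR_bound t0.
have h1 : t / (1 - expR (- t)) <= 1 + t.
  have -> : 1 + t = t * (t^-1 + 1) by field; rewrite gt_eqF.
  by rewrite ler_wpM2l ?(ltW t0)//; move: h; lra.
have h2 : 1 + t <= 4 * expR (4^-1 * t).
  by have := expR_ge1Dx (4^-1 * t); move: (expR _) => E; lra.
have E : expR (- t / 2) = expR (- (4^-1 * t)) * expR (- (4^-1 * t)) :> R.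
  by rewrite -expRD; congr expR; field.
have E1 : expR (4^-1 * t) * expR (- (4^-1 * t)) = 1 by rewrite -expRD subrr expR0.
rewrite /remainder E; have := expR_gt0 (- (4^-1 * t)).
move: h1 h2 E1 f0 f1 d0; move: (expR (- (4^-1 * t))) (expR (4^-1 * t)) (1 - _) (sech t - F t).
move=> a b d f h1 h2 ab f0 f1 d0 a0.
have k1 : f / d <= C * (1 + t).
  apply: le_trans (_ : C * (t / d) <= _); last exact: ler_wpM2l.
  by rewrite mulrA ler_wpM2r// invr_ge0 ltW.
have k2 : (1 + t) * a <= 4.
  have : (1 + t) * a <= 4 * b * a by rewrite ler_wpM2r ?(ltW a0).
  by rewrite -mulrA ab mulr1.
rewrite (_ : f * (a * a) / d = f / d * a * a); last by ring.
rewrite ler_wpM2r ?(ltW a0)// (@le_trans _ _ (C * (1 + t) * a))//.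
  by rewrite ler_wpM2r ?(ltW a0).
by rewrite -mulrA [leRHS]mulrC ler_wpM2l.
Qed.

Lemma remainder_integrable (h : R -> R) : measurable_fun setT h ->
  (forall t, 0 < t -> `|h t| <= 1) ->
  mu.-integrable `]0, +oo[ (EFin \o (fun t => remainder t * h t)).
Proof.
move=> mh h1; have p0 : 0 < 4^-1 :> R by rewrite invr_gt0.
have [ie _] := exp_integral p0.
apply: (le_integrableR _ _ _ (integrableZR (4 * C) (measurable_itv _) ie)) => //.
  apply: measurable_funM; last exact: measurable_funTS.
  apply: measurable_funM.
    apply: measurable_funTS; apply: measurable_funM.
      apply: measurable_funB => //; apply: continuous_measurable_fun => t; exact: sech_continuous.
    by apply: continuous_measurable_fun => t; apply: der_continuous; der.
  apply: open_continuous_measurable_fun; first exact: interval_open.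
  move=> x; rewrite inE/= in_itv/= andbT => x0; apply: der_continuous.
  by der; rewrite gt_eqF// subr_gt0 expRN_lt1.
move=> t /=; rewrite in_itv /= andbT => t0.
have /andP[r0 r1] := remainder_bound t0.
rewrite normrM ger0_norm// (le_trans _ r1)// -[leRHS]mulr1 ler_wpM2l// h1//.
Qed.

Lemma psi_of_remainder (s : R) : 0 <= s ->
  psi_of (damped F) s =
  kern s + \int[mu]_(t in `]0, +oo[) (remainder t * expR (- (s * t))).
Proof.
move=> s0; have ir : mu.-integrable `]0, +oo[ (EFin \o (fun t => remainder t * expR (- (s * t)))).
  apply: remainder_integrable => [|t t0].
    by apply: continuous_measurable_fun => t; apply: der_continuous; der.
  by rewrite ger0_norm ?expR_ge0// -[leRHS]expR0 ler_expR oppr_le0 mulr_ge0// ltW.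
rewrite kernE -(RintegralDR (measurable_itv _) (kernel_integrable s0) ir).
apply: eq_Rintegral => t; rewrite inE /= in_itv /= andbT => t0.
rewrite /kernel_integrand /remainder /damped F0 oppr0 mul0r expR0 !mul1r; ring.
Qed.

Lemma remainder_integrable1 : mu.-integrable `]0, +oo[ (EFin \o remainder).
Proof.
have := @remainder_integrable (cst 1) (measurable_cst _); rewrite /cst.
rewrite (_ : (fun t => remainder t * 1) = remainder); last by apply/funext => t; rewrite mulr1.
by apply => t _; rewrite normr1.
Qed.

(** Linear in C, so that the remainder tends to 0 along test functions with C -> 0. *)
Lemma remainder_integral_le : 0 <= \int[mu]_(t in `]0, +oo[) remainder t <= 16 * C.
Proof.
have p0 : 0 < 4^-1 :> R by rewrite invr_gt0.
have [ie eE] := exp_integral p0.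
have ir := remainder_integrable1.
apply/andP; split.
  by apply: Rintegral_ge0 => t /=; rewrite in_itv /= andbT => /remainder_bound/andP[].
have -> : 16 * C = \int[mu]_(t in `]0, +oo[) (4 * C * expR (- (4^-1 * t))).
  by rewrite (RintegralZR _ (measurable_itv _) ie) eE invrK; ring.
have iZ := integrableZR (4 * C) (measurable_itv _) ie.
apply: (le_Rintegral _ ir iZ) => // t /=.
by rewrite in_itv /= andbT => /remainder_bound/andP[].
Qed.

Lemma remainder_form_integral N (w : nat -> R) :
  mu.-integrable `]0, +oo[ (EFin \o (fun t => remainder t * geom_form N (expR (- t)) w)) /\
  \sum_(i < N) \sum_(j < N) w i * w j * psi_of (damped F) (natdist i j)%:R =
  kern_form N w + \int[mu]_(t in `]0, +oo[) (remainder t * geom_form N (expR (- t)) w).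
Proof.
pose f (m : nat) (t : R) := remainder t * expR (- (m%:R * t)).
have fi m : mu.-integrable `]0, +oo[ (EFin \o f m).
  apply: remainder_integrable => [|t t0].
    by apply: continuous_measurable_fun => t; apply: der_continuous; der.
  by rewrite ger0_norm ?expR_ge0// -[leRHS]expR0 ler_expR oppr_le0 mulr_ge0// ltW.
have [iS ES] := Rintegral_form N w (measurable_itv _) fi.
have fE : (fun t => remainder t * geom_form N (expR (- t)) w) =
    (fun t => \sum_(i < N) \sum_(j < N) w i * w j * f (natdist i j) t).
  apply/funext => t; rewrite mulr_sumr; apply: eq_bigr => i _.
  rewrite mulr_sumr; apply: eq_bigr => j _; rewrite /f expR_natM; ring.
rewrite fE; split => //; rewrite ES /kern_form -big_split /=; apply: eq_bigr => i _.
rewrite -big_split /=; apply: eq_bigr => j _.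
by rewrite psi_of_remainder// mulrDr.
Qed.

Variables (n : nat) (v : 'cV[R]_n.+1).

(** The critical scale is chosen so that ln(2 pi/r) equals t = v^T A v. *)
Lemma Q_form_remainder (x : 'cV[R]_n.+1) :
  let w i := x (inord i) 0 in
  Q_form F (critical_scale v) x = critical_exponent v * phi_form x ^+ 2 - matrix_form x -
    \int[mu]_(t in `]0, +oo[) (remainder t * geom_form n.+1 (expR (- t)) w).
Proof.
move=> w; have [_ E] := remainder_form_integral n.+1 w.
rewrite /Q_form /critical_scale; have pi0 : 0 < 2 * pi :> R by rewrite mulr_gt0// pi_gt0.
have -> : ln (2 * pi / (2 * pi * expR (- critical_exponent v))) = critical_exponent v.
  move: (2 * pi) pi0 => q q0; rewrite invfM mulrA divff ?gt_eqF// mul1r.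
  by rewrite -expRN opprK expRK.
have -> : q_form (damped F) x =
    \sum_(i < n.+1) \sum_(j < n.+1) w i * w j * psi_of (damped F) (natdist i j)%:R.
  apply: eq_bigr => i _; apply: eq_bigr => j _; rewrite /w !inord_val natdistE //.
by rewrite E matrix_formE opprD addrA.
Qed.

End remainder.

Section admissible_remainder.
Context {R : realType}.
Notation mu := (@lebesgue_measure R).

Variable F : R -> R.
Hypothesis nF : normalized_admissible F.

Let tF : test_function F. Proof. by case: nF => -[]. Qed.
Let mF : measurable_fun setT F. Proof. exact: test_function_measurable. Qed.
Let F0 : F 0 = 1. Proof. by case: nF. Qed.

Lemma admissible_sech_bound : exists C, forall t, 0 < t -> 0 <= sech t - F t <= C * t.
Proof.
have [C C0 hC] := test_function_slope tF; exists C => t t0.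
rewrite subr_ge0 admissible_le_sech//; last by case: nF.
have := hC t; rewrite F0 (gtr0_norm t0) ler_norml => /andP[h _].
by have := sech_le1 t; move: h; lra.
Qed.

(* [sech t] decays like [expR (- t / 2)] but [F] decays faster. *)
Lemma remainder_integral_gt0 (h : R -> R) (c : R) : 0 < c ->
  mu.-integrable `]0, +oo[ (EFin \o (fun t => remainder F t * h t)) ->
  (forall t, 0 < t -> c <= h t) ->
  0 < \int[mu]_(t in `]0, +oo[) (remainder F t * h t).
Proof.
move=> c0 ih hc; have [e e2 [C C0 hF]] := test_function_decay tF.
have [K hK] := admissible_sech_bound.
pose g (t : R) := (expR (- (2^-1 * t)) - C * expR (- (e * t))) * expR (- t / 2) * c.
have e20 : 0 < e - 2^-1 by rewrite subr_gt0 -div1r.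
(* Beyond C/(e - 1/2) the bound C e^{-et} on F is below the lower bound e^{-t/2} of sech, because
   e^{(e-1/2)t} > (e - 1/2)t >= C. *)
pose a := Num.max 1 (C / (e - 2^-1)).
have a0 : 0 < a by rewrite lt_max ltr01.
apply: (@Rintegral_gt0_minorant _ _ _ g a (a + 1)) => //.
- move=> t /=; rewrite in_itv /= andbT => t0; rewrite mulr_ge0 ?(le_trans (ltW c0) (hc t t0))//.
  by have /andP[] := remainder_bound hK t0.
- by rewrite ltrDl.
- by move=> t /=; rewrite !in_itv /= andbT => /andP[/(lt_le_trans a0)].
- by move=> t _; apply: der_continuous; rewrite /g; der.
move=> t /andP[at_ _]; have t0 := lt_le_trans a0 at_.
have E0 : 0 < expR (- (2^-1 * t)) - C * expR (- (e * t)).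
  have -> : expR (- (2^-1 * t)) = expR ((e - 2^-1) * t) * expR (- (e * t)).
    by rewrite -expRD; congr expR; ring.
  rewrite -mulrBl mulr_gt0 ?expR_gt0// subr_gt0.
  apply: le_lt_trans (_ : (e - 2^-1) * t < _).
    by rewrite mulrC -ler_pdivrMr// (le_trans _ at_)// le_max lexx orbT.
  by have := expR_ge1Dx ((e - 2^-1) * t); lra.
apply/andP; split; first by rewrite !mulr_gt0 ?expR_gt0.
have d0 : 0 < 1 - expR (- t) by rewrite subr_gt0 expRN_lt1.
have d1 : 1 - expR (- t) <= 1 by rewrite lerBlDr lerDl expR_ge0.
have Fb : F t <= C * expR (- (e * t)).
  by rewrite (le_trans (ler_norm _))// (le_trans (hF t))// gtr0_norm.
have Sb := sech_ge (ltW t0).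
apply: ler_pM; rewrite ?hc//; [by rewrite mulr_ge0 ?expR_ge0 ?ltW|by rewrite ltW|].
apply: (@le_trans _ _ ((sech t - F t) * expR (- t / 2))).
  by rewrite ler_wpM2r ?expR_ge0// lerB.
rewrite -[leLHS]mulr1 /remainder ler_wpM2l ?invf_ge1//.
by rewrite mulr_ge0 ?expR_ge0//; have /andP[] := hK t t0.
Qed.

Section extremal.
Variable P : nat -> {poly R}.
Hypothesis hP : orthogonal_system P.
Variables (n : nat) (v : 'cV[R]_n.+1).
Hypothesis hv : trig_coefficients P v.

(** At v the main part t phi^2 - v^T A v is 0, and positivity of v bounds the geometric form below
    by its entry v_0^2, so the remainder is strictly positive. *)
Lemma Q_form_extremal_lt0 : Q_form F (critical_scale v) v < 0.
Proof.
have [K hK] := admissible_sech_bound.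
rewrite (Q_form_remainder mF F0 hK).
pose w (i : nat) := v (inord i) 0; have [iw _] := remainder_form_integral mF F0 hK n.+1 w.
have E : critical_exponent v * phi_form v ^+ 2 - matrix_form v = 0.
  have := matrix_form_shift hP hv v; rewrite (_ : phi_form v = 1); last first.
    exact: (trig_sum1 hP hv).
  rewrite scale1r subrr expr1n mulr1 => h.
  have -> : critical_exponent v - matrix_form v = - (matrix_form v - critical_exponent v) by ring.
  rewrite -h matrix_formE /kern_form big1 ?oppr0// => i _; rewrite big1// => j _.
  by rewrite !mxE !mul0r.
rewrite E sub0r oppr_lt0; apply: (remainder_integral_gt0 (c := w 0%N * w 0%N)) => //.
  by rewrite mulr_gt0 ?(extremal_vector_gt0 hP hv).
move=> t t0; rewrite /geom_form big_ord_recl /= big_ord_recl /= expr0 mulr1 -addrA lerDl.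
apply: addr_ge0.
  by apply: sumr_ge0 => j _; rewrite mulr_ge0 ?exprn_ge0 ?expR_ge0// mulr_ge0 ?ltW ?(extremal_vector_gt0 hP hv).
apply: sumr_ge0 => i _; apply: sumr_ge0 => j _.
by rewrite mulr_ge0 ?exprn_ge0 ?expR_ge0// mulr_ge0 ?ltW ?(extremal_vector_gt0 hP hv).
Qed.

End extremal.

End admissible_remainder.

(** * The test functions exp(-a|x|) sech(x/2) *)

Local Open Scope complex_scope.

(** * Bounded variation by comparison with a bounded function *)

Section controlled.
Context {R : realType}.
Implicit Types (A : set R) (f g h : R -> R).

(** A certificate of bounded variation that survives sums and products: increments of f are
    dominated by those of a bounded h, which telescope. *)
Definition controlled A f := exists h, exists2 K, 0 <= K &
  (forall x, A x -> `|h x| <= K /\ `|f x| <= K) /\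
  (forall x y, A x -> A y -> x <= y -> `|f y - f x| <= h y - h x).

Lemma nondecreasing_controlled A f K : 0 <= K -> (forall x, A x -> `|f x| <= K) ->
  (forall x y, A x -> A y -> x <= y -> f x <= f y) -> controlled A f.
Proof.
move=> K0 fK fh; exists f, K => //; split => [x Ax|x y Ax Ay xy]; first by split; exact: fK.
by rewrite ger0_norm// subr_ge0 fh.
Qed.

Lemma controlledN A f : controlled A f -> controlled A (fun x => - f x).
Proof.
move=> [h [K K0 [fK fh]]]; exists h, K => //; split => [x /fK[hx fx]|x y Ax Ay xy].
  by rewrite normrN.
by rewrite -opprD normrN fh.
Qed.

Lemma controlled_eq A f g : (forall x, A x -> f x = g x) -> controlled A f -> controlled A g.
Proof.
move=> fg [h [K K0 [fK fh]]]; exists h, K => //; split => [x Ax|x y Ax Ay xy].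
  by rewrite -fg//; exact: fK.
by rewrite -!fg//; exact: fh.
Qed.

Lemma controlledD A f g : controlled A f -> controlled A g ->
  controlled A (fun x => f x + g x).
Proof.
move=> [h [K K0 [fK fh]]] [k [L L0 [gL gk]]].
exists (fun x => h x + k x), (K + L); first exact: addr_ge0.
split => [x Ax|x y Ax Ay xy].
  have [h1 h2] := fK x Ax; have [k1 k2] := gL x Ax.
  by rewrite !(le_trans (ler_normD _ _))// lerD.
have -> : f y + g y - (f x + g x) = (f y - f x) + (g y - g x) by ring.
have -> : h y + k y - (h x + k x) = (h y - h x) + (k y - k x) by ring.
by rewrite (le_trans (ler_normD _ _))// lerD ?fh ?gk.
Qed.

Lemma controlledM A f g : controlled A f -> controlled A g ->
  controlled A (fun x => f x * g x).
Proof.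
move=> [h [K K0 [fK fh]]] [k [L L0 [gL gk]]].
exists (fun x => L * h x + K * k x), (L * K + K * L).
  by rewrite addr_ge0 ?mulr_ge0.
split => [x Ax|x y Ax Ay xy].
  have [h1 h2] := fK x Ax; have [k1 k2] := gL x Ax; split.
    rewrite (le_trans (ler_normD _ _))// !normrM (ger0_norm K0) (ger0_norm L0).
    by rewrite lerD// ler_wpM2l.
  by rewrite normrM (@le_trans _ _ (K * L))// ?ler_pM// lerDr mulr_ge0.
have [h1 h2] := fK x Ax; have [k1 k2] := gL y Ay.
have -> : f y * g y - f x * g x = (f y - f x) * g y + f x * (g y - g x) by ring.
have -> : L * h y + K * k y - (L * h x + K * k x) = (h y - h x) * L + K * (k y - k x) by ring.
by rewrite (le_trans (ler_normD _ _))// !normrM lerD// ler_pM ?fh ?gk.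
Qed.

Lemma variation_le (b : R) f h (a : R) (s : seq R) : path <%R a s ->
  (forall x y, x \in a :: s -> y \in a :: s -> x < y -> `|f y - f x| <= h y - h x) ->
  variation a b f s <= h (nth b (a :: s) (size s)) - h a.
Proof.
move=> /(pathP b) ps fh; rewrite /variation.
apply: (@le_trans _ _ (\sum_(0 <= i < size s)
    (h (nth b (a :: s) i.+1) - h (nth b (a :: s) i)))); last first.
  by rewrite (telescope_sumr (fun i => h (nth b (a :: s) i))).
rewrite !big_nat; apply: ler_sum => i /andP[_ si]; apply: fh.
- by apply: mem_nth; rewrite /= ltnS ltnW.
- by apply: (@mem_nth _ b (a :: s) i.+1); rewrite /= ltnS.
- exact: ps.
Qed.

(* Even functions have [c = 1] and odd functions [c = -1]. *)
Lemma symmetric_variation A f (c : R) : (forall x, A x -> A (- x)) -> `|c| <= 1 ->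
  (forall x, A x -> f (- x) = c * f x) ->
  controlled (A `&` [set x | 0 <= x]) f -> bounded_variation_on A f.
Proof.
move=> AN c1 fN [h [K K0 [fK fh]]].
(* The jump 4K at 0 pays for pairs of opposite sign: f varies by at most 2K, and the two values of h
   can take away another 2K. *)
pose H x := if 0 <= x then h x + 4 * K else - h (- x).
have AP x : A x -> 0 <= x -> (A `&` [set x | 0 <= x]) x by [].
have APN x : A x -> ~~ (0 <= x) -> (A `&` [set x | 0 <= x]) (- x).
  by move=> Ax; rewrite -ltNge => x0; split; [exact: AN|rewrite /= oppr_ge0 ltW].
have fN' x : A x -> f x = c * f (- x) by move=> /AN/fN; rewrite opprK.
have HK x : A x -> `|H x| <= 5 * K.
  move=> Ax; rewrite /H; case: ifPn => x0.
    have [hx _] := fK x (AP x Ax x0); rewrite (le_trans (ler_normD _ _))//.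
    by rewrite (ger0_norm (_ : 0 <= 4 * K)) ?mulr_ge0//; move: hx; lra.
  by have [hx _] := fK _ (APN x Ax x0); rewrite normrN; move: hx K0; lra.
have fH x y : A x -> A y -> x < y -> `|f y - f x| <= H y - H x.
  move=> Ax Ay xy; rewrite /H; have [x0|x0] := boolP (0 <= x).
    have y0 : 0 <= y by rewrite (le_trans x0)// ltW.
    rewrite y0 (_ : h y + _ - _ = h y - h x); last by ring.
    by apply: fh (ltW xy); exact: AP.
  have [y0|y0] := boolP (0 <= y).
    have [hx fx] := fK _ (APN x Ax x0); have [hy fy] := fK _ (AP y Ay y0).
    have {}fx : `|f x| <= K.
      by rewrite fN'// normrM -[leRHS]mul1r ler_pM.
    rewrite (le_trans (ler_normB _ _))//.
    move: hx hy; rewrite !ler_norml => /andP[hx1 hx2] /andP[hy1 hy2].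
    by move: fx fy hx1 hx2 hy1 hy2; lra.
  rewrite [f x]fN'// [f y]fN'// -mulrBr normrM -[leRHS]mul1r ler_pM// distrC.
  rewrite (_ : - h (- y) - _ = h (- x) - h (- y)); last by ring.
  by apply: fh; [exact: APN..|rewrite lerN2 ltW].
exists (10 * K) => a s ps As.
apply: le_trans (variation_le _ ps _) _.
  by move=> x y xs ys; apply: fH; exact: As.
have := HK _ (As a (mem_head _ _)).
have lastA : A (nth (last a s) (a :: s) (size s)) by apply: As; rewrite mem_nth.
have := HK _ lastA; rewrite !ler_norml; lra.
Qed.

End controlled.

Section laplace.
Context {R : realType}.
Notation mu := (@lebesgue_measure R).

Lemma exp_controlled (A : set R) (c : R) : 0 <= c -> A `<=` [set x | 0 <= x] ->
  controlled A (fun x => expR (- (c * x))).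
Proof.
move=> c0 A0; apply: (@controlled_eq _ _ (fun x => - - expR (- (c * x)))).
  by move=> x _; rewrite opprK.
apply: controlledN; apply: (@nondecreasing_controlled _ _ _ 1) => // [x /A0/= x0|x y _ _ xy].
  rewrite normrN ger0_norm ?expR_ge0// -[leRHS]expR0 ler_expR oppr_le0 mulr_ge0//.
by rewrite lerN2 ler_expR lerN2 ler_wpM2l.
Qed.

Lemma logistic_controlled (A : set R) :
  controlled A (fun x : R => (1 + expR (- x))^-1).
Proof.
have p x : 0 < 1 + expR (- x) by rewrite addr_gt0// expR_gt0.
apply: (@nondecreasing_controlled _ _ _ 1) => // [x _|x y _ _ xy].
  by rewrite ger0_norm ?invr_ge0 ?(ltW (p _))// invf_le1// lerDl expR_ge0.
by rewrite lef_pV2 ?posrE// lerD2l ler_expR lerN2.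
Qed.

(** By convexity of e^{-cx} its chord slope from 0 increases, and it stays between -c and 0. *)
Lemma exp_slope_controlled (c : R) : 0 <= c ->
  controlled [set x | 0 < x] (fun x => (expR (- (c * x)) - 1) / x).
Proof.
move=> c0; pose f x := (expR (- (c * x)) - 1) / x.
have f0 x : 0 < x -> - c <= f x <= 0.
  move=> x0; rewrite /f ler_pdivlMr// ler_pdivrMr// mul0r.
  have := expR_ge1Dx (- (c * x)); have : expR (- (c * x)) <= 1.
    by rewrite -[leRHS]expR0 ler_expR oppr_le0 mulr_ge0// ltW.
  by move: (expR _) => E; lra.
apply: (@nondecreasing_controlled _ _ _ c) => // [x /f0/andP[h1 h2]|x y /= x0 y0 xy].
  by rewrite ler_norml h1 (le_trans h2).
rewrite ler_pdivrMr// mulrAC ler_pdivlMr//.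
have h : expR (- (c * x)) * (1 - c * (y - x)) <= expR (- (c * y)).
  have -> : expR (- (c * y)) = expR (- (c * x)) * expR (- (c * (y - x))).
    by rewrite -expRD; congr expR; ring.
  by rewrite ler_wpM2l ?expR_ge0// expR_ge1Dx.
have h' : expR (- (c * x)) * (1 + c * x) <= 1.
  rewrite -[leRHS](expRxMexpNx_1 (c * x)) mulrC ler_wpM2r ?expR_ge0//.
  exact: expR_ge1Dx.
have : 0 <= (y - x) * (1 - expR (- (c * x)) * (1 + c * x)).
  by rewrite mulr_ge0 ?subr_ge0.
have : 0 <= x * (expR (- (c * y)) - expR (- (c * x)) * (1 - c * (y - x))).
  by rewrite mulr_ge0 ?subr_ge0 ?(ltW x0).
by move: (expR _) (expR _) => E E'; lra.
Qed.

Lemma controlledS (A B : set R) f : A `<=` B -> controlled B f -> controlled A f.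
Proof.
move=> AB [h [K K0 [fK fh]]]; exists h, K => //; split => [x /AB/fK//|x y /AB Bx /AB By].
exact: fh.
Qed.

Lemma sechE (x : R) : sech x = 2 * (expR (- (2^-1 * x)) * (1 + expR (- x))^-1).
Proof.
rewrite /sech /cosh (_ : x / 2 = 2^-1 * x); last by rewrite mulrC.
rewrite (_ : expR (- x) = expR (- (2^-1 * x)) ^+ 2); last first.
  by rewrite expr2 -expRD; congr expR; field.
rewrite (_ : expR (2^-1 * x) = (expR (- (2^-1 * x)))^-1); last by rewrite -expRN opprK.
have := expR_gt0 (- (2^-1 * x)).
move: (expR _) => u u0; field.
by rewrite !gt_eqF// ?addr_gt0 ?mulr_gt0 ?exprn_gt0.
Qed.

Variable a : R.
Hypothesis a0 : 0 < a.

Definition laplace_exp (x : R) : R := expR (- (a * `|x|)).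
Definition laplace_sech (x : R) : R := laplace_exp x * sech x.

Lemma sechN (x : R) : sech (- x) = sech x.
Proof. by rewrite /sech /cosh !mulNr opprK addrC. Qed.

Lemma laplace_sechN x : laplace_sech (- x) = laplace_sech x.
Proof. by rewrite /laplace_sech /laplace_exp normrN sechN. Qed.

Lemma laplace_exp_continuous : continuous laplace_exp.
Proof.
move=> x; apply: (@continuous_comp _ _ _ (fun x : R => `|x|) (fun y => expR (- (a * y)))).
  exact: norm_continuous.
by apply: der_continuous; der.
Qed.

Lemma laplace_sech_continuous : continuous laplace_sech.
Proof. by move=> x; apply: cvgM; [exact: laplace_exp_continuous|exact: sech_continuous]. Qed.

Lemma integral_reflect (f : R -> R) : (forall x, 0 <= f x) -> continuous f ->
  (\int[mu]_(x in setT) (f x)%:E = \int[mu]_(x in `]0%R, +oo[) (f x + f (- x))%:E)%E.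
Proof.
move=> f0 cf; have mf : measurable_fun [set: R] f by exact: continuous_measurable_fun.
have mfN : measurable_fun [set: R] (fun x => f (- x)).
  by apply: continuous_measurable_fun => x; apply: continuous_comp; [exact: opp_continuous|exact: cf].
under [RHS]eq_integral do rewrite EFinD.
rewrite [RHS]ge0_integralD//; first last.
- by apply/measurable_EFinP; exact: measurable_funTS.
- by move=> x _; rewrite lee_fin.
- by apply/measurable_EFinP; exact: measurable_funTS.
- by move=> x _; rewrite lee_fin.
rewrite -(setUv (`]0, +oo[%classic : set R)) ge0_integral_setU//; first last.
- by apply/disj_setPCl.
- by move=> x _; rewrite lee_fin.
- by apply/measurable_EFinP; rewrite setUv.
- exact: measurableC.
congr (_ + _)%E; rewrite setCitvr.
rewrite -[X in `]-oo, X]%classic]oppr0 ge0_integration_by_substitutionNy//.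
- by rewrite [RHS]integral_itv_obnd_cbnd//; apply/measurable_EFinP; exact: measurable_funTS.
- exact: continuous_subspaceT.
Qed.

Lemma laplace_exp_integral : mu.-integrable setT (EFin \o laplace_exp).
Proof.
have m := continuous_measurable_fun laplace_exp_continuous.
apply/integrableP; split; first exact/measurable_EFinP.
have [ie eE] := exp_integral a0.
have ie2 := integrableZR 2 (measurable_itv _) ie.
rewrite (_ : (fun x => _) = (fun x => (laplace_exp x)%:E)); last first.
  by apply/funext => x /=; rewrite ger0_norm ?expR_ge0.
rewrite integral_reflect; [|by move=> x; exact: expR_ge0|exact: laplace_exp_continuous].
rewrite (_ : integral _ _ _ = \int[mu]_(x in `]0%R, +oo[) (2 * expR (- (a * x)))%:E)%E; last first.
  apply: eq_integral => x; rewrite inE /= in_itv /= andbT => x0.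
  by rewrite /laplace_exp normrN gtr0_norm//; congr (_%:E); ring.
by rewrite (integral_EFin ie2)// ltry.
Qed.

Lemma laplace_exp_integrable (g : R -> R) : continuous g -> (forall x, `|g x| <= 1) ->
  mu.-integrable setT (EFin \o (fun x => laplace_exp x * g x)).
Proof.
move=> cg g1; have L0 x : 0 <= laplace_exp x by exact: expR_ge0.
apply: (G_bounded_integrable laplace_exp_integral L0 (M := 1)) => //.
exact: continuous_measurable_fun.
Qed.

(** Adding 1 makes the integrand nonnegative, as [integral_reflect] requires; the case g = 0 is
    subtracted afterwards. *)
Let shift_integral (g : R -> R) : continuous g -> (forall x, `|g x| <= 1) ->
  \int[mu]_(x in setT) (laplace_exp x * (1 + g x)) =
  \int[mu]_(x in `]0, +oo[) (expR (- (a * x)) * (2 + (g x + g (- x)))).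
Proof.
move=> cg g1; rewrite /Rintegral integral_reflect; first last.
- move=> x; apply: cvgM; first exact: laplace_exp_continuous.
  by apply: cvgD; [exact: cvg_cst|exact: cg].
- move=> x; rewrite mulr_ge0 ?expR_ge0//.
  by have := g1 x; rewrite ler_norml; lra.
congr fine; apply: eq_integral => x; rewrite inE /= in_itv /= andbT => x0.
by rewrite /laplace_exp normrN gtr0_norm//; congr (_%:E); ring.
Qed.

Lemma laplace_exp_integralM (g : R -> R) : continuous g -> (forall x, `|g x| <= 1) ->
  \int[mu]_(x in setT) (laplace_exp x * g x) =
  \int[mu]_(x in `]0, +oo[) (expR (- (a * x)) * (g x + g (- x))).
Proof.
move=> cg g1; have ig := laplace_exp_integrable cg g1.
have c0 : continuous (cst 0 : R -> R) by exact: cst_continuous.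
have b0 (x : R) : `|cst 0 x : R| <= 1 by rewrite normr0.
have [ie _] := exp_integral a0.
have i2 := integrableZR 2 (measurable_itv _) ie.
have igD : mu.-integrable `]0, +oo[ (EFin \o (fun x => expR (- (a * x)) * (g x + g (- x)))).
  apply: (le_integrableR _ _ _ i2) => //.
    apply: measurable_funM.
      by apply: measurable_funTS; apply: continuous_measurable_fun => x; apply: der_continuous; der.
    apply: measurable_funTS; apply: continuous_measurable_fun => x; apply: cvgD; first exact: cg.
    by apply: continuous_comp; [exact: opp_continuous|exact: cg].
  move=> x _; rewrite normrM ger0_norm ?expR_ge0// mulrC ler_wpM2r ?expR_ge0//.
  by rewrite (le_trans (ler_normD _ _))// -[leRHS]/(1 + 1) lerD.
have E := shift_integral cg g1; have E0 := shift_integral c0 b0.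
have iL := laplace_exp_integral.
have L1 : \int[mu]_(x in setT) (laplace_exp x * (1 + g x)) =
    \int[mu]_(x in setT) laplace_exp x + \int[mu]_(x in setT) (laplace_exp x * g x).
  rewrite -(RintegralDR measurableT iL ig); apply: eq_Rintegral => x _; ring.
have L0 : \int[mu]_(x in setT) (laplace_exp x * (1 + cst 0 x)) = \int[mu]_(x in setT) laplace_exp x.
  by apply: eq_Rintegral => x _; rewrite /= addr0 mulr1.
have R1 : \int[mu]_(x in `]0, +oo[) (expR (- (a * x)) * (2 + (g x + g (- x)))) =
    \int[mu]_(x in `]0, +oo[) (2 * expR (- (a * x))) +
    \int[mu]_(x in `]0, +oo[) (expR (- (a * x)) * (g x + g (- x))).
  rewrite -(RintegralDR (measurable_itv _) i2 igD); apply: eq_Rintegral => x _; ring.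
have R0 : \int[mu]_(x in `]0, +oo[) (expR (- (a * x)) * (2 + (cst 0 x + cst 0 (- x)))) =
    \int[mu]_(x in `]0, +oo[) (2 * expR (- (a * x))).
  by apply: eq_Rintegral => x _ /=; ring.
move: E E0; rewrite L0 R0 L1 R1; move: (Rintegral _ _ _) (Rintegral _ _ _) => A B.
by move=> + E; rewrite E => /addrI.
Qed.

End laplace.

Section laplace_sech.
Context {R : realType}.
Notation mu := (@lebesgue_measure R).
Variable a : R.
Hypothesis a0 : 0 < a.

Lemma laplace_sech_admissible : normalized_admissible (laplace_sech a).
Proof.
have S0 x : 0 < sech x := sech_gt0 x.
have F0 : laplace_sech a 0 = 1.
  by rewrite /laplace_sech /laplace_exp normr0 mulr0 oppr0 expR0 sech0 mulr1.
split => //; split; last first.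
- move=> u; rewrite /fourier lecE /=.
  (* The cosh factor undoes the sech, so the transform is that of e^{-a|x|}, namely 2a/(a^2 + (2 pi
     u)^2). *)
  have GE x : laplace_sech a x * cosh (x / 2) = laplace_exp a x.
    by rewrite /laplace_sech /sech mulfVK// gt_eqF// cosh_gt0.
  have cc : continuous (fun x : R => cos (2 * pi * x * u)).
    by move=> x; apply: der_continuous; der.
  have cs : continuous (fun x : R => - sin (2 * pi * x * u)).
    by move=> x; apply: der_continuous; der.
  have bc (x : R) : `|cos (2 * pi * x * u)| <= 1 by rewrite ler_norml cos_geN1 cos_le1.
  have bs (x : R) : `|- sin (2 * pi * x * u)| <= 1 by rewrite normrN ler_norml sin_geN1 sin_le1.
  apply/andP; split.
    apply/eqP; transitivity (\int[mu]_(x in setT) (laplace_exp a x * - sin (2 * pi * x * u))).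
      by apply: eq_Rintegral => x _; rewrite GE /cis /= sinN mul0r addr0.
    rewrite laplace_exp_integralM//; transitivity (\int[mu]_(x in `]0, +oo[) (cst 0 x : R)).
      apply: eq_Rintegral => x _ /=.
      have -> : 2 * pi * (- x) * u = - (2 * pi * x * u) by ring.
      by rewrite sinN opprK addNr mulr0.
    by rewrite /Rintegral integral0.
  rewrite (_ : Rintegral _ _ _ = \int[mu]_(x in setT) (laplace_exp a x * cos (2 * pi * x * u))).
    rewrite laplace_exp_integralM//.
    have [ic cE] := exp_cos_integral (2 * pi * u) a0.
    rewrite (_ : Rintegral _ _ _ =
        \int[mu]_(x in `]0, +oo[) (2 * (expR (- (a * x)) * cos (2 * pi * u * x)))).
      rewrite (RintegralZR _ (measurable_itv _) ic) cE.
      by rewrite mulr_ge0// divr_ge0 ?(ltW a0)// addr_ge0 ?sqr_ge0.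
    apply: eq_Rintegral => x _.
    have -> : 2 * pi * (- x) * u = - (2 * pi * u * x) by ring.
    have -> : 2 * pi * x * u = 2 * pi * u * x by ring.
    by rewrite cosN; ring.
  by apply: eq_Rintegral => x _; rewrite GE /cis /= cosN mul0r subr0.
- by move=> x; exact: mulr_ge0 (expR_ge0 _) (ltW (S0 _ _)).
- by exists 0; rewrite F0 oner_neq0.
split.
- exact: laplace_sechN.
(* The decay rate is 1/2 + a: half of the surplus a puts the exponent above 1/2, the other half
   keeps the product integrable. *)
- exists (2^-1 + a / 2); first by rewrite div1r ltrDl divr_gt0.
  pose b := a / 2; have b_gt0 : 0 < b by rewrite divr_gt0.
  have b0 := ltW b_gt0.
  pose f x := laplace_sech a x * expR ((2^-1 + b) * `|x|).
  have fE x : f x = 2 * (expR (- (b * `|x|)) * (1 + expR (- `|x|))^-1).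
    have -> : f x = laplace_exp a x * sech `|x| * expR ((2^-1 + b) * `|x|).
      by rewrite /f /laplace_sech; have [x0|x0] := ger0P x; rewrite ?sechN.
    rewrite sechE /laplace_exp.
    transitivity (2 * ((expR (- (a * `|x|)) * expR (- (2^-1 * `|x|)) * expR ((2^-1 + b) * `|x|)) *
      (1 + expR (- `|x|))^-1)); first by ring.
    by rewrite -!expRD; congr (_ * (expR _ * _)); rewrite /b; field.
  split.
    have ib := @integrableZR _ _ _ 2 measurableT (laplace_exp_integral b_gt0).
    apply: (le_integrableR measurableT _ _ ib).
      apply: continuous_measurable_fun => x; apply: cvgM; first exact: laplace_sech_continuous.
      apply: (@continuous_comp _ _ _ (fun x : R => `|x|) (fun y => expR ((2^-1 + b) * y))).
        exact: norm_continuous.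
      by apply: der_continuous; der.
    move=> x _; rewrite -/(f x) fE ger0_norm; last first.
      by rewrite mulr_ge0// mulr_ge0 ?expR_ge0// invr_ge0 addr_ge0 ?expR_ge0.
    rewrite ler_wpM2l// ler_piMr ?expR_ge0// invf_le1 ?lerDl ?expR_ge0//.
  apply: (@symmetric_variation _ _ _ 1) => //; first by rewrite normr1.
    by move=> x _; rewrite -!/(f _) !fE normrN mul1r.
  apply: (@controlled_eq _ _ (fun x => 2 * (expR (- (b * x)) * (1 + expR (- x))^-1))).
    by move=> x [_ /= x0]; rewrite -/(f x) fE ger0_norm.
  apply: controlledM.
    apply: (@nondecreasing_controlled _ _ _ 2) => // x _; by rewrite ger0_norm.
  by apply: controlledM; [apply: exp_controlled => // x []|exact: logistic_controlled].
- apply: (@symmetric_variation _ _ _ (-1)) => /=.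
  + by move=> x; rewrite oppr_eq0.
  + by rewrite normrN normr1.
  + by move=> x _; rewrite laplace_sechN invrN mulrN mulN1r.
  have p2 : 0 <= 2^-1 :> R by rewrite invr_ge0.
  apply: (@controlledS _ _ [set x | 0 < x]) => [x [/= x0]|].
    by rewrite lt_neqAle eq_sym x0.
  have hs : [set x : R | 0 < x] `<=` [set x | 0 <= x] by move=> x /= /ltW.
  have c2 : controlled [set x : R | 0 < x] (fun=> 2).
    apply: (@nondecreasing_controlled _ _ _ 2) => // x _; by rewrite ger0_norm.
  have c1 : controlled [set x : R | 0 < x] (fun=> 1).
    apply: (@nondecreasing_controlled _ _ _ 1) => // x _; by rewrite normr1.
  have cl := logistic_controlled [set x : R | 0 < x].
  have ce := exp_controlled p2 hs.
  (* With u = e^{-x/2}, sech x - 1 = -(1 - u)^2/(1 + u^2), so (F - 1)/x is ((e^{-ax} - 1)/x) sech x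
     plus ((u - 1)/x) (1 - u)/(1 + u^2). *)
  have k1 := controlledM (exp_slope_controlled (ltW a0)) (controlledM c2 (controlledM ce cl)).
  have k2 := controlledM (exp_slope_controlled p2) (controlledM (controlledD c1 (controlledN ce)) cl).
  apply: controlled_eq (controlledD k1 k2) => x /= x0.
  rewrite F0 /laplace_sech /laplace_exp sechE gtr0_norm//.
  rewrite (_ : expR (- x) = expR (- (2^-1 * x)) ^+ 2); last first.
    by rewrite expr2 -expRD; congr expR; field.
  have := expR_gt0 (- (2^-1 * x)); move: (expR _) (expR _) => u E u0.
  by field; rewrite !gt_eqF// addr_gt0// exprn_gt0.
- move=> x; exists (laplace_sech a x), (laplace_sech a x); split.
  + by apply: cvg_at_left_filter; exact: laplace_sech_continuous.
  + by apply: cvg_at_right_filter; exact: laplace_sech_continuous.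
  + by field.
Qed.

Lemma laplace_sech_remainder t : 0 < t -> 0 <= sech t - laplace_sech a t <= a * t.
Proof.
move=> t0; rewrite /laplace_sech /laplace_exp gtr0_norm// -{1 3}[sech t]mul1r -mulrBl.
have e1 : expR (- (a * t)) <= 1 by rewrite -[leRHS]expR0 ler_expR oppr_le0 mulr_ge0 ?ltW.
have := expR_ge1Dx (- (a * t)) => e2.
rewrite mulr_ge0 ?subr_ge0 ?(ltW (sech_gt0 _))//=.
apply: (@le_trans _ _ (1 - expR (- (a * t)))); last by lra.
by rewrite ler_piMr ?subr_ge0// sech_le1.
Qed.

End laplace_sech.

Section universal_vector.
Context {R : realType}.
Notation mu := (@lebesgue_measure R).
Variable P : nat -> {poly R}.
Hypothesis hP : orthogonal_system P.
Variables (n : nat) (v : 'cV[R]_n.+1).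
Hypothesis hv : trig_coefficients P v.

(* As [a --> 0] the test functions [laplace_sech a] approach the extremal
   function [sech], which is not admissible. *)
Lemma universally_negative_multiple (x : 'cV[R]_n.+1) :
  (forall F, normalized_admissible F -> Q_form F (critical_scale v) x < 0) ->
  x = phi_form x *: v.
Proof.
move=> xneg; apply: (matrix_form_le0 hP hv).
pose w (i : nat) := x (inord i) 0.
pose K := \sum_(i < n.+1) \sum_(j < n.+1) `|w i * w j|.
have K0 : 0 <= K by apply: sumr_ge0 => i _; apply: sumr_ge0.
apply/ler_addgt0Pr => e e0; rewrite add0r.
(* Makes 16 a K, the bound on the weighted remainder, at most e. *)
pose a := e / (16 * K + 1).
have D0 : 0 < 16 * K + 1 by rewrite ltr_wpDl// mulr_ge0.
have a0 : 0 < a by rewrite divr_gt0.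
have nF := laplace_sech_admissible a0.
have mF : measurable_fun setT (laplace_sech a).
  by apply: continuous_measurable_fun; exact: laplace_sech_continuous.
have F0 : laplace_sech a 0 = 1 by case: nF.
have hF := laplace_sech_remainder a0.
have := xneg _ nF; rewrite (Q_form_remainder mF F0 hF) -/w.
have [iw _] := remainder_form_integral mF F0 hF n.+1 w.
rewrite subr_lt0 => /ltW/le_trans; apply.
have ir : mu.-integrable `]0, +oo[ (EFin \o remainder (laplace_sech a)).
  exact: remainder_integrable1 hF.
have iK := integrableZR K (measurable_itv _) ir.
apply: (@le_trans _ _ (\int[mu]_(t in `]0, +oo[) (K * remainder (laplace_sech a) t))).
  apply: (le_Rintegral _ iw iK) => // t /=; rewrite in_itv /= andbT => t0.
  rewrite mulrC ler_wpM2r//; first by have /andP[] := remainder_bound hF t0.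
  apply: geom_form_bound; rewrite expR_ge0 -[leRHS]expR0 ler_expR oppr_le0 ltW//.
rewrite (RintegralZR _ (measurable_itv _) ir).
have /andP[_ h] := remainder_integral_le mF hF.
apply: le_trans (ler_wpM2l K0 h) _.
rewrite /a mulrA mulrCA mulrA ler_pdivrMr//.
by rewrite mulrC; move: e0 K0; nra.
Qed.

End universal_vector.

Local Close Scope complex_scope.

(** * Irrationality of ln 2 *)

Section niven.
Context {R : realType}.

Definition niven_poly (m : nat) : {poly R} := m`!%:R^-1 *: ('X^m * (1 - 'X) ^+ m).

(** The value is i! c_i/m!, with c_i the integer coefficient of X^i in X^m (1 - X)^m; c_i is 0 for i
    < m, and m! divides i! otherwise. *)
Lemma niven_poly_derivn0_int m i : (niven_poly m)^`(i).[0] \is a Num.int.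
Proof.
rewrite horner_coef0 coef_derivn addn0 ffactnn /niven_poly coefZ.
have ci : ('X^m * (1 - 'X) ^+ m : {poly R})`_i \is a Num.int.
  apply/polyOverP; rewrite rpredM ?rpredX ?polyOverX//.
  by rewrite rpredB ?polyOverX// rpred1.
have [im|/bin_fact <-] := ltnP i m.
  by rewrite coefXnM im mulr0 mul0rn rpred0.
have D0 : (m`!%:R : R) != 0 by rewrite pnatr_eq0 -lt0n fact_gt0.
rewrite -[X in X \is a _]mulr_natr !natrM; move: (_`_i) ci => c ci.
rewrite (_ : _ * _ = c * ('C(i, m)%:R * (i - m)`!%:R)); last by field.
by rewrite rpredM// rpredM// natr_int.
Qed.

Lemma niven_poly_reflect m : niven_poly m \Po (1 - 'X) = niven_poly m.
Proof.
rewrite /niven_poly comp_polyZ comp_polyM !rmorphXn /= comp_polyX comp_polyB comp_polyC comp_polyX.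
by rewrite subKr mulrC.
Qed.

Lemma niven_poly_derivn1_int m i : (niven_poly m)^`(i).[1] \is a Num.int.
Proof.
have E : (niven_poly m)^`(i) \Po (1 - 'X) = (-1) ^+ i *: (niven_poly m)^`(i).
  elim: i => [|i IH]; first by rewrite expr0 scale1r niven_poly_reflect.
  rewrite [in RHS]derivnS exprS mulN1r scaleNr -(derivZ ((-1) ^+ i)) -IH.
  by rewrite deriv_comp derivB derivX -derivnS derivC sub0r mulrN1 opprK.
have := congr1 (horner^~ 1) E; rewrite horner_comp hornerZ !hornerE subrr => h.
rewrite -[X in X \is a _](signrMK i) -h rpredM ?niven_poly_derivn0_int//.
by rewrite rpredX// rpredN rpred1.
Qed.

Lemma niven_poly_bound m (x : R) : 0 < x < 1 -> 0 < (niven_poly m).[x] <= m`!%:R^-1.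
Proof.
move=> /andP[x0 x1]; rewrite /niven_poly hornerZ hornerM hornerXn horner_exp hornerD hornerN hornerC hornerX.
have m0 : 0 < (m`!%:R : R)^-1 by rewrite invr_gt0 ltr0n fact_gt0.
have y0 : 0 < 1 - x by rewrite subr_gt0.
rewrite mulr_gt0 ?(mulr_gt0 (exprn_gt0 _ x0)) ?exprn_gt0//= ler_piMr ?(ltW m0)//.
by rewrite mulr_ile1 ?exprn_ile1 ?exprn_ge0 ?ltW// ltrBlDr ltrDl.
Qed.

Variables p m : nat.
Let P : R := p%:R.

(** Chosen so that e^{Px} times it is an antiderivative of P^{2m+1} e^{Px} [niven_poly m]: the
    alternating derivatives telescope. *)
Definition niven_sum : {poly R} :=
  \sum_(i < (m + m).+1) ((-1) ^+ i * P ^+ (m + m - i)) *: (niven_poly m)^`(i).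

Lemma niven_sum_int (x : R) : (forall i, (niven_poly m)^`(i).[x] \is a Num.int) ->
  niven_sum.[x] \is a Num.int.
Proof.
move=> h; rewrite /niven_sum horner_sum rpred_sum// => i _; rewrite hornerZ rpredM//.
by rewrite rpredM ?rpredX ?rpredN ?rpred1// natr_int.
Qed.

Lemma niven_sum_deriv : P *: niven_sum + niven_sum^`() = P ^+ (m + m).+1 *: niven_poly m.
Proof.
pose u (i : nat) : {poly R} := ((-1) ^+ i * P ^+ ((m + m).+1 - i)) *: (niven_poly m)^`(i).
have sz : (size (niven_poly m) <= (m + m).+1)%N.
  rewrite (leq_trans (size_scale_leq _ _))// (leq_trans (size_polyMleq _ _))//.
  rewrite size_polyXn /= -addnS leq_add2l (leq_trans (size_poly_exp_leq _ _))//.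
  have : (size (1 - 'X : {poly R})%R <= 2)%N.
    by rewrite (leq_trans (size_polyD _ _))// geq_max size_polyN size_polyX size_polyC oner_eq0.
  by move: (size _) => [|[|[|k]]] //= _; lia.
transitivity (\sum_(i < (m + m).+1) (u i - u i.+1)).
  rewrite /niven_sum scaler_sumr raddf_sum /= -big_split /=; apply: eq_bigr => i _.
  rewrite /u scalerA derivZ -derivnS subSS exprS mulN1r mulNr scaleNr opprK; congr (_ *: _ + _).
  by rewrite mulrCA -exprS subSn// -ltnS.
rewrite -(big_mkord xpredT (fun i => u i - u i.+1)).
under eq_bigr do rewrite -opprB.
rewrite sumrN telescope_sumr// opprB {2}/u derivn_poly0// scaler0 subr0.
by rewrite /u subn0 expr0 mul1r.
Qed.

Lemma niven_mean_value : exists2 c, 0 < c < 1 &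
  expR P * niven_sum.[1] - niven_sum.[0] = P ^+ (m + m).+1 * expR (P * c) * (niven_poly m).[c].
Proof.
pose h (x : R) := expR (P * x) * niven_sum.[x].
have dh (x : R) : has_der h x (P ^+ (m + m).+1 * expR (P * x) * (niven_poly m).[x]).
  have E := congr1 (horner^~ x) niven_sum_deriv; move: E; rewrite hornerD !hornerZ => E.
  rewrite -mulrA mulrCA -E mulrDr.
  apply: der_eq; first by rewrite /h; der.
  by rewrite /= derive_val; ring.
have hc : {within `[0, 1], continuous h}.
  by apply: continuous_subspaceT => x; exact: der_continuous (dh x).
have [c] := MVT ltr01 (fun x _ => dh x) hc.
rewrite in_itv /= => c01; rewrite /h mulr1 mulr0 expR0 mul1r subr0 mulr1 => E.
by exists c.
Qed.

End niven.

Section ln2.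
Context {R : realType}.

(** For integral e^p the left side of [niven_mean_value] is an integer, while its right side lies
    strictly between 0 and 1 for a suitable m. *)
Lemma expR_nat_notin_int (p : nat) : (0 < p)%N -> expR (p%:R : R) \isn't a Num.int.
Proof.
move=> p0; apply/negP => eint; pose P : R := p%:R.
have P0 : 0 < P by rewrite ltr0n.
have [m _ hm] : exists2 m, True & P * expR P * ((P ^+ 2) ^+ m / m`!%:R) < 1.
  have : P * expR P * ((P ^+ 2) ^+ m / m`!%:R) @[m --> \oo] --> P * expR P * 0.
    by apply: cvgMr; exact: pi_irrational.exp_fact.
  rewrite mulr0 => /cvgrPdist_lt /(_ 1 ltr01) [N _ hN]; exists N => //.
  have := hN N (leqnn N); rewrite /= sub0r normrN; apply: le_lt_trans; exact: ler_norm.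
have [c c01 E] := @niven_mean_value R p m; move: E; rewrite -/P => E.
have Z : expR P * (niven_sum p m).[1] - (niven_sum p m).[0] \is a Num.int.
  rewrite rpredB ?rpredM ?niven_sum_int// => i.
  - exact: niven_poly_derivn1_int.
  - exact: niven_poly_derivn0_int.
have /andP[f0 f1] := niven_poly_bound m c01.
have Q0 : 0 < P ^+ (m + m).+1 * expR (P * c) by rewrite mulr_gt0 ?exprn_gt0 ?expR_gt0.
have lt0 : 0 < expR P * (niven_sum p m).[1] - (niven_sum p m).[0].
  by rewrite E mulr_gt0.
have lt1 : expR P * (niven_sum p m).[1] - (niven_sum p m).[0] < 1.
  rewrite E (le_lt_trans _ hm)//.
  apply: (@le_trans _ _ (P ^+ (m + m).+1 * expR P * m`!%:R^-1)).
    rewrite ler_pM ?(ltW Q0) ?(ltW f0)// ler_pM2l ?exprn_gt0// ler_expR ler_piMr ?(ltW P0)//.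
    by have /andP[_ /ltW] := c01.
  by rewrite exprS -exprM mul2n addnn [P * _ * _]mulrAC !mulrA.
move: Z lt0 lt1 => /intrP[z ->]; rewrite ltr0z -[1]/(1%:~R) ltr_int; lia.
Qed.

Lemma ln2_irrational (r : rat) : ln 2 != ratr r :> R.
Proof.
apply/eqP => E; have l2 : 0 < ln 2 :> R by rewrite ln_gt0// ltr1n.
have r0 : 0 < r by rewrite -(ltr0q R) -E.
have n0 : 0 < numq r by rewrite numq_gt0.
have d0 : 0 < denq r by rewrite denq_gt0.
have nE : numq r = `|numq r|%N :> int by rewrite gtz0_abs.
have dE : denq r = `|denq r|%N :> int by rewrite gtz0_abs.
have {E} : `|denq r|%:R * ln 2 = `|numq r|%:R :> R.
  rewrite E /ratr -[`|numq r|%:R]/(Posz `|numq r|)%:~R -[`|denq r|%:R]/(Posz `|denq r|)%:~R.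
  by rewrite -nE -dE mulrCA divff ?mulr1// intr_eq0 denq_neq0.
move=> /(congr1 expR); rewrite expRM_natl lnK ?posrE// => E.
have q0 : (0 < `|numq r|)%N by rewrite absz_gt0 gt_eqF.
by have := expR_nat_notin_int q0; rewrite -E rpredX ?natr_int.
Qed.

End ln2.

(** * Rationality of the coefficient vector *)

Section rational_kernel.
Context {R : realType}.

(** Increments of [kernD2] collected from 0 or 1 up to m: odd denominators for even m, even ones for
    odd m. *)
Definition kern_rat (m : nat) : rat := \sum_(k < m./2) 2 / (k.*2 + odd m).+1%:R.

Lemma kern_natE m :
  kern m%:R = kern 0 + (odd m)%:R * (2 * ln 2) + ratr (kern_rat m) :> R.
Proof.
elim/ltn_ind: m => -[|[|m]] IH.
- by rewrite /kern_rat /= big_ord0 [ratr 0]rmorph0 mul0r !addr0.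
- by rewrite /kern_rat /= big_ord0 [ratr 0]rmorph0 mul1r addr0 -kern1B0 addrC subrK.
rewrite -[m.+2]addn2 natrD kernD2 ?ler0n// IH// -!addrA; congr (_ + _).
rewrite oddD addbF; congr (_ + _); rewrite /kern_rat oddD addbF halfD andbF add0n addn1.
rewrite big_ord_recr rmorphD /=; congr (_ + _).
by rewrite addnC odd_double_half rmorphM fmorphV /= !ratr_nat natr1.
Qed.

Lemma odd_natdist i j : odd (natdist i j) = odd i (+) odd j.
Proof.
rewrite /natdist; have [ij|/ltnW ij] := leqP i j; move: (ij); rewrite -subn_eq0 => /eqP ->.
  by rewrite add0n oddB// addbC.
by rewrite addn0 oddB.
Qed.

(** Membership in a row space is insensitive to field extension, so real solvability yields a
    rational solution, and uniqueness identifies it with z. *)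
Lemma rational_solution (k m : nat) (M : 'M[rat]_(k, m)) (c : 'rV[rat]_m) (z : 'rV[R]_k) :
  z *m map_mx ratr M = map_mx ratr c ->
  (forall w : 'rV[R]_k, w *m map_mx ratr M = 0 -> w = 0) ->
  exists u : 'rV[rat]_k, z = map_mx ratr u.
Proof.
move=> zM inj; have : (map_mx ratr c <= (map_mx ratr M : 'M[R]_(k, m)))%MS.
  by apply/submxP; exists z.
rewrite map_submx => /submxP[u cE]; exists u; apply/eqP; rewrite -subr_eq0; apply/eqP.
by apply: inj; rewrite mulmxBl zM -map_mxM -cE subrr.
Qed.

End rational_kernel.

Section rationality.
Context {R : realType}.
Variable P : nat -> {poly R}.
Hypothesis hP : orthogonal_system P.
Variables (n : nat) (v : 'cV[R]_n.+1).
Hypothesis hv : trig_coefficients P v.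

Definition kern_rat_row (x : 'cV[R]_n.+1) (i : nat) : R :=
  \sum_(j < n.+1) x j 0 * ratr (kern_rat (natdist i j)).

(** The coefficient of 2 ln 2 in row i of A x. *)
Definition odd_sum (x : 'cV[R]_n.+1) (i : nat) : R :=
  \sum_(j < n.+1) x j 0 * (odd i (+) odd j)%:R.

Lemma kern_row_rat (x : 'cV[R]_n.+1) (i : nat) :
  kern_row x i = phi_form x * kern 0 + odd_sum x i * (2 * ln 2) + kern_rat_row x i.
Proof.
rewrite /phi_form !mulr_suml -!big_split; apply: eq_bigr => j _ /=.
by rewrite kern_natE odd_natdist; ring.
Qed.

Lemma odd_sum_add (x : 'cV[R]_n.+1) i : odd_sum x i + odd_sum x i.+1 = phi_form x.
Proof.
rewrite -big_split; apply: eq_bigr => j _ /=.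
by rewrite -mulrDr; case: (odd i); case: (odd j); rewrite /= ?addr0 ?add0r mulr1.
Qed.

Lemma odd_sum_parity (x : 'cV[R]_n.+1) i : odd_sum x i = odd_sum x (odd i).
Proof. by apply: eq_bigr => j _; case: (odd i). Qed.

(** Equality of rows 0 and 1 of A v would express ln 2 times the alternating sum of v by rationals,
    and that sum is nonzero for even n. *)
Lemma extremal_irrational : (0 < n)%N -> ~~ odd n ->
  ~ exists u : 'cV[rat]_n.+1, v = map_mx ratr u.
Proof.
move=> n0 nev [u vu].
have phi1 : phi_form v = 1 := trig_sum1 hP hv.
have := kern_row_const hP hv n0; rewrite !kern_row_rat.
have S := odd_sum_add v 0.
pose s : rat := \sum_(k < n.+1) (-1) ^+ k * u k 0.
have sE : odd_sum v 1 - odd_sum v 0 = ratr s.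
  rewrite rmorph_sum -sumrB; apply: eq_bigr => k _ /=.
  rewrite rmorphM rmorphXn rmorphN rmorph1 vu !mxE -signr_odd.
  by case: (odd k) => /=; rewrite ?mulr1 ?mulr0 ?expr1 ?expr0; ring.
have s0 : s != 0.
  have := alternating_sum_neq0 hP hv nev; apply: contraNneq => s0.
  rewrite (_ : \sum_(k < _) _ = ratr s); first by rewrite s0 rmorph0.
  rewrite rmorph_sum; apply: eq_bigr => k _ /=.
  by rewrite rmorphM rmorphXn rmorphN rmorph1 vu !mxE.
have rE i : kern_rat_row v i = ratr (\sum_(j < n.+1) u j 0 * kern_rat (natdist i j)).
  rewrite rmorph_sum; apply: eq_bigr => j _ /=; by rewrite rmorphM vu mxE.
rewrite !rE; set q1 := \sum_(j < _) _; set q0 := \sum_(j < _) _ => E.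
have /eqP := @ln2_irrational R ((q0 - q1) / (2 * s)); apply.
have {}E : 2 * ln 2 * ratr s = ratr q0 - ratr q1 :> R.
  by rewrite -sE; move: E; rewrite -!addrA => /addrI; lra.
rewrite fmorph_div rmorphB rmorphM /= ratr_nat -E.
by field; rewrite fmorph_eq0.
Qed.

(** The system asks for constant rational rows, sum 1 and [odd_sum] 1/2. The last condition, known
    for v by symmetry, replaces the terms in ln 2. *)
Lemma extremal_rational : odd n -> exists u : 'cV[rat]_n.+1, v = map_mx ratr u.
Proof.
move=> n_odd; have phi1 : phi_form v = 1 := trig_sum1 hP hv.
(* For odd n the reversal j -> n - j exchanges the two parities. *)
have S : odd_sum v 0 = 2^-1.
  have := odd_sum_add v 0; rewrite phi1 (_ : odd_sum v 1 = odd_sum v 0); first by lra.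
  rewrite /odd_sum [LHS](reindex_inj rev_ord_inj); apply: eq_bigr => j _ /=.
  rewrite -(trig_symmetric hv) oddB ?ltn_ord// /= n_odd /=; congr (_ * _%:R).
  by case: (odd j).
pose M1 : 'M[rat]_n.+1 :=
  \matrix_(j, i) (kern_rat (natdist i j) - kern_rat (natdist 0 j)).
pose M2 : 'M[rat]_(n.+1, 2) := \matrix_(j, i) (if i == 0 then 1 else (odd j)%:R).
pose c : 'rV[rat]_2 := \row_i (if i == 0 then 1 else 2^-1).
have mulM1 (w : 'cV[R]_n.+1) i :
    (w^T *m map_mx ratr M1) 0 i = kern_rat_row w i - kern_rat_row w 0.
  rewrite mxE -sumrB; apply: eq_bigr => j _; rewrite !mxE rmorphB mulrBr //.
have mulM2 (w : 'cV[R]_n.+1) i :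
    (w^T *m map_mx ratr M2) 0 i = if i == 0 then phi_form w else odd_sum w 0.
  rewrite mxE; case: ifPn => i0; apply: eq_bigr => j _; rewrite !mxE.
    by rewrite i0 rmorph1 mulr1.
  by rewrite (negbTE i0) ratr_nat.
have [||u vu] := @rational_solution R _ _ (row_mx M1 M2) (row_mx 0 c) v^T.
- rewrite map_row_mx mul_mx_row map_row_mx map_mx0; congr row_mx; apply/rowP => i.
    rewrite mulM1 mxE; have := kern_row_const hP hv (_ : i <= n)%N; rewrite -ltnS ltn_ord => /(_ isT).
    rewrite !kern_row_rat (odd_sum_parity v i).
    have S1 : odd_sum v 1 = odd_sum v 0 by have := odd_sum_add v 0; rewrite S phi1; lra.
    by case: (odd i); rewrite ?S1 => /addrI ->; rewrite subrr.
  rewrite mulM2 !mxE phi1 S; case: ifP => _; first by rewrite rmorph1.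
  by rewrite fmorphV /= ratr_nat.
- move=> w; rewrite map_row_mx mul_mx_row => /eqP; rewrite row_mx_eq0 => /andP[/eqP w1 /eqP w2].
  have {}w1 i : (i <= n)%N -> kern_rat_row w^T i = kern_rat_row w^T 0.
    move=> ni; apply/eqP; rewrite -subr_eq0 -(inordK (_ : i < n.+1)%N)// -mulM1.
    by rewrite trmxK w1 mxE.
  have phi0 : phi_form w^T = 0 by have := mulM2 w^T 0; rewrite trmxK w2 mxE eqxx.
  have odd0 : odd_sum w^T 0 = 0 by have := mulM2 w^T 1; rewrite trmxK w2 mxE.
  have oddi i : odd_sum w^T i = 0.
    rewrite odd_sum_parity; case: (odd i) => //=.
    by have := odd_sum_add w^T 0; rewrite odd0 phi0 add0r.
  apply: trmx_inj; rewrite trmx0; apply/eqP/negPn/negP => wn.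
  (* A homogeneous solution w has constant rows in A w and sum 0, so w^T A w = 0, against
     definiteness. *)
  have := matrix_form_lt0 phi0 wn; rewrite ltNge => /negP; apply.
  have row i : (i <= n)%N -> kern_row w^T i = kern_row w^T 0.
    by move=> ni; rewrite !kern_row_rat !oddi phi0 w1.
  rewrite /matrix_form (eq_bigr (fun i : 'I_n.+1 => w^T i 0 * kern_row w^T 0)).
    by rewrite -mulr_suml -/(phi_form _) phi0 mul0r.
  move=> i _; rewrite -(row i) ?leq_ord// mulr_sumr; apply: eq_bigr => j _; by rewrite mulrA.
by exists u^T; rewrite -map_trmx -vu trmxK.
Qed.

End rationality.

(** * From real to integral vectors *)

Section quadratic_form.
Context {R : realType}.
Variables (F : R -> R) (r : R) (n : nat).
Implicit Types x y : 'cV[R]_n.+1.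

Let q (i j : 'I_n.+1) : R := ln (2 * pi / r) - psi_of (damped F) `|i%:R - j%:R|.

Lemma Q_formE x :
  Q_form F r x = \sum_(i < n.+1) \sum_(j < n.+1) x i 0 * x j 0 * q i j.
Proof.
rewrite /Q_form /q_form expr2 mulr_suml mulr_sumr -sumrB; apply: eq_bigr => i _.
rewrite !mulr_sumr -sumrB; apply: eq_bigr => j _; rewrite /q; ring.
Qed.

Lemma Q_formZ (a : R) x : Q_form F r (a *: x) = a ^+ 2 * Q_form F r x.
Proof.
rewrite !Q_formE mulr_sumr; apply: eq_bigr => i _; rewrite mulr_sumr.
by apply: eq_bigr => j _; rewrite !mxE; ring.
Qed.

(** Writing y = N x + d with |d_i| <= 1, the cross terms and the terms in d alone are of order N. *)
Lemma Q_form_perturb x : exists K, forall (N : nat) y, (0 < N)%N ->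
  (forall i, `|y i 0 - N%:R * x i 0| <= 1) ->
  Q_form F r y <= N%:R ^+ 2 * Q_form F r x + N%:R * K.
Proof.
exists (\sum_(i < n.+1) \sum_(j < n.+1) (`|x i 0| + `|x j 0| + 1) * `|q i j|).
move=> N y N0 hy; rewrite !Q_formE !mulr_sumr -big_split; apply: ler_sum => i _ /=.
rewrite !mulr_sumr -big_split; apply: ler_sum => j _ /=.
have N1 : 1 <= N%:R :> R by rewrite ler1n.
have := hy i; have := hy j; set e := y j 0 - _; set d := y i 0 - _ => e1 d1.
have -> : y i 0 = N%:R * x i 0 + d by rewrite /d addrC subrK.
have -> : y j 0 = N%:R * x j 0 + e by rewrite /e addrC subrK.
rewrite -lerBlDl [leLHS](_ : _ = (N%:R * (x i 0 * e + d * x j 0) + d * e) * q i j); last by ring.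
rewrite (le_trans (ler_norm _))// normrM mulrA ler_wpM2r//.
rewrite (le_trans (ler_normD _ _))// [leRHS]mulrDr lerD//.
  rewrite normrM (ger0_norm (ler0n _ _)) ler_wpM2l// (le_trans (ler_normD _ _))// !normrM lerD//.
    by rewrite ler_piMr.
  by rewrite ler_piMl.
by rewrite mulr1 (le_trans _ N1)// normrM mulr_ile1.
Qed.

End quadratic_form.

Section integral_vectors.
Context {R : realType}.

(** Rounding N v costs at most N K, which N^2 |Q_F(v)| exceeds once N > K/|Q_F(v)|. Both K and N
    depend on F. *)
Lemma natural_approximation (F : R -> R) (r : R) n (v : 'cV[R]_n.+1) :
  (forall k, 0 < v k 0) -> (forall k, v k 0 = v (rev_ord k) 0) -> Q_form F r v < 0 ->
  exists x : 'cV[int]_n.+1,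
    [/\ positive_vector x, symmetric_vector x & Q_int F r x < 0].
Proof.
move=> v0 vsym Qv; have [K hK] := Q_form_perturb F r v.
have d0 : 0 < - Q_form F r v by rewrite oppr_gt0.
pose N := (Num.truncn (K / - Q_form F r v)).+1.
have NK : K / - Q_form F r v < N%:R := truncnS_gt _.
(* Truncation plus 1, so that small coordinates stay positive. *)
exists (\col_k (Num.truncn (N%:R * v k 0)).+1%:Z); split.
- by move=> k; rewrite mxE.
- by move=> k; rewrite !mxE -vsym.
have N0 : 0 < N%:R :> R by rewrite ltr0n.
rewrite /Q_int (le_lt_trans (hK N _ _ _))//.
  move=> i; rewrite !mxE /=.
  have t0 : 0 <= N%:R * v i 0 by rewrite mulr_ge0 ?ltW.
  have /andP[h1 h2] := truncn_itv t0.
  by rewrite -pmulrn ger0_norm ?subr_ge0 ?(ltW h2)// -natr1 lerBlDr addrC lerD2l.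
rewrite expr2 -mulrA -mulrDr pmulr_rlt0// -ltrBrDl sub0r -mulrN.
by rewrite -ltr_pdivrMr.
Qed.

Lemma common_denominator n (u : 'cV[rat]_n.+1) :
  exists2 d : nat, (0 < d)%N & exists x : 'cV[int]_n.+1, forall k,
    (x k 0)%:~R = d%:R * u k 0 :> rat.
Proof.
exists (\prod_(k < n.+1) `|denq (u k ord0)|)%N.
  by rewrite prodn_gt0// => k; rewrite absz_gt0 denq_neq0.
exists (\col_k (numq (u k 0) * (\prod_(j < n.+1 | j != k) `|denq (u j ord0)|)%N%:Z)) => k.
rewrite mxE [in RHS](bigD1 k)//= natrM rmorphM /= mulrAC; congr (_ * _).
rewrite -{3}[u k 0]divq_num_den mulrC.
rewrite (_ : `|denq (u k 0)|%:R = (denq (u k 0))%:~R); last by rewrite -[in RHS](gtz0_abs (denq_gt0 _)).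
by rewrite mulfVK// intr_eq0 denq_neq0.
Qed.

Lemma rational_multiple n (v : 'cV[R]_n.+1) (u : 'cV[rat]_n.+1) :
  v = map_mx ratr u -> (forall k, 0 < v k 0) -> (forall k, v k 0 = v (rev_ord k) 0) ->
  exists x : 'cV[int]_n.+1, [/\ positive_vector x, symmetric_vector x &
    exists2 d : R, 0 < d & map_mx intr x = d *: v].
Proof.
move=> vu v0 vsym; have [d d0 [x xE]] := common_denominator u.
have xv k : (x k 0)%:~R = d%:R * v k 0 :> R.
  have := congr1 (ratr : rat -> R) (xE k).
  by rewrite rmorphM /= ratr_int ratr_nat vu mxE.
have dR : 0 < d%:R :> R by rewrite ltr0n.
exists x; split.
- by move=> k; rewrite -(ltr0z R) xv mulr_gt0.
- by move=> k; apply: (intr_inj (R := R)); rewrite !xv -vsym.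
by exists d%:R => //; apply/matrixP => i j; rewrite ord1 !mxE xv.
Qed.

End integral_vectors.

Local Close Scope classical_set_scope.

Theorem theorem3p6 (R : realType) (P : nat -> {poly R})
    (hP : orthogonal_system P) (n : nat) (v : 'cV[R]_n.+1)
    (hv : trig_coefficients P v) :
  let negative (F : R -> R) (x : 'cV[int]_n.+1) :=
    Q_int F (critical_scale v) x < 0 in
  [/\ (exists x : 'cV[int]_n.+1,
         [/\ x != 0, nonneg_vector x
           & forall F, normalized_admissible F -> negative F x])
      <-> (n = 0%N \/ odd n),
      (n = 0%N \/ odd n) ->
      exists x : 'cV[int]_n.+1,
        [/\ positive_vector x, symmetric_vector x
          & forall F, normalized_admissible F -> negative F x]
    & (0 < n)%N -> ~~ odd n ->
      (forall F, normalized_admissible F ->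
         exists x : 'cV[int]_n.+1,
           [/\ positive_vector x, symmetric_vector x & negative F x])
      /\ ~ (exists x : 'cV[int]_n.+1,
              x != 0 /\ forall F, normalized_admissible F -> negative F x)].
Proof.
move=> negative.
have v0 := extremal_vector_gt0 hP hv; have vsym := trig_symmetric hv.
have Qv F (nF : normalized_admissible F) := Q_form_extremal_lt0 nF hP hv.
have pos : n = 0%N \/ odd n -> exists x : 'cV[int]_n.+1,
    [/\ positive_vector x, symmetric_vector x
      & forall F, normalized_admissible F -> negative F x].
  move=> hn; have [u vu] : exists u : 'cV[rat]_n.+1, v = map_mx ratr u.
    case: hn => [n0|]; last exact: (extremal_rational hP hv).
    (* For n = 0 the single entry of v is its sum, 1. *)
    exists (const_mx 1); apply/matrixP => i j; rewrite ord1 !mxE rmorph1.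
    have := trig_sum1 hP hv; rewrite (bigD1 i)//= big1 ?addr0// => k /eqP[].
    by apply/val_inj => /=; have := ltn_ord k; have := ltn_ord i; lia.
  have [x [x0 xsym [d d0 xE]]] := rational_multiple vu v0 vsym.
  exists x; split => // F nF; rewrite /negative /Q_int xE Q_formZ.
  by rewrite pmulr_rlt0 ?exprn_gt0// Qv.
have neg : (0 < n)%N -> ~~ odd n -> ~ (exists x : 'cV[int]_n.+1,
    x != 0 /\ forall F, normalized_admissible F -> negative F x).
  move=> n0 nev [x [x0 xneg]].
  have xE := universally_negative_multiple hP hv xneg.
  apply: (extremal_irrational hP hv n0 nev).
  (* Sum 0 would make x the zero multiple of v; hence v = x/phi(x) would be rational. *)
  have phi0 : phi_form (map_mx intr x : 'cV[R]_n.+1) != 0.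
    apply: contraNneq x0 => phi0; move: xE; rewrite phi0 scale0r => /matrixP xE.
    by apply/eqP/matrixP => i j; apply: (intr_inj (R := R)); have := xE i j; rewrite !mxE.
  pose s : int := \sum_j x j 0.
  have sE : phi_form (map_mx intr x : 'cV[R]_n.+1) = s%:~R.
    by rewrite /s rmorph_sum; apply: eq_bigr => j _; rewrite mxE.
  exists (\col_k ((x k 0)%:~R / s%:~R)); apply/matrixP => i j; rewrite ord1.
  have /matrixP/(_ i 0) := xE; rewrite !mxE sE fmorph_div /= !ratr_int => ->.
  by rewrite mulrAC divff ?mul1r// -sE.
split; [split|exact: pos|].
- move=> [x [x0 _ xneg]]; have [/eqP ->|n0] := boolP (n == 0%N); first by left.
  right; apply/negPn/negP => nev; apply: (neg _ nev); first by rewrite lt0n.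
  by exists x.
- move=> /pos[x [x0 xsym xneg]]; exists x; split => //; last by move=> k; exact: ltW (x0 k).
  by apply/eqP => xE; have := x0 ord0; rewrite xE mxE ltxx.
move=> n0 nev; split; last exact: neg.
by move=> F nF; apply: natural_approximation => //; exact: Qv.
Qed.
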